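(* Let $q\in L^1_{\mathrm{loc}}(\mathbb{R}_+)$ be real-valued and let $\tau=-\frac{d^2}{dx^2}+\frac{l(l+1)}{x^2}+q(x)$ on $\mathbb{R}_+=(0,\infty)$. Assume one of the following: (a) $l>-\frac12$ and $x\,q(x)\in L^p(0,1)$ with $p\in[1,\infty]$; (b) $l=-\frac12$ and $x\,q(x)\in L^p(0,1)$ with $p\in(1,\infty]$; (c) $l=-\frac12$, $p=1$ and $(1-\log x)\,x\,q(x)\in L^1(0,1)$. Then there exist two linearly independent solutions $\phi(z,x)$ and $\theta(z,x)$ of $\tau u=zu$ such that $$\phi(z,x)=x^{l+1}\widetilde\phi(z,x),\qquad \theta(z,x)=\begin{cases}\frac{x^{-l}}{2l+1}\widetilde\theta(z,x), & l>-\frac12,\\ -\log(x)\,x^{1/2}\,\widetilde\theta(z,x), & l=-\frac12,\end{cases}\qquad \widetilde\phi(z,0)=\widetilde\theta(z,0)=1,$$ where $\widetilde\phi(z,\cdot)\in W^{1,p}(0,1)$, and - if $l>0$: $\widetilde\theta(z,\cdot)\in W^{1,p}(0,1)$; - if $-\frac12<l\le0$: $\widetilde\theta(z,\cdot)\in W^{1,r}(0,1)$ for every $r\in[1,p]$ with $r<\frac{-1}{2l}$ (with $\frac{-1}{2l}=\infty$ for $l=0$); - if $l=-\frac12$: $\widetilde\theta(z,\cdot)\in C[0,1]$. Moreover, for $l>-\frac12$, $$\lim_{x\to0}x\,\widetilde\phi'(z,x)=\lim_{x\to0}x\,\widetilde\theta'(z,x)=0\quad\text{and}\quad \lim_{x\to0}W_x(\theta(z),\phi(\zeta))=1.$$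 The functions $\phi(z,x)$ and $\theta(z,x)$ can be chosen entire with respect to $z$ and such that $\widetilde\phi,\widetilde\theta\in C(\mathbb{C}\times[0,1])$.
   Context: $z,\zeta\in\mathbb{C}$. $W_x(f,g)=f(x)g'(x)-f'(x)g(x)$ is the Wronskian; primes denote derivatives with respect to $x$. $W^{1,p}(0,1)$ is the Sobolev space of absolutely continuous functions whose derivative is in $L^p(0,1)$.
   Formalization: For l=-1/2 the formula for θ is claimed for x>0, x≠1, and θ̃ is continuous on [0,1) and C×[0,1) only: continuity at x=1, where log x=0, would force θ(z,1)=0, contradicting linear independence when φ(z,1)=0 (e.g. q=0, √z a zero of J_0). *)

(* Defs.v *)
From mathcomp Require Import all_boot all_order all_algebra.
From mathcomp Require Import all_classical all_reals all_analysis.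
From mathcomp Require Export complex.

Set Implicit Arguments.
Unset Strict Implicit.
Unset Printing Implicit Defensive.

Import Order.TTheory GRing.Theory Num.Theory.
Import numFieldNormedType.Exports.

Local Open Scope classical_set_scope.
Local Open Scope ring_scope.
Local Open Scope complex_scope.

Section Defs.
Context {R : realType}.
Implicit Types (f g u : R -> R[i]) (p : \bar R) (a b x l : R) (z : R[i]).

Local Notation mu := (@lebesgue_measure R).
Local Notation unit_itv := (`]0, 1[%classic : set R).
Local Notation normc := (@ComplexField.Normc.normc R).

(* The library has no normed R-module structure on R[i], so derivatives with
   respect to a real variable are taken componentwise. *)
Definition cderivable f x :=
  derivable (@complex.Re R \o f) x 1 /\ derivable (@complex.Im R \o f) x 1.

Definition cderive f x : R[i] :=
  derive1 (@complex.Re R \o f) x +i* derive1 (@complex.Im R \o f) x.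

Definition wronskian f g x : R[i] := f x * cderive g x - cderive f x * g x.

Definition abs_continuous a b f :=
  forall e : R, 0 < e -> exists2 d : R, 0 < d &
    forall (n : nat) (s t : 'I_n -> R),
      (forall i, [/\ a <= s i, s i <= t i & t i <= b]) ->
      trivIset [set: 'I_n] (fun i => `]s i, t i[%classic) ->
      \sum_(i < n) (t i - s i) < d ->
      \sum_(i < n) normc (f (t i) - f (s i)) < e.

Definition loc_abs_continuous f :=
  forall a b, 0 < a -> a <= b -> abs_continuous a b f.

(* L^p(0,1), through extension by zero *)
Definition Lp01 p (h : R -> R) : Prop := h \_ unit_itv \in Lfun mu p.

Definition cLp01 p g :=
  [/\ measurable_fun unit_itv (@complex.Re R \o g),
      measurable_fun unit_itv (@complex.Im R \o g) & Lp01 p (normc \o g)].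

(* W^{1,p}(0,1); f is the continuous representative, so that f 0 is its value
   at the endpoint *)
Definition W1p01 p f :=
  abs_continuous 0 1 f /\
  exists2 g, cLp01 p g &
    {ae mu, forall x, 0 < x < 1 -> cderivable f x /\ cderive f x = g x}.

(* u solves - u'' + (l (l + 1) / x^2 + q) u = z u on (0, +oo): u and u' are
   locally absolutely continuous and the equation holds almost everywhere *)
Definition solution l (q : R -> R) z u :=
  [/\ forall x, 0 < x -> cderivable u x,
      loc_abs_continuous u, loc_abs_continuous (cderive u) &
      {ae mu, forall x, 0 < x ->
         cderivable (cderive u) x /\
         - cderive (cderive u) x + (l * (l + 1) / x ^+ 2 + q x)%:C * u x
           = z * u x}].

Definition lin_indep f g :=
  forall c d : R[i], (forall x, 0 < x -> c * f x + d * g x = 0) ->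
    c = 0 /\ d = 0.

(* R[i]^o carries the usual topology of the complex plane and its structure of
   normed space over R[i], so derivability is complex differentiability. *)
Definition entire (F : R[i] -> R[i]) :=
  forall z, derivable (F : R[i]^o -> R[i]^o) z 1.

Definition continuous_on (A : set R) f :=
  {within A, continuous (f : R -> R[i]^o)}.

Definition jointly_continuous_on (A : set R) (F : R[i] -> R -> R[i]) :=
  {within [set: R[i]^o] `*` A,
    continuous (fun zx : R[i]^o * R => F zx.1 zx.2 : R[i]^o)}.

Definition tends_to_at0 f (c : R[i]) :=
  f x @[x --> 0^'+] --> (c : R[i]^o).

End Defs.

(* Main.v *)
(* The two solutions are power series in the spectral parameter,
     phi z x = sum_n z^n phi_n x  and  theta z x = sum_n z^n theta_n x,
   with real coefficients satisfying - u_n'' + V u_n = u_(n-1), where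
   V = l (l + 1) / x^2 + q; thus only real equations at z = 0 have to be solved.
   Being a primitive in the sense of Lebesgue ([prim]) is the working form of
   every differential equation, and variation of constants turns a perturbation
   of an equation with known solutions a, b of Wronskian 1 into the Volterra
   equation with kernel a(x) b(t) - b(x) a(t).  The iterates of such an equation
   decay faster than any geometric sequence, uniformly up to the singular
   endpoint because b(x) a(t) <= C a(x) b(t) for t <= x.
   phi_0 perturbs x^(l+1); theta_0 solves an initial value problem at an interior
   point, normalized by W(theta_0, phi_0) = 1, and its asymptotics at 0 follow
   from comparing (theta_0 / phi_0)' = - 1 / phi_0^2 with the free equation.
   phi_n and theta_n come from phi_0 and theta_0 by variation of constants.
   For the regularity, boundedness of u = phi z / x^(l+1) already forces
     u'(x) = x^(-2l-2) \int_0^x t^(2l+2) (q - z) u dt,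
   and similarly for theta, with x^(2l) (c + \int_x^1 t^(-2l) (q - z) u dt);
   Hardy's inequalities applied to t q(t) then give the L^p bounds. *)

Require Import Defs.
From mathcomp Require Import all_boot all_order all_algebra.
From mathcomp Require Import all_classical all_reals all_analysis.
From mathcomp Require Import measurable_realfun ess_sup_inf ring lra.

Set Implicit Arguments.
Unset Strict Implicit.
Unset Printing Implicit Defensive.

Import Order.TTheory GRing.Theory Num.Theory.
Import numFieldNormedType.Exports.

Local Open Scope classical_set_scope.
Local Open Scope ring_scope.

(** * Integrals over half-open intervals *)

Section IntervalIntegral.
Context {R : realType}.
Implicit Types (f g : R -> R) (a b c x y : R).
Local Notation mu := (@lebesgue_measure R).

(** Passing to coefficients of the powers of [z] reduces several requirements to one kind of
    estimate: bounds beating every geometric sequence, uniform on []0, X]] relative to the size of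
    the solution, yield entireness in [z], joint continuity up to [x = 0] and the equation itself.
    The obstacle is [theta]. For [l >= 1/2] the square of [x^(-l)] is not integrable at [0], so
    variation of constants based at [0] diverges for the first coefficients. Since multiples of
    [phi] may be added to [theta], base points can be moved freely; keeping them independent of [z]
    preserves entireness. The case distinctions of the theorem are the endpoints of Hardy's
    inequalities. For [-1/2 < l < 0] the homogeneous flux of [theta] contributes [x^(2l)], which
    lies in [L^r] near [0] exactly when [r < -1/(2l)]. For [phi] the inequality breaks down only for
    [l = -1/2] and [p = 1], where a logarithm appears; the logarithmic hypothesis is made for that
    case. For [l = -1/2] and [p > 1] integrability of [x q] against the logarithm follows from a
    power gained through [p > 1]. *)

Definition itg f a b := mu.-integrable `]a, b] (EFin \o f).
Definition oint f a b := \int[mu]_(t in `]a, b]) f t.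

Lemma itgS f a b c d : a <= c -> d <= b -> itg f a b -> itg f c d.
Proof.
move=> ac db; apply: integrableS => //=.
by apply: subset_itv; rewrite bnd_simp.
Qed.

Lemma eq_itg f g a b : (forall t, a < t <= b -> f t = g t) ->
  itg f a b -> itg g a b.
Proof.
move=> fg; apply: eq_integrable => //= t; rewrite inE/= in_itv/= => tab.
by rewrite fg.
Qed.

Lemma eq_oint f g a b : (forall t, a < t <= b -> f t = g t) ->
  oint f a b = oint g a b.
Proof.
by move=> fg; apply: eq_Rintegral => t; rewrite inE/= in_itv/= => /fg.
Qed.

Lemma itg_meas f a b : itg f a b -> measurable_fun `]a, b] f.
Proof. by move=> /measurable_int/measurable_EFinP. Qed.

Lemma itg_le f g a b : measurable_fun `]a, b] f ->
  (forall t, a < t <= b -> `|f t| <= g t) -> itg g a b -> itg f a b.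
Proof.
move=> mf fg; apply: le_integrable => //=; first exact/measurable_EFinP.
move=> t; rewrite /= in_itv/= => /fg {}fg.
by rewrite lee_fin (le_trans fg)// ler_norm.
Qed.

Lemma itg_cst a b k : itg (cst k) a b.
Proof.
apply: measurable_bounded_integrable => //=.
  by rewrite lebesgue_measure_itv/=; case: ifPn => // _; rewrite -EFinB ltry.
exists `|k|; split; first exact: num_real.
by move=> x kx t _ /=; apply: ltW.
Qed.

Lemma itgD f g a b : itg f a b -> itg g a b -> itg (fun t => f t + g t) a b.
Proof. by move=> fi gi; apply: integrableD fi gi. Qed.

Lemma itgZ k f a b : itg f a b -> itg (fun t => k * f t) a b.
Proof. by move=> fi; apply: integrableZl fi. Qed.

Lemma itgN f a b : itg f a b -> itg (fun t => - f t) a b.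
Proof.
by move=> fi; apply: eq_itg (itgZ (-1) fi) => t _; rewrite mulN1r.
Qed.

Lemma itgB f g a b : itg f a b -> itg g a b -> itg (fun t => f t - g t) a b.
Proof. by move=> fi gi; exact: itgD fi (itgN gi). Qed.

Lemma itg_norm f a b : itg f a b -> itg (fun t => `|f t|) a b.
Proof. by move=> fi; exact: integrable_norm fi. Qed.

Lemma ointD f g a b : itg f a b -> itg g a b ->
  oint (fun t => f t + g t) a b = oint f a b + oint g a b.
Proof. by move=> fi gi; exact: RintegralD. Qed.

Lemma ointB f g a b : itg f a b -> itg g a b ->
  oint (fun t => f t - g t) a b = oint f a b - oint g a b.
Proof. by move=> fi gi; exact: RintegralB. Qed.

Lemma ointZ k f a b : itg f a b -> oint (fun t => k * f t) a b = k * oint f a b.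
Proof. by move=> fi; exact: RintegralZl. Qed.

Lemma oint_cst a b k : a <= b -> oint (cst k) a b = k * (b - a).
Proof.
move=> ab; rewrite /oint Rintegral_cst//= lebesgue_measure_itv/= lte_fin.
by move: ab; rewrite le_eqVlt => /predU1P[->|->//]; rewrite ltxx subrr.
Qed.

Lemma oint_nil f a b : b <= a -> oint f a b = 0.
Proof. by move=> ba; rewrite /oint set_itv_ge ?Rintegral_set0// bnd_simp -leNgt. Qed.

Lemma itg_nil f a b : b <= a -> itg f a b.
Proof.
move=> ba; rewrite /itg set_itv_ge; last by rewrite bnd_simp -leNgt.
exact: integrable_set0.
Qed.

Lemma oint_split f a b c : a <= b -> b <= c -> itg f a c ->
  oint f a c = oint f a b + oint f b c.
Proof.
move=> ab bc fi; rewrite /oint -Rintegral_setU//=.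
- by rewrite -itv_bndbnd_setU.
- by rewrite -itv_bndbnd_setU.
- apply/disj_set2P; rewrite -subset0 => z/=; rewrite !in_itv/= => -[/andP[_]].
  by rewrite leNgt => /negbTE ->.
Qed.

Lemma itg_cat f a b c : itg f a b -> itg f b c -> itg f a c.
Proof.
have [ba|ab] := leP b a; first by move=> _; exact: itgS.
have [cb|bc] := leP c b; first by move=> + _; exact: itgS.
move=> /integrableP[/= mf fi] /integrableP[/= mg gi]; apply/integrableP.
have -> : `]a, c]%classic = `]a, b] `|` `]b, c] :> set R.
  by rewrite -itv_bndbnd_setU// bnd_simp ltW.
have mU : measurable_fun (`]a, b] `|` `]b, c]) (EFin \o f).
  by apply/measurable_funU.
split => //; rewrite ge0_integral_setU//=.
- by rewrite lte_add_pinfty.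
- apply/measurable_EFinP; apply: measurableT_comp => //; exact/measurable_EFinP.
- apply/disj_set2P; rewrite -subset0 => z/=; rewrite !in_itv/= => -[/andP[_]].
  by rewrite leNgt => /negbTE ->.
Qed.

Lemma le_oint f g a b : itg f a b -> itg g a b ->
  (forall t, a < t <= b -> f t <= g t) -> oint f a b <= oint g a b.
Proof.
move=> fi gi fg; apply: le_Rintegral => //= t; rewrite /= in_itv/=.
Qed.

Lemma oint_ge0 f a b : (forall t, a < t <= b -> 0 <= f t) -> 0 <= oint f a b.
Proof. by move=> f0; apply: Rintegral_ge0 => t; rewrite /= in_itv/=; exact: f0. Qed.

Lemma le_norm_oint f g a b : itg f a b -> itg g a b ->
  (forall t, a < t <= b -> `|f t| <= g t) -> `|oint f a b| <= oint g a b.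
Proof.
move=> fi gi fg; apply: le_trans (le_normr_Rintegral _ fi) _ => //=.
by apply: le_oint => //; exact: itg_norm.
Qed.

Lemma le_oint_itv f a b c d : a <= c -> c <= d -> d <= b -> itg f a b ->
  (forall t, a < t <= b -> 0 <= f t) -> oint f c d <= oint f a b.
Proof.
move=> ac cd db fi f0.
rewrite (oint_split ac (le_trans cd db) fi) (oint_split cd db (itgS ac (lexx _) fi)).
rewrite addrCA lerDl addr_ge0//; apply: oint_ge0 => t /andP[h1 h2]; apply: f0.
  by rewrite h1 (le_trans h2)// (le_trans cd).
by rewrite (le_lt_trans ac (le_lt_trans cd h1)).
Qed.

Lemma oint_small f a b (e : R) : itg f a b -> 0 < e ->
  exists2 d : R, 0 < d & forall y x, a <= y -> y <= x -> x <= b -> x - y < d ->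
    oint (fun t => `|f t|) y x < e.
Proof.
move=> fi e0.
have : mu.-integrable setT (EFin \o f \_ `]a, b]).
  by rewrite -restrict_EFin; apply/integrable_restrict => //=; rewrite setTI.
move=> /integral_normr_continuous /(_ _ e0)[d [d0 /=]] h; exists d => //.
move=> y x ay yx xb xyd; have := h `]y, x]%classic (measurable_itv _).
rewrite lebesgue_measure_itv/= lte_fin.
have -> : \int[mu]_(x0 in `]y, x]) `|(f \_ `]a, b]) x0| =
    oint (fun t => `|f t|) y x.
  apply: eq_Rintegral => t; rewrite inE/= => tyx; rewrite patchE mem_set//=.
  by apply: subset_itv tyx; rewrite bnd_simp.
by apply; case: ifPn => // _; rewrite -EFinB lte_fin.
Qed.

End IntervalIntegral.

(** * Primitives on the half line *)

Section Primitive.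
Context {R : realType}.
Implicit Types (f g F G : R -> R) (a b c x y : R).
Local Notation mu := (@lebesgue_measure R).
Local Notation posR := (`]0, +oo[%classic : set R).

Definition cont F := forall x, 0 < x -> {for x, continuous F}.

Lemma contP F x : {for x, continuous F} <->
  forall e : R, 0 < e -> exists2 d : R, 0 < d &
    forall y, `|y - x| < d -> `|F y - F x| < e.
Proof.
split.
  move=> /cvgrPdist_lt h e e0; have /nbhs_ballP[d /= d0 hd] := h _ e0.
  exists d => // y yd; rewrite distrC; apply: hd.
  by rewrite /ball/= distrC.
move=> h; apply/cvgrPdist_lt => e e0; have [d d0 hd] := h _ e0.
apply/nbhs_ballP; exists d => //= y yd; rewrite distrC; apply: hd.
by rewrite distrC.
Qed.

Lemma cont_within F a b : 0 < a -> cont F -> {within `[a, b], continuous F}.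
Proof.
move=> a0 cF; apply: continuous_in_subspaceT => t; rewrite inE/= in_itv/=.
by move=> /andP[at_ _]; apply: cF; apply: lt_le_trans at_.
Qed.

Lemma cont_measT F : cont F -> measurable_fun posR F.
Proof.
move=> cF; apply: open_continuous_measurable_fun.
  exact: interval_open.
by move=> t; rewrite inE/= in_itv/= andbT; exact: cF.
Qed.

Lemma pos_meas F a b : measurable_fun posR F -> 0 <= a ->
  measurable_fun `]a, b] F.
Proof.
move=> cF a0; apply: measurable_funS cF => //.
move=> t; rewrite /= !in_itv/= andbT => /andP[+ _].
exact: le_lt_trans.
Qed.

Lemma cont_meas F a b : cont F -> 0 <= a -> measurable_fun `]a, b] F.
Proof. by move=> cF; apply: pos_meas; exact: cont_measT. Qed.

Lemma cont_bounded F a b : cont F -> 0 < a ->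
  exists2 M, 0 < M & forall t, a <= t <= b -> `|F t| <= M.
Proof.
move=> cF a0; have [ab|ba] := leP a b; last first.
  by exists 1 => // t /andP[h1 h2]; move: (le_lt_trans (le_trans h1 h2) ba);
    rewrite ltxx.
have cN : cont (fun t => `|F t|).
  by move=> x x0; apply: (continuous_comp (cF _ x0)); exact: norm_continuous.
have [c _ hc] := EVT_max ab (cont_within (b := b) a0 cN).
exists (1 + `|F c|); first by rewrite ltr_pwDl.
by move=> t tab; rewrite (le_trans (hc t _)) ?in_itv// lerDr.
Qed.

Lemma cont_itg F a b : cont F -> 0 < a -> itg F a b.
Proof.
move=> cF a0; have [M _ hM] := cont_bounded b cF a0.
apply: (itg_le _ _ (itg_cst a b M)); first exact: cont_meas (ltW a0).
by move=> t /andP[/ltW h1 h2]; apply: hM; rewrite h1.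
Qed.

Lemma itgM_cont f F a b : cont F -> 0 < a -> itg f a b ->
  itg (fun t => f t * F t) a b.
Proof.
move=> cF a0 fi; have [M _ hM] := cont_bounded b cF a0.
apply: (itg_le _ _ (itgZ M (itg_norm fi))).
  by apply: measurable_funM; [exact: itg_meas|exact: cont_meas (ltW a0)].
move=> t /andP[/ltW h1 h2]; rewrite normrM mulrC ler_wpM2r//; apply: hM.
by rewrite h1.
Qed.

Lemma contD F G : cont F -> cont G -> cont (fun t => F t + G t).
Proof. by move=> cF cG x x0; apply: continuousD; [exact: cF|exact: cG]. Qed.

Lemma contM F G : cont F -> cont G -> cont (fun t => F t * G t).
Proof. by move=> cF cG x x0; apply: continuousM; [exact: cF|exact: cG]. Qed.

Lemma cont_cst k : cont (fun=> k).
Proof. by move=> x _; exact: cst_continuous. Qed.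

Lemma contN F : cont F -> cont (fun t => - F t).
Proof. by move=> cF x x0; apply: continuousN; exact: cF. Qed.

Lemma contB F G : cont F -> cont G -> cont (fun t => F t - G t).
Proof. by move=> cF cG; exact: contD cF (contN cG). Qed.

Lemma cont_eq F G : (forall x, 0 < x -> F x = G x) -> cont F -> cont G.
Proof.
move=> FG cF x x0; move: (cF _ x0); rewrite /prop_for /continuous_at -(FG _ x0).
apply: cvg_trans; apply: near_eq_cvg; near=> t; apply: FG.
by near: t; exact: lt_nbhsr.
Unshelve. all: by end_near. Qed.

(* [prim u1 u] and [prim (V * u) u1] together say that [u] is a Caratheodory
   solution of [u'' = V u] on the open half line. *)
Definition prim f F := forall y x, 0 < y -> y <= x ->
  itg f y x /\ F x - F y = oint f y x.

Lemma prim_itg f F a b : prim f F -> 0 < a -> itg f a b.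
Proof.
move=> fF a0; have [ab|/ltW ba] := leP a b; last exact: itg_nil.
by case: (fF _ _ a0 ab).
Qed.

Lemma prim_oint f F a b : prim f F -> 0 < a -> a <= b ->
  F b - F a = oint f a b.
Proof. by move=> fF a0 ab; case: (fF _ _ a0 ab). Qed.

Lemma prim_dist f F a b : prim f F -> 0 < a -> a <= b ->
  `|F b - F a| <= oint (fun t => `|f t|) a b.
Proof.
move=> fF a0 ab; rewrite (prim_oint fF)//; have fi := prim_itg b fF a0.
by apply: le_norm_oint => //; exact: itg_norm.
Qed.

Lemma prim_cont f F : prim f F -> cont F.
Proof.
move=> fF x x0; apply/contP => e e0.
have x20 : 0 < x / 2 by rewrite divr_gt0.
have [d d0 hd] := oint_small (prim_itg (x + 1) fF x20) e0.
exists (Num.min d (Num.min (x / 2) 1)).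
  by rewrite !lt_min d0 x20 ltr01.
move=> y; rewrite !lt_min => /and3P[].
rewrite 3!ltr_norml => /andP[? ?] /andP[? ?] /andP[? ?].
have [xy|/ltW yx] := leP x y.
  by apply: (le_lt_trans (prim_dist fF x0 xy)); apply: hd; lra.
have y0 : 0 < y by lra.
by rewrite distrC; apply: (le_lt_trans (prim_dist fF y0 yx)); apply: hd; lra.
Qed.

Lemma primD f F g G : prim f F -> prim g G ->
  prim (fun t => f t + g t) (fun t => F t + G t).
Proof.
move=> fF gG y x y0 yx; have [fi fE] := fF _ _ y0 yx.
have [gi gE] := gG _ _ y0 yx; split; first exact: itgD.
by rewrite ointD// -fE -gE; ring.
Qed.

Lemma primZ k f F : prim f F -> prim (fun t => k * f t) (fun t => k * F t).
Proof.
move=> fF y x y0 yx; have [fi fE] := fF _ _ y0 yx; split; first exact: itgZ.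
by rewrite ointZ// -fE; ring.
Qed.

Lemma eq_prim f F g G : (forall t, 0 < t -> f t = g t) ->
  (forall t, 0 < t -> F t = G t) -> prim f F -> prim g G.
Proof.
move=> fg FG fF y x y0 yx; have [fi fE] := fF _ _ y0 yx.
have h t : y < t <= x -> f t = g t.
  by move=> /andP[yt _]; apply: fg; exact: lt_trans yt.
split; first exact: eq_itg fi.
by rewrite -(eq_oint h) -!FG// (lt_le_trans y0).
Qed.

Lemma primN f F : prim f F -> prim (fun t => - f t) (fun t => - F t).
Proof. by move=> /(primZ (-1)); apply: eq_prim => t _; rewrite mulN1r. Qed.

Lemma primB f F g G : prim f F -> prim g G ->
  prim (fun t => f t - g t) (fun t => F t - G t).
Proof. by move=> fF gG; apply: primD => //; exact: primN. Qed.

Lemma prim_derive f F x : prim f F -> 0 < x -> {for x, continuous f} ->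
  is_derive x 1 F (f x).
Proof.
move=> fF x0 cf; have x20 : 0 < x / 2 by rewrite divr_gt0.
have fi : itg f (x / 2) (x + 1) by exact: prim_itg fF _.
have xx1 : x < x + 1 by rewrite ltrDl.
have ax : (BRight (x / 2) < BRight x)%O by rewrite bnd_simp; lra.
have [dG GE] := continuous_FTC1 xx1 fi ax cf.
apply: (@near_eq_is_derive _ _ _
    (fun t => F (x / 2) + \int[mu]_(u in [set` `]x / 2, t]]) f u)).
  near=> t; rewrite -[X in _ + X]/(oint f (x / 2) t) -(prim_oint fF)//.
    by rewrite addrC subrK.
  by apply/ltW; near: t; apply: lt_nbhsr; lra.
apply: is_derive_eq (_ : 0 + f x = f x); last by rewrite add0r.
by apply: is_deriveD; rewrite -GE derive1E; exact: DeriveDef.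
Unshelve. all: by end_near. Qed.

Lemma derive_prim f F : (forall x, 0 < x -> is_derive x 1 F (f x)) -> cont f ->
  prim f F.
Proof.
move=> dF cf y x y0; rewrite le_eqVlt => /predU1P[<-|yx].
  by rewrite subrr oint_nil//; split=> //; exact: itg_nil.
split; first exact: cont_itg.
have cF : cont F.
  move=> t t0; apply: differentiable_continuous; apply/derivable1_diffP.
  exact: (@ex_derive _ _ _ _ _ _ _ (dF _ t0)).
have h := @continuous_FTC2 R f F y x yx (cont_within y0 cf).
rewrite /oint Rintegral_itv_obnd_cbnd; last exact: cont_itg.
rewrite /Rintegral h//.
- split.
  + move=> t; rewrite in_itv/= => /andP[yt _].
    exact: (@ex_derive _ _ _ _ _ _ _ (dF _ (lt_trans y0 yt))).
  + exact/cvg_at_right_filter/cF.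
  + by apply/cvg_at_left_filter/cF; exact: lt_trans yx.
- move=> t; rewrite in_itv/= => /andP[yt _]; rewrite derive1E.
  exact: (@derive_val _ _ _ _ _ _ _ (dF _ (lt_trans y0 yt))).
Qed.

Lemma prim_cst k : prim (fun=> 0) (fun=> k).
Proof.
move=> y x y0 yx; split; first exact: itg_cst.
by rewrite subrr (oint_cst 0 yx) mul0r.
Qed.

(** Since the right-hand side is additive over adjacent intervals, the estimate need only be checked
    on short ones. The steps have length [d / 2], so that the strict bound [x - y < d] is available
    on each. *)
Lemma chain_le F (N : R -> R) a b (d e : R) : 0 < d ->
  (forall y x, a <= y -> y <= x -> x <= b -> x - y < d ->
     `|F x - F y| <= e * (N x - N y)) ->
  forall y x, a <= y -> y <= x -> x <= b -> `|F x - F y| <= e * (N x - N y).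
Proof.
move=> d0 h y x ay yx xb.
have [n hn] : exists n : nat, x - y < d / 2 * n%:R.
  have d20 : 0 < d / 2 by rewrite divr_gt0.
  exists (Num.bound ((x - y) / (d / 2))); rewrite mulrC -ltr_pdivrMr//.
  by apply: archi_boundP; rewrite divr_ge0 ?subr_ge0// ltW.
elim: n x yx xb hn => [|n IH] x yx xb hn.
  by move: hn; rewrite mulr0; lra.
have [xyd|xyd] := leP (x - y) (d / 2).
  by apply: h => //; lra.
have h1 : `|F (x - d / 2) - F y| <= e * (N (x - d / 2) - N y).
  apply: IH; [lra|lra|].
  by move: hn; rewrite -(natr1 n) mulrDr; lra.
have h2 : `|F x - F (x - d / 2)| <= e * (N x - N (x - d / 2)).
  by apply: h; lra.
have := ler_normD (F x - F (x - d / 2)) (F (x - d / 2) - F y).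
rewrite addrA subrK.
by move=> h3; apply: le_trans h3 _; apply: le_trans (lerD h2 h1) _; lra.
Qed.

(** Product rule for merely integrable derivatives, obtained without Fubini or differentiation
    almost everywhere: on a short interval the defect of the identity is a sum of two integrals,
    each at most [e] times the integral of [|g|], and [chain_le] adds these errors up to [2 e] times
    a fixed number. *)
Lemma prim_mul f F g G : prim f F -> prim g G ->
  prim (fun t => f t * G t + F t * g t) (fun t => F t * G t).
Proof.
move=> fF gG y x y0 yx.
have cF := prim_cont fF; have cG := prim_cont gG.
have fGi a b : 0 < a -> itg (fun t => f t * G t) a b.
  by move=> a0; apply: itgM_cont => //; exact: prim_itg fF _.
have Fgi a b : 0 < a -> itg (fun t => F t * g t) a b.
  move=> a0; under [fun t => _]funext do rewrite mulrC.
  by apply: itgM_cont => //; exact: prim_itg gG _.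
split; first by apply: itgD; [exact: fGi|exact: Fgi].
have fi := prim_itg x fF y0; have gi := prim_itg x gG y0.
pose h t := f t * G t + F t * g t.
have hi a b : 0 < a -> itg h a b by move=> a0; apply: itgD; [exact: fGi|exact: Fgi].
pose H t := F t * G t - oint h y t.
pose N t := oint (fun u => `|g u|) y t.
suff H0 e : 0 < e -> `|H x - H y| <= 2 * e * (N x - N y).
  have : `|H x - H y| <= 0.
    apply/ler_addgt0Pl => e e0; rewrite addr0.
    have Ny : 0 <= N x - N y.
      by rewrite /N (oint_nil _ (lexx y)) subr0; apply: oint_ge0.
    (* The [+ 1] keeps the denominator positive when the integral of [|g|] over the interval is
       zero. *)
    have := H0 (e / (2 * (N x - N y + 1))).
    have Npos : 0 < 2 * (N x - N y + 1) by lra.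
    move=> /(_ (divr_gt0 e0 Npos)) /le_trans; apply.
    rewrite (_ : 2 * _ * _ = e * ((N x - N y) / (N x - N y + 1))); last first.
      by field; lra.
    by rewrite ger_pMr// ler_pdivrMr; lra.
  rewrite normr_le0 subr_eq0 => /eqP; rewrite /H (oint_nil _ (lexx y)) -/h.
  by move=> ?; lra.
move=> e0; have [d d0 hd] := oint_small fi e0.
apply: (chain_le (b := x) d0) => // {fi}s t ys st tx tsd.
have s0 : 0 < s by exact: lt_le_trans ys.
have Fi := prim_itg t fF s0; have Gi := prim_itg t gG s0.
(* [G] is frozen at the right end and [F] at the left end: with this mixed choice the boundary
   products combine exactly to [F t * G t - F s * G s]. *)
have -> : H t - H s = oint (fun u => f u * (G t - G u)) s t +
     oint (fun u => g u * (F s - F u)) s t.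
  have E1 : oint (fun u => f u * (G t - G u)) s t =
      (F t - F s) * G t - oint (fun u => f u * G u) s t.
    rewrite (prim_oint fF)// [X in X - _]mulrC -ointZ// -ointB//; last 2 first.
    - exact: itgZ.
    - exact: fGi.
    - by apply: eq_oint => u _; ring.
  have E2 : oint (fun u => g u * (F s - F u)) s t =
      (G t - G s) * F s - oint (fun u => F u * g u) s t.
    rewrite (prim_oint gG)// [X in X - _]mulrC -ointZ// -ointB//; last 2 first.
    - exact: itgZ.
    - exact: Fgi.
    - by apply: eq_oint => u _; ring.
  rewrite E1 E2 /H (oint_split ys st (hi _ _ y0)) /h (@ointD _ _ _ s t).
  - by ring.
  - exact: fGi.
  - exact: Fgi.
have fn := itg_norm Fi; have gn := itg_norm Gi.
have Gb u : s < u <= t -> `|G t - G u| <= N t - N s.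
  move=> /andP[su ut]; have u0 : 0 < u := lt_trans s0 su.
  apply: le_trans (prim_dist gG u0 ut) _.
  rewrite /N (@oint_split _ _ y s t)//; last exact/itg_norm/(prim_itg _ gG).
  by rewrite addrC addKr; apply: le_oint_itv => //; exact: ltW.
have Fb u : s < u <= t -> `|F s - F u| <= e.
  move=> /andP[su ut]; rewrite distrC.
  apply: le_trans (prim_dist fF s0 (ltW su)) _.
  by apply/ltW/hd; lra.
have NE : N t - N s = oint (fun u => `|g u|) s t.
  rewrite /N (@oint_split _ _ y s t)//; last exact/itg_norm/(prim_itg _ gG).
  by rewrite addrC addKr.
have B1 : `|oint (fun u => f u * (G t - G u)) s t| <=
    oint (fun u => (N t - N s) * `|f u|) s t.
  apply: le_norm_oint => [||u sut].
  - apply: itgM_cont => //; apply: contB => //; exact: cont_cst.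
  - exact: itgZ.
  - by rewrite normrM mulrC ler_wpM2r// Gb.
have B2 : `|oint (fun u => g u * (F s - F u)) s t| <=
    oint (fun u => e * `|g u|) s t.
  apply: le_norm_oint => [||u sut].
  - apply: itgM_cont => //; apply: contB => //; exact: cont_cst.
  - exact: itgZ.
  - by rewrite normrM mulrC ler_wpM2r// Fb.
apply: le_trans (ler_normD _ _) _; apply: le_trans (lerD B1 B2) _.
rewrite ointZ// ointZ// -NE.
have N0 : 0 <= N t - N s by rewrite NE; apply: oint_ge0.
have : oint (fun u => `|f u|) s t <= e by apply/ltW/hd.
by move=> /(ler_wpM2l N0); lra.
Qed.

End Primitive.

(** * Differentiation almost everywhere, absolute continuity, variation of constants *)

Section PrimitiveMore.
Context {R : realType}.
Implicit Types (f g F G : R -> R) (a b c x y : R).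
Local Notation mu := (@lebesgue_measure R).

(** Lebesgue's differentiation theorem is applied to countably many truncations of [f] to []lo n, hi
    n]], because [f] need not be integrable up to [0] or to infinity. *)
Lemma prim_ae f F : prim f F ->
  {ae mu, forall x, 0 < x -> is_derive x 1 F (f x)}.
Proof.
move=> fF.
pose lo (n : nat) : R := n.+1%:R^-1; pose hi (n : nat) : R := n.+1%:R.
pose g n := f \_ `]lo n, hi n].
have lo0 n : 0 < lo n by rewrite invr_gt0 ltr0n.
have gi n : mu.-integrable setT (EFin \o g n).
  rewrite /g -restrict_EFin; apply/integrable_restrict => //=.
  by rewrite setTI; exact: prim_itg fF _.
have giS n y : mu.-integrable [set` Interval (BRight (lo n)) (BRight y)]
    (EFin \o g n) by apply: integrableS (gi n).
have h n := FTC1 (giS n) (open_integrable_locally openT (gi n)).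
have := ae_foralln h; apply: filterS => x hx x0.
have [n /andP[ln nh]] : exists n : nat, lo n < x < hi n.
  exists (maxn (Num.bound x) (Num.bound x^-1)); apply/andP; split.
    rewrite /lo invf_plt ?posrE ?ltr0n// (lt_le_trans (archi_boundP _))//.
      by rewrite invr_ge0 ltW.
    by rewrite ler_nat leqW// leq_maxr.
  rewrite (lt_le_trans (archi_boundP (ltW x0)))// ler_nat.
  by rewrite leqW// leq_maxl.
have ax : (BRight (lo n) < BRight (x : R))%O by rewrite bnd_simp.
have [dG GE] := hx n ax.
apply: (@near_eq_is_derive _ _ _
    (fun t => F (lo n) + \int[mu]_(u in [set` `]lo n, t]]) g n u)).
  near=> t.
  have lt : lo n < t by near: t; exact: lt_nbhsr.
  have th : t <= hi n by apply/ltW; near: t; exact: lt_nbhsl.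
  rewrite -[X in _ + X]/(oint (g n) (lo n) t).
  rewrite (@eq_oint _ _ f); last first.
    move=> u /andP[u1 u2]; rewrite /g patchE mem_set//= in_itv/= u1.
    exact: le_trans th.
  rewrite -(prim_oint fF)//; last exact: ltW.
  by rewrite addrC subrK.
have -> : f x = 0 + g n x.
  by rewrite add0r /g patchE mem_set//= in_itv/= ln ltW.
by apply: is_deriveD; rewrite -GE derive1E; exact: DeriveDef.
Unshelve. all: by end_near. Qed.

(** Absolute continuity of the integral, used on the union of the intervals: disjointness makes the
    measure of the union equal to the sum of the lengths. *)
Lemma oint_sum_disj g (a b e : R) : itg g a b -> 0 < e ->
  exists2 d : R, 0 < d & forall (n : nat) (s t : 'I_n -> R),
    (forall i, [/\ a <= s i, s i <= t i & t i <= b]) ->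
    trivIset [set: 'I_n] (fun i => `]s i, t i[%classic) ->
    \sum_(i < n) (t i - s i) < d ->
    \sum_(i < n) oint (fun u => `|g u|) (s i) (t i) < e.
Proof.
move=> gi e0.
have gT : mu.-integrable setT (EFin \o g \_ `]a, b]).
  by rewrite -restrict_EFin; apply/integrable_restrict => //=; rewrite setTI.
have [d [d0 hd]] := integral_normr_continuous gT e0.
exists d => // n s t st tI sd.
pose A := \big[setU/set0]_(i < n) `]s i, t i[%classic.
have mA : measurable A by apply: bigsetU_measurable.
have muA : (mu A < d%:E)%E.
  rewrite /A measure_bigsetU_ord//=.
  rewrite (eq_bigr (fun i => (t i - s i)%:E)) ?sumEFin ?lte_fin//.
  move=> i _; have [_ + _] := st i.
  rewrite lebesgue_measure_itv/= lte_fin le_eqVlt => /predU1P[->|->//].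
  by rewrite ltxx subrr.
have := hd A mA muA.
have gm : measurable_fun setT (fun x => (`|(g \_ `]a, b]) x|)%:E).
  apply/measurable_EFinP; apply: measurableT_comp => //.
  by move/measurable_int/measurable_EFinP: gT.
have -> : \int[mu]_(x in A) `|(g \_ `]a, b]) x| =
    \sum_(i < n) oint (fun u => `|g u|) (s i) (t i).
  apply: EFin_inj; rewrite -sumEFin.
  have Ai : mu.-integrable A (EFin \o (fun x => `|(g \_ `]a, b]) x|)).
    exact: integrable_norm (integrableS _ _ _ gT).
  rewrite /Rintegral fineK; last by apply: (integrable_fin_num _ Ai); exact: mA.
  rewrite /A ge0_integral_bigsetU//=.
  - apply: eq_bigr => i _; have [as_ sti tb] := st i.
    have gst : itg g (s i) (t i) by exact: itgS gi.
    rewrite /oint /Rintegral fineK; last first.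
      exact: (integrable_fin_num _ (itg_norm gst)).
    rewrite [RHS](_ : _ = \int[mu]_(x in `]s i, t i[) (`|g x|)%:E)%E; last first.
      symmetry; apply: integral_itv_bndo_bndc.
      apply/measurable_EFinP; apply: measurable_funS (itg_meas (itg_norm gst)) => //.
      by apply: subset_itv; rewrite bnd_simp.
    apply: eq_integral => x; rewrite inE/= in_itv/= => /andP[h1 h2].
    rewrite patchE mem_set//= in_itv/= (le_lt_trans as_ h1)/=.
    by rewrite (le_trans (ltW h2)).
  - exact: index_enum_uniq.
  - by apply: sub_trivIset tI.
  - exact: measurable_funTS.
by [].
Qed.

Lemma prim_ac f F a b (e : R) : prim f F -> 0 < a -> 0 < e ->
  exists2 d : R, 0 < d & forall (n : nat) (s t : 'I_n -> R),
    (forall i, [/\ a <= s i, s i <= t i & t i <= b]) ->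
    trivIset [set: 'I_n] (fun i => `]s i, t i[%classic) ->
    \sum_(i < n) (t i - s i) < d ->
    \sum_(i < n) `|F (t i) - F (s i)| < e.
Proof.
move=> fF a0 e0; have [d d0 hd] := oint_sum_disj (prim_itg b fF a0) e0.
exists d => // n s t st tI sd; apply: le_lt_trans (hd n s t st tI sd).
apply: ler_sum => i _; have [as_ sti tb] := st i.
by apply: prim_dist => //; exact: lt_le_trans as_.
Qed.

Lemma prim0_cst F : prim (fun=> 0) F -> forall x y, 0 < x -> 0 < y -> F x = F y.
Proof.
move=> h; suff H y x : 0 < y -> y <= x -> F x = F y.
  by move=> x y x0 y0; have [/(H _ _ x0)//|/ltW/(H _ _ y0)] := leP x y.
move=> y0 yx; apply/eqP; rewrite -subr_eq0 (prim_oint h)//.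
by rewrite (oint_cst 0)// mul0r.
Qed.

(** With [P' = b f] and [Q' = a f] the terms [a b f] cancel in the first derivative of [a P - b Q];
    in the second derivative the Wronskian collects them into [(b a1 - b1 a) f = f]. *)
Lemma VOC (V f a a1 b b1 P Q : R -> R) :
  prim a1 a -> prim (fun t => V t * a t) a1 ->
  prim b1 b -> prim (fun t => V t * b t) b1 ->
  (forall x, 0 < x -> b x * a1 x - b1 x * a x = 1) ->
  prim (fun t => b t * f t) P -> prim (fun t => a t * f t) Q ->
  let u := fun t => a t * P t - b t * Q t in
  let u1 := fun t => a1 t * P t - b1 t * Q t in
  prim u1 u /\ prim (fun t => V t * u t + f t) u1.
Proof.
move=> pa pa1 pb pb1 W pP pQ u u1; split.
  apply: eq_prim (primB (prim_mul pa pP) (prim_mul pb pQ)) => t t0 //.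
  by rewrite /u1; ring.
apply: eq_prim (primB (prim_mul pa1 pP) (prim_mul pb1 pQ)) => t t0 //.
rewrite /u mulrBr; transitivity (V t * a t * P t - V t * b t * Q t +
  (b t * a1 t - b1 t * a t) * f t); first by ring.
by rewrite W//; ring.
Qed.

Lemma wronskian_cst (V u u1 v v1 : R -> R) :
  prim u1 u -> prim (fun t => V t * u t) u1 ->
  prim v1 v -> prim (fun t => V t * v t) v1 ->
  forall x y, 0 < x -> 0 < y ->
  u x * v1 x - u1 x * v x = u y * v1 y - u1 y * v y.
Proof.
move=> pu pu1 pv pv1.
apply: (@prim0_cst (fun x => u x * v1 x - u1 x * v x)).
apply: eq_prim (primB (prim_mul pu pv1) (prim_mul pu1 pv)) => t t0 //.
by ring.
Qed.

End PrimitiveMore.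

(** * Volterra equations *)

Section Volterra.
Context {R : realType}.
Implicit Types (f g F G w : R -> R) (a b c x y : R).
Local Notation mu := (@lebesgue_measure R).

(* On steps of length [e] with [\int w <= 1 / (2 r)], induction on [n] gives
   [m n x <= C / r ^+ n * 2 ^+ k] as soon as [|x - c| <= k * e]. *)
Lemma volterra_bound c lo hi w (m : nat -> R -> R) (C r : R) :
  0 < r -> lo <= c <= hi -> itg w lo hi ->
  (forall t, lo < t <= hi -> 0 <= w t) ->
  (forall n, itg (fun t => w t * m n t) lo hi) ->
  (forall n t, lo < t <= hi -> 0 <= m n t) ->
  (forall t, lo < t <= hi -> m 0%N t <= C) ->
  (forall n x, lo < x <= hi -> m n.+1 x <=
     oint (fun t => w t * m n t) c x + oint (fun t => w t * m n t) x c) ->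
  exists K, forall n x, lo < x <= hi -> m n x <= K / r ^+ n.
Proof.
move=> r0 /andP[loc chi] wi w0 wmi m0 mC mS.
have r20 : 0 < (2 * r)^-1 by rewrite invr_gt0 mulr_gt0.
have [d d0 hd] := oint_small wi r20.
have {}hd y x : lo <= y -> y <= x -> x <= hi -> x - y <= d / 2 ->
    oint w y x <= (2 * r)^-1.
  move=> ly yx xh xyd; apply: le_trans (ltW (hd y x ly yx xh _)); last by lra.
  apply: le_oint; [exact: itgS wi|exact/itg_norm/(itgS _ _ wi)|].
  by move=> t _; exact: ler_norm.
have d20 : 0 < d / 2 by rewrite divr_gt0.
set e := d / 2 in hd d20; pose C' := Num.max C 0.
have C'0 : 0 <= C' by rewrite le_max lexx orbT.
have rn0 n : 0 < r ^+ n by rewrite exprn_gt0.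
pose I n x := oint (fun t => w t * m n t) c x + oint (fun t => w t * m n t) x c.
have P n k x : lo < x <= hi -> `|x - c| <= k%:R * e -> m n x <= C' / r ^+ n * 2 ^+ k.
  elim: n k x => [k x xD _|n IH].
    rewrite expr0 divr1 (le_trans (mC x xD))//.
    rewrite (@le_trans _ _ C')// ?le_max ?lexx// ler_peMr//.
    by rewrite exprn_ege1// ler1n.
  have wb k y x : lo <= y -> y <= x -> x <= hi -> x - y <= e ->
      `|x - c| <= k%:R * e -> `|y - c| <= k%:R * e ->
      oint (fun t => w t * m n t) y x <= (2 * r)^-1 * (C' / r ^+ n * 2 ^+ k).
    move=> ly yx xh xye xc yc.
    have wi' : itg w y x by exact: itgS wi.
    apply: (@le_trans _ _ (oint (fun t => (C' / r ^+ n * 2 ^+ k) * w t) y x)).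
      apply: le_oint; [exact: itgS (wmi n)|exact: itgZ|].
      move=> t /andP[yt tx].
      have tD : lo < t <= hi by rewrite (le_lt_trans ly yt) (le_trans tx).
      rewrite mulrC ler_wpM2r ?w0//; apply: IH => //.
      move: xc yc; rewrite !ler_norml => /andP[h1 h2] /andP[h3 h4]; lra.
    rewrite ointZ// mulrC ler_wpM2r ?hd//.
    by rewrite mulr_ge0 ?divr_ge0 ?exprn_ge0// ltW.
  (* [2 + 4 + ... + 2 ^+ k = 2 ^+ k.+1 - 2] adds the contributions of the [k] steps between [c] and
     [x]; the prefactor [1 / (2 r)] later turns [2 ^+ k.+1] into [2 ^+ k / r], which closes the
     induction on [n]. *)
  have Q k x : lo < x <= hi -> `|x - c| <= k%:R * e ->
      I n x <= (2 * r)^-1 * (C' / r ^+ n) * (2 ^+ k.+1 - 2).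
    elim: k x => [x _|k IHk x xD].
      rewrite mul0r normr_le0 subr_eq0 => /eqP ->.
      by rewrite /I oint_nil// expr1 subrr mulr0 addr0.
    move=> xc; have [xk|kx] := leP `|x - c| (k%:R * e).
      apply: le_trans (IHk _ xD xk) _; apply: ler_wpM2l.
        by rewrite mulr_ge0 ?divr_ge0 ?invr_ge0 ?mulr_ge0// ltW.
      by rewrite lerD2r ler_eXn2l// ltr1n.
    have k0 : 0 <= k%:R * e by rewrite mulr_ge0 ?ler0n// ltW.
    have kE : k.+1%:R * e = k%:R * e + e by rewrite -(natr1 k) mulrDl mul1r.
    have S : (2 * r)^-1 * (C' / r ^+ n) * (2 ^+ k.+2 - 2) =
        (2 * r)^-1 * (C' / r ^+ n) * (2 ^+ k.+1 - 2) +
        (2 * r)^-1 * (C' / r ^+ n * 2 ^+ k.+1).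
      by rewrite exprS; ring.
    move/andP: (xD) => [lx xh].
    have [cx|xc'] := leP c x.
      move: xc kx; rewrite ger0_norm ?subr_ge0// => xc kx.
      pose y := c + k%:R * e.
      have cy : c <= y by rewrite lerDl.
      have yx : y <= x by rewrite /y -lerBrDl ltW.
      have ly : lo <= y by exact: le_trans cy.
      have yc : `|y - c| = k%:R * e by rewrite /y addrAC subrr add0r ger0_norm.
      (* For [k = 0] the point [y] is [c], which may be the excluded endpoint [lo]; in that case
         [I n y] is zero and the inner induction hypothesis is not called. *)
      have yD : (lo < y) || (y == c).
        rewrite /y; have [->|kn0] := eqVneq k 0%N.
          by rewrite mul0r addr0 eqxx orbT.
        by rewrite (le_lt_trans loc)// ltrDl mulr_gt0// ltr0n lt0n.
      have Iy : I n y <= (2 * r)^-1 * (C' / r ^+ n) * (2 ^+ k.+1 - 2).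
        have [->|yc'] := eqVneq y c.
          rewrite /I oint_nil// addr0 mulr_ge0//.
            by rewrite mulr_ge0 ?divr_ge0 ?invr_ge0 ?mulr_ge0// ltW.
          by rewrite subr_ge0 exprS ler_peMr// exprn_ege1// ler1n.
        apply: IHk; last by rewrite yc.
        by move: yD; rewrite (negbTE yc') orbF => ->; exact: le_trans xh.
      rewrite S; apply: le_trans (lerD Iy (wb k.+1 y x _ _ _ _ _ _)).
      + rewrite /I (@oint_nil _ _ x c)// (@oint_nil _ _ y c) ?addr0//.
        rewrite (@oint_split _ _ c y x)//; exact: itgS (wmi n).
      + exact: ly.
      + exact: yx.
      + by [].
      + by rewrite /y; lra.
      + by rewrite ger0_norm ?subr_ge0.
      + by rewrite yc kE; lra.
    move: xc kx; rewrite ltr0_norm ?subr_lt0// => xc kx.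
    pose y := c - k%:R * e.
    have yc' : y <= c by rewrite gerBl.
    have xy : x <= y by move: kx; rewrite /y; lra.
    have yh : y <= hi by exact: le_trans chi.
    have yc : `|y - c| = k%:R * e by rewrite /y addrAC subrr add0r normrN ger0_norm.
    have Iy : I n y <= (2 * r)^-1 * (C' / r ^+ n) * (2 ^+ k.+1 - 2).
      by apply: IHk; [rewrite (lt_le_trans lx)|rewrite yc].
    rewrite S; apply: le_trans (lerD Iy (wb k.+1 x y _ _ _ _ _ _)).
    + rewrite /I (@oint_nil _ _ c x) ?(ltW xc')// (@oint_nil _ _ c y) ?add0r//.
      rewrite addrC (@oint_split _ _ x y c)//.
      by apply: itgS (wmi n) => //; exact: ltW.
    + exact: ltW.
    + exact: xy.
    + exact: yh.
    + by rewrite /y; lra.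
    + by rewrite yc kE; lra.
    + by rewrite ltr0_norm ?subr_lt0//; lra.
  move=> k x xD xk; apply: le_trans (mS n x xD) _; apply: le_trans (Q k x xD xk) _.
  rewrite (_ : C' / r ^+ n.+1 * 2 ^+ k = (2 * r)^-1 * (C' / r ^+ n) * (2 ^+ k.+1)).
    apply: ler_wpM2l; last by rewrite gerBl.
    by rewrite mulr_ge0 ?divr_ge0 ?invr_ge0 ?mulr_ge0// ltW.
  by rewrite !exprS; field; rewrite gt_eqF ?gt_eqF.
have [k hk] : exists k : nat, hi - lo < k%:R * e.
  exists (Num.bound ((hi - lo) / e)); rewrite -ltr_pdivrMr//.
  by apply: archi_boundP; rewrite divr_ge0// ?(ltW d20)//; lra.
exists (C' * 2 ^+ k) => n x xD; rewrite mulrAC; apply: P => //.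
by move/andP: xD => [h1 h2]; rewrite ler_norml; apply/andP; split; lra.
Qed.

End Volterra.

(** * Oriented integrals from a base point that may be the singular endpoint *)

Section SignedIntegral.
Context {R : realType}.
Implicit Types (f g : R -> R) (c lo hi x y : R).

(* Windows around the base point [c] of an integral equation: for [c > 0] they
   stay away from the singular endpoint, for [c = 0] they start there. *)
Definition window c lo hi := [/\ 0 <= lo, lo <= c, c <= hi & lo = 0 -> c = 0].

Definition locint c f := forall lo hi, window c lo hi -> itg f lo hi.

(** [oint] vanishes on reversed intervals, so at most one of the two terms is nonzero and the
    difference is the oriented integral from [c] to [x]. *)
Definition sint c f x := oint f c x - oint f x c.

Lemma window_cover c y x : 0 <= c -> 0 < y -> y <= x ->
  exists lo hi, [/\ window c lo hi, lo < y & x <= hi].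
Proof.
move=> c0 y0 yx; have [->|cn0] := eqVneq c 0.
  by exists 0, x; split=> //; split=> //; lra.
have cp : 0 < c by rewrite lt_def cn0.
exists (Num.min (y / 2) c), (Num.max x c); split.
- split; rewrite ?ge_min ?le_max ?lexx ?orbT//.
    by rewrite le_min (ltW cp) andbT; lra.
  by move=> /eqP; rewrite gt_eqF// lt_min cp andbT; lra.
- by rewrite gt_min; apply/orP; left; lra.
- by rewrite le_max lexx.
Qed.

Lemma locint_itg c f y x : 0 <= c -> locint c f -> 0 < y -> itg f y x.
Proof.
move=> c0 lf y0; have [yx|/ltW xy] := leP y x; last exact: itg_nil.
have [lo [hi [d ly xh]]] := window_cover c0 y0 yx.
by apply: itgS (lf _ _ d) => //; exact: ltW.
Qed.

Lemma sint_prim c f : 0 <= c -> locint c f -> prim f (sint c f).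
Proof.
move=> c0 lf y x y0 yx; split; first exact: locint_itg lf y0.
have [lo [hi [d ly xh]]] := window_cover c0 y0 yx.
have [lo0 loc chi _] := d; have fi := lf _ _ d.
rewrite /sint; have [cy|yc] := leP c y.
  rewrite !(@oint_nil _ _ _ c)//; last exact: le_trans yx.
  rewrite (@oint_split _ _ c y x)//; first by ring.
  exact: itgS fi.
have [cx|xc] := leP c x.
  rewrite (@oint_nil _ _ x c)// (@oint_nil _ _ c y) ?(ltW yc)//.
  rewrite (@oint_split _ _ y c x)//; [by ring|exact: ltW|].
  by apply: itgS fi => //; exact: ltW.
rewrite !(@oint_nil _ _ c) ?(ltW yc) ?(ltW xc)//.
rewrite (@oint_split _ _ y x c)//; [by ring|exact: ltW|].
by apply: itgS fi => //; exact: ltW.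
Qed.

Lemma le_norm_sint c f g x : itg f c x -> itg g c x -> itg f x c -> itg g x c ->
  (forall t, c < t <= x \/ x < t <= c -> `|f t| <= g t) ->
  `|sint c f x| <= oint g c x + oint g x c.
Proof.
move=> f1 g1 f2 g2 fg; apply: le_trans (ler_normB _ _) _; apply: lerD.
  by apply: le_norm_oint => // t h; apply: fg; left.
by apply: le_norm_oint => // t h; apply: fg; right.
Qed.

End SignedIntegral.

(** * Iterates of the Volterra operator in a weighted supremum norm *)

Section VolterraIteration.
Context {R : realType}.
Variables (V p a a1 b b1 om : R -> R) (c : R).
Local Notation posR := (`]0, +oo[%classic : set R).

(** The particular solution of [u'' = V u + p v] given by variation of constants with both integrals
    based at [c]. *)
Definition vop (v : R -> R) (x : R) :=
  a x * sint c (fun t => b t * (p t * v t)) x -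
  b x * sint c (fun t => a t * (p t * v t)) x.

(** The derivative of [vop v]: only the outer factors are differentiated, since the derivatives of
    the two integrals cancel. *)
Definition vop1 (v : R -> R) (x : R) :=
  a1 x * sint c (fun t => b t * (p t * v t)) x -
  b1 x * sint c (fun t => a t * (p t * v t)) x.

Definition vseq u0 n := iter n vop u0.

Hypothesis c0 : 0 <= c.
Hypotheses (pa : prim a1 a) (pa1 : prim (fun t => V t * a t) a1)
  (pb : prim b1 b) (pb1 : prim (fun t => V t * b t) b1)
  (W : forall x, 0 < x -> b x * a1 x - b1 x * a x = 1).
Hypotheses (com : cont om) (om0 : forall x, 0 < x -> 0 < om x)
  (mp : measurable_fun posR p)
  (hap : locint c (fun t => a t * p t * om t))
  (hbp : locint c (fun t => b t * p t * om t)).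
(** The condition separates the variables: for the quotients [|v| / om] the kernel is majorized by
    an integrable [w t] that does not depend on [x]. This is what keeps the estimates uniform up to
    a singular endpoint. *)
Hypothesis hk : forall lo hi, window c lo hi -> exists w, [/\ itg w lo hi,
  (forall t, lo < t <= hi -> 0 <= w t) &
  (forall x t, lo < x <= hi -> lo < t <= hi -> c < t <= x \/ x < t <= c ->
     (`|a x * b t| + `|b x * a t|) * `|p t| * om t <= om x * w t)].

Definition dominated v := cont v /\ forall lo hi, window c lo hi ->
  exists C, forall x, lo < x <= hi -> `|v x| <= C * om x.

Lemma dominated_locint d v : dominated v -> cont d ->
  locint c (fun t => d t * p t * om t) -> locint c (fun t => d t * (p t * v t)).
Proof.
move=> [cv hv] cd hd lo hi dom; have [lo0 _ _ _] := dom.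
have [C hC] := hv _ _ dom.
apply: (itg_le _ _ (itgZ C (itg_norm (hd _ _ dom)))).
  apply: measurable_funM; first exact: cont_meas.
  by apply: measurable_funM; [exact: pos_meas|exact: cont_meas].
move=> t tD; have t0 : 0 < t by apply: le_lt_trans lo0 _; case/andP: tD.
rewrite !normrM (gtr0_norm (om0 t0)) mulrA [X in _ <= X]mulrC -!mulrA.
rewrite ler_wpM2l// ler_wpM2l// mulrC; exact: hC.
Qed.

Lemma vop_prim v : dominated v -> prim (vop1 v) (vop v) /\
  prim (fun t => V t * vop v t + p t * v t) (vop1 v).
Proof.
move=> dv; apply: VOC => //.
- by apply: sint_prim => //; apply: dominated_locint => //; exact: prim_cont pb.
- by apply: sint_prim => //; apply: dominated_locint => //; exact: prim_cont pa.
Qed.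

(** This is the recursive inequality that [volterra_bound] asks for, with [m n] the quotient of the
    [n]-th iterate by the weight [om]. *)
Lemma vop_bound lo hi w v : window c lo hi -> dominated v -> itg w lo hi ->
  (forall t, lo < t <= hi -> 0 <= w t) ->
  (forall x t, lo < x <= hi -> lo < t <= hi -> c < t <= x \/ x < t <= c ->
     (`|a x * b t| + `|b x * a t|) * `|p t| * om t <= om x * w t) ->
  itg (fun t => w t * (`|v t| / om t)) lo hi /\
  forall x, lo < x <= hi -> `|vop v x| <= om x *
    (oint (fun t => w t * (`|v t| / om t)) c x +
     oint (fun t => w t * (`|v t| / om t)) x c).
Proof.
move=> dom dv wi w0 hw; have [lo0 loc chi _] := dom.
have [cv hv] := dv; have [C hC] := hv _ _ dom.
have gi : itg (fun t => w t * (`|v t| / om t)) lo hi.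
  apply: (itg_le _ _ (itgZ C wi)).
    apply: measurable_funM; first exact: itg_meas.
    apply: cont_meas => //; apply: contM.
      by move=> x x0; apply: (continuous_comp (cv _ x0)); exact: norm_continuous.
    by move=> x x0; apply: continuousV; [rewrite gt_eqF// om0|exact: com].
  move=> t tD; have t0 : 0 < t by apply: le_lt_trans lo0 _; case/andP: tD.
  rewrite normrM (ger0_norm (w0 _ tD)) mulrC ler_wpM2r ?w0// ger0_norm.
    by rewrite ler_pdivrMr ?om0// hC.
  by rewrite divr_ge0// ltW// om0.
split=> // x xD; have [lx xh] := andP xD.
have lA := dominated_locint dv (prim_cont pa) hap.
have lB := dominated_locint dv (prim_cont pb) hbp.
have x0 : 0 < x by exact: le_lt_trans lx.
have [iA iB] : itg (fun t => a t * (p t * v t)) lo hi /\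
    itg (fun t => b t * (p t * v t)) lo hi by split; [exact: lA|exact: lB].
have lx' := ltW lx.
have S f y z : itg f lo hi -> lo <= y -> z <= hi -> itg f y z.
  by move=> fi ? ?; exact: itgS fi.
pose k t := a x * (b t * (p t * v t)) - b x * (a t * (p t * v t)).
have -> : vop v x = sint c k x.
  rewrite /vop /sint /k !ointB ?ointZ; try by apply: itgZ; apply: S.
  - by ring.
  1-4: by apply: S.
rewrite mulrDr -!ointZ; try exact: S.
have ki y z : lo <= y -> z <= hi -> itg k y z.
  by move=> ? ?; apply: itgB; apply: itgZ; apply: S.
apply: le_norm_sint; rewrite ?ki//; try by apply: itgZ; apply: S.
move=> t ht; have tD : lo < t <= hi.
  case: ht => /andP[h1 h2].
    by rewrite (le_lt_trans loc h1) (le_trans h2 xh).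
  by rewrite (lt_trans lx h1) (le_trans h2 chi).
have t0 : 0 < t by apply: le_lt_trans lo0 _; case/andP: tD.
have := hw x t xD tD ht.
have vom : `|v t| = `|v t| / om t * om t by rewrite divfK// gt_eqF// om0.
have vo0 : 0 <= `|v t| / om t by rewrite divr_ge0// ltW// om0.
move=> h0; have := ler_wpM2r vo0 h0; rewrite -[X in _ <= X]mulrA => h1.
apply: le_trans h1.
rewrite /k; apply: le_trans (ler_normB _ _) _.
rewrite !normrM {1 2}vom le_eqVlt; apply/orP; left; apply/eqP.
by ring.
Qed.

Lemma vop_dominated v : dominated v -> dominated (vop v).
Proof.
move=> dv; split; first exact: prim_cont (vop_prim dv).1.
move=> lo hi dom; have [w [wi w0 hw]] := hk dom; have [lo0 loc chi _] := dom.
have [gi h] := vop_bound dom dv wi w0 hw.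
have g0 t : lo < t <= hi -> 0 <= w t * (`|v t| / om t).
  move=> tD; rewrite mulr_ge0 ?w0// divr_ge0// ltW// om0//.
  by apply: le_lt_trans lo0 _; case/andP: tD.
exists (oint (fun t => w t * (`|v t| / om t)) lo hi +
        oint (fun t => w t * (`|v t| / om t)) lo hi) => x xD.
apply: le_trans (h _ xD) _; rewrite mulrC ler_wpM2r//.
  by rewrite ltW// om0//; apply: le_lt_trans lo0 _; case/andP: xD.
move: xD => /andP[lx xh]; apply: lerD.
  have [cx|xc] := leP c x; first exact: le_oint_itv.
  by rewrite oint_nil ?(ltW xc)//; apply: oint_ge0.
have [cx|xc] := leP x c; first by apply: le_oint_itv => //; exact: ltW.
by rewrite oint_nil ?(ltW xc)//; apply: oint_ge0.
Qed.

Lemma vseq_dominated u0 n : dominated u0 -> dominated (vseq u0 n).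
Proof. by move=> d0; elim: n => //= n; exact: vop_dominated. Qed.

Lemma vseq_bound u0 lo hi (r : R) : dominated u0 -> window c lo hi -> 0 < r ->
  exists2 K, 0 <= K & forall n x, lo < x <= hi -> `|vseq u0 n x| <= K * om x / r ^+ n.
Proof.
move=> d0 dom r0; have [w [wi w0 hw]] := hk dom; have [lo0 loc chi _] := dom.
have [C hC] := d0.2 _ _ dom.
have dn n := vseq_dominated n d0.
have xp x : lo < x <= hi -> 0 < x by move=> /andP[+ _]; exact: le_lt_trans.
have [K hK] : exists K, forall n x, lo < x <= hi ->
    `|vseq u0 n x| / om x <= K / r ^+ n.
  apply: (@volterra_bound _ c lo hi w (fun n t => `|vseq u0 n t| / om t) C) => //.
  - by rewrite loc.
  - by move=> n; have [] := vop_bound dom (dn n) wi w0 hw.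
  - by move=> n t tD; rewrite divr_ge0// ltW// om0// xp.
  - by move=> t tD; rewrite ler_pdivrMr ?om0 ?xp// hC.
  - move=> n x xD; rewrite ler_pdivrMr ?om0 ?xp// mulrC.
    by have [_] := vop_bound dom (dn n) wi w0 hw; exact.
exists (Num.max K 0) => [|n x xD]; first by rewrite le_max lexx orbT.
have := hK n x xD; rewrite ler_pdivrMr ?om0 ?xp// => /le_trans; apply.
rewrite mulrAC ler_wpM2r ?ler_wpM2r ?le_max ?lexx//.
  by rewrite invr_ge0 exprn_ge0// ltW.
by rewrite ltW// om0// xp.
Qed.

End VolterraIteration.

(** * Series of solutions *)

Section GeometricSeries.
Context {R : realType}.
Implicit Types (a b : nat -> R) (x y C M : R).

Lemma exp2_gt (n : nat) : n%:R < 2 ^+ n :> R.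
Proof. by rewrite -natrX ltr_nat ltn_expl. Qed.

Lemma exp2_gt0 (n : nat) : 0 < 2 ^+ n :> R.
Proof. by rewrite exprn_gt0. Qed.

Lemma geo_small C (e : R) : 0 < e -> exists n : nat, C / 2 ^+ n < e.
Proof.
move=> e0; exists (Num.bound `|C / e|).
rewrite ltr_pdivrMr ?exp2_gt0// mulrC -ltr_pdivrMr// (le_lt_trans (ler_norm _))//.
by apply: lt_trans (exp2_gt _); exact: archi_boundP.
Qed.

Lemma eq_geo C x y : (forall n : nat, `|x - y| <= C / 2 ^+ n) -> x = y.
Proof.
move=> h; apply/eqP; rewrite -subr_eq0 -normr_le0; apply/ler_addgt0Pl => e e0.
have [n hn] := geo_small C e0.
by rewrite addr0 (le_trans (h n))// ltW.
Qed.

Definition geobd M a := forall n : nat, `|a n| <= M / 2 ^+ n.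

Definition ser a : R := limn (series a).

Lemma geobd_ge0 M a : geobd M a -> 0 <= M.
Proof. by move=> /(_ 0%N); rewrite expr0 divr1; exact: le_trans. Qed.

Lemma geo_sum M a N n : geobd M a -> (N <= n)%N ->
  `|series a n - series a N| <= 2 * M / 2 ^+ N.
Proof.
move=> ha; suff H j : `|series a (j + N)%N - series a N| <=
    2 * M / 2 ^+ N - 2 * M / 2 ^+ (j + N).
  move=> Nn; rewrite -(subnK Nn); apply: le_trans (H _) _.
  by rewrite gerBl divr_ge0// ?mulr_ge0 ?(geobd_ge0 ha)// ltW// exp2_gt0.
elim: j => [|j IH]; first by rewrite !add0n !subrr normr0.
rewrite addSn seriesSr addrAC (le_trans (ler_normD _ _))//.
apply: le_trans (lerD IH (ha _)) _.
rewrite exprS le_eqVlt; apply/orP; left; apply/eqP.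
by field; rewrite gt_eqF ?exp2_gt0// gt_eqF ?exp2_gt0.
Qed.

Lemma ser_tail M a N : geobd M a ->
  `|ser a - \sum_(0 <= k < N) a k| <= 2 * M / 2 ^+ N.
Proof.
move=> ha; have cv : cvgn (series a).
  apply/cauchy_cvgP/cauchy_seriesP => e e0.
  have [n hn] := geo_small (2 * M) e0.
  exists (`[n, +oo[, `[n, +oo[)%classic => /=.
    by split; exists n => //= k /= nk; rewrite in_itv/= andbT.
  move=> [k l] /=; rewrite !in_itv/= !andbT => -[nk nl].
  rewrite -[X in `|X|]/(\sum_(k <= i < l) a i).
  have [kl|lk] := leqP k l; last first.
    by rewrite big_geq ?normr0// ltnW.
  rewrite (_ : \sum_(k <= i < l) a i = series a l - series a k).
    apply: le_lt_trans (geo_sum ha kl) _; apply: le_lt_trans hn.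
    rewrite ler_wpM2l ?mulr_ge0 ?(geobd_ge0 ha)//.
    by rewrite lef_pV2 ?posrE ?exp2_gt0// ler_weXn2l// ler1n.
  by rewrite sub_series_geq.
apply/ler_addgt0Pl => e e0.
move/cvgrPdist_lt : cv => /(_ _ e0) [n _ hn].
have := hn (maxn n N) (leq_maxl _ _).
have := geo_sum ha (leq_maxr n N).
rewrite -/(ser a) {2}/series => h1 h2.
have -> : ser a - series a N = (ser a - series a (maxn n N)) +
    (series a (maxn n N) - series a N) by ring.
by rewrite (le_trans (ler_normD _ _))// lerD// ltW.
Qed.

Lemma ser_unique M C a x : geobd M a ->
  (forall N, `|x - \sum_(0 <= k < N) a k| <= C / 2 ^+ N) -> ser a = x.
Proof.
move=> ha hx; apply: (@eq_geo (2 * M + C)) => n.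
rewrite mulrDl -(subrKA (\sum_(0 <= k < n) a k)) (le_trans (ler_normD _ _))//.
by apply: lerD; [exact: ser_tail|rewrite distrC].
Qed.

Lemma ser_bound M a : geobd M a -> `|ser a| <= 2 * M.
Proof.
by move=> /ser_tail - /(_ 0%N); rewrite big_nil subr0 expr0 divr1.
Qed.

Lemma geobdD M C a b : geobd M a -> geobd C b ->
  geobd (M + C) (fun n => a n + b n).
Proof.
by move=> ha hb n; rewrite mulrDl (le_trans (ler_normD _ _))// lerD.
Qed.

Lemma geobdZ M k a : geobd M a -> geobd (`|k| * M) (fun n => k * a n).
Proof. by move=> ha n; rewrite normrM -mulrA ler_wpM2l. Qed.

Lemma serD M C a b : geobd M a -> geobd C b ->
  ser (fun n => a n + b n) = ser a + ser b.
Proof.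
move=> ha hb; apply: (ser_unique (C := 2 * M + 2 * C) (geobdD ha hb)) => N.
rewrite big_split/= opprD addrACA (le_trans (ler_normD _ _))//.
by rewrite mulrDl lerD//; exact: ser_tail.
Qed.

Lemma serZ M k a : geobd M a -> ser (fun n => k * a n) = k * ser a.
Proof.
move=> ha; apply: (ser_unique (C := `|k| * (2 * M)) (geobdZ k ha)) => N.
by rewrite -mulr_sumr -mulrBr normrM -!mulrA ler_wpM2l// mulrA; exact: ser_tail.
Qed.

Lemma geobdS M a : geobd M a -> geobd M (fun n => a n.+1).
Proof.
move=> ha n; apply: le_trans (ha n.+1) _; rewrite ler_wpM2l ?(geobd_ge0 ha)//.
by rewrite lef_pV2 ?posrE ?exp2_gt0// ler_weXn2l// ler1n.
Qed.

Lemma ser_recl M a : geobd M a -> ser a = a 0%N + ser (fun n => a n.+1).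
Proof.
move=> ha; have ha' := geobdS ha.
apply: (ser_unique (C := 2 * (2 * M)) ha) => -[|N].
  rewrite big_nil subr0 expr0 divr1 (le_trans (ler_normD _ _))//.
  have := ser_bound ha'; have := ha 0%N; rewrite expr0 divr1.
  by have := geobd_ge0 ha; lra.
rewrite big_nat_recl// opprD addrACA subrr add0r exprS -mulf_div divff// mul1r.
exact: ser_tail.
Qed.

(** The fixed ratio [1 / 2] of [geobd] suffices everywhere: weights growing like [s ^+ n] are
    absorbed by coefficients whose decay rate may be taken to be [2 s]. *)
Lemma geobd_pow (D K s : R) (r v : nat -> R) : 0 < s -> 0 <= D ->
  (forall n, `|r n| <= D * s ^+ n) -> (forall n, `|v n| <= K / (2 * s) ^+ n) ->
  geobd (D * K) (fun n => r n * v n).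
Proof.
move=> s0 D0 hr hv n; rewrite normrM; apply: le_trans (ler_pM _ _ (hr n) (hv n)) _ => //.
rewrite exprMn le_eqVlt; apply/orP; left; apply/eqP.
by field; rewrite !expf_neq0// gt_eqF.
Qed.

End GeometricSeries.

(** * Termwise passage to the limit in second order equations *)

Section SeriesOfSolutions.
Context {R : realType}.
Local Notation mu := (@lebesgue_measure R).
Local Notation posR := (`]0, +oo[%classic : set R).

Lemma cont_limit (U : nat -> R -> R) (u : R -> R) : (forall N, cont (U N)) ->
  (forall y x, 0 < y -> exists C, forall N t, y < t <= x ->
     `|U N t - u t| <= C / 2 ^+ N) -> cont u.
Proof.
move=> cU h x x0; apply/contP => e e0.
have x20 : 0 < x / 2 by lra.
have e3 : 0 < e / 3 by lra.
have [C hC] := h (x / 2) (x + 1) x20; have [N hN] := geo_small C e3.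
have [d d0 hd] := (contP _ _).1 (cU N x x0) _ e3.
exists (Num.min d (Num.min (x / 2) 1)).
  by rewrite !lt_min d0 x20 ltr01.
move=> y; rewrite !lt_min => /and3P[yd].
rewrite !ltr_norml => /andP[? ?] /andP[? ?].
have hy : `|U N y - u y| < e / 3.
  by apply: le_lt_trans hN; apply: hC; apply/andP; split; lra.
have hx : `|U N x - u x| < e / 3.
  by apply: le_lt_trans hN; apply: hC; apply/andP; split; lra.
have := hd _ yd; move: hy hx; rewrite !ltr_norml.
by move=> /andP[? ?] /andP[? ?] /andP[? ?]; apply/andP; split; lra.
Qed.

(** No convergence of the first derivatives [U1 N] is assumed. Their increments converge because the
    [F N] do, and the missing constant [U1 N 1] is recovered by integrating over []1, 2]], where the
    integral of [U1 N] is the convergent difference [U N 2 - U N 1]. *)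
Lemma prim2_lim (U U1 F : nat -> R -> R) (u f : R -> R) :
  (forall N, prim (U1 N) (U N)) -> (forall N, prim (F N) (U1 N)) ->
  (forall y x, 0 < y -> itg f y x) ->
  (forall y x, 0 < y -> exists2 G, itg G y x &
     forall N t, y < t <= x -> `|F N t - f t| <= G t / 2 ^+ N) ->
  (forall x, 0 < x -> exists C, forall N : nat, `|U N x - u x| <= C / 2 ^+ N) ->
  exists u1, [/\ prim u1 u, prim f u1 &
    forall x, 0 < x -> exists C, forall N : nat, `|U1 N x - u1 x| <= C / 2 ^+ N].
Proof.
move=> pU pU1 fi hF hU.
have l1 : locint 1 f.
  move=> lo hi [lo0 _ _ h]; apply: fi; rewrite lt_def lo0 andbT.
  by apply/eqP => /h /eqP; rewrite oner_eq0.
pose h := sint 1 f; have ph : prim f h by apply: sint_prim.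
(* [k] is the limit of [U1 N 1]: integrating [u1 = k + h] over []1, 2]], an interval of length one,
   must give [u 2 - u 1]. *)
pose k := u 2 - u 1 - oint h 1 2; pose u1 t := k + h t.
have pu1 : prim f u1.
  by apply: eq_prim (primD (prim_cst k) ph) => // t _; rewrite add0r.
have key y x : 0 < y -> y <= x -> exists C, forall N t,
    Num.min y 1 <= t -> t <= Num.max x 2 -> `|U1 N t - u1 t| <= C / 2 ^+ N.
  move=> y0 yx.
  pose lo := Num.min y 1; pose hi := Num.max x 2.
  have lo0 : 0 < lo by rewrite lt_min y0 ltr01.
  have lo1 : lo <= 1 by rewrite ge_min lexx orbT.
  have loy : lo <= y by rewrite ge_min lexx.
  have hi2 : 2 <= hi by rewrite le_max lexx orbT.
  have hix : x <= hi by rewrite le_max lexx.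
  have [G Gi hG] := hF lo hi lo0.
  pose I := oint (fun t => `|G t|) lo hi.
  have I0 : 0 <= I by apply: oint_ge0.
  have Fi N a b : 0 < a -> itg (F N) a b by move=> ?; exact: prim_itg (pU1 N) _.
  pose g N t := F N t - f t.
  have gi N a b : 0 < a -> itg (g N) a b.
    by move=> ?; apply: itgB; [exact: Fi|exact: fi].
  have gb N a b : lo <= a -> a <= b -> b <= hi -> `|oint (g N) a b| <= I / 2 ^+ N.
    move=> la ab bh; have a0 : 0 < a by exact: lt_le_trans la.
    apply: (@le_trans _ _ (oint (fun t => (2 ^+ N)^-1 * `|G t|) a b)).
      apply: le_norm_oint; [exact: gi|apply/itgZ/itg_norm/(itgS _ _ Gi) => //|].
      move=> t /andP[at_ tb]; rewrite mulrC.
      have tD : lo < t <= hi by rewrite (le_lt_trans la at_) (le_trans tb bh).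
      apply: le_trans (hG N t tD) _; rewrite ler_wpM2r ?ler_norm//.
    rewrite ointZ; last exact/itg_norm/(itgS _ _ Gi).
    rewrite mulrC ler_wpM2r ?invr_ge0 ?(ltW (exp2_gt0 _))//.
    by apply: le_oint_itv => //; exact: itg_norm.
  have hb N t : lo <= t -> t <= hi -> `|(U1 N t - U1 N 1) - h t| <= I / 2 ^+ N.
    move=> lt th; have t0 : 0 < t by exact: lt_le_trans lt.
    have h1 : h 1 = 0 by rewrite /h /sint !oint_nil// subrr.
    rewrite -[h t]subr0 -h1; have [t1|/ltW t1] := leP 1 t.
      rewrite (prim_oint (pU1 N))// (prim_oint ph)// -ointB; [|exact: Fi|exact: fi].
      by apply: gb => //; lra.
    have -> : U1 N t - U1 N 1 - (h t - h 1) = - ((U1 N 1 - U1 N t) - (h 1 - h t)).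
      by ring.
    rewrite normrN.
    rewrite (prim_oint (pU1 N))// (prim_oint ph)// -ointB; [|exact: Fi|exact: fi].
    by apply: gb => //; lra.
  have [C2 hC2] : exists C, forall N : nat, `|U N 2 - u 2| <= C / 2 ^+ N by exact: hU.
  have [C1 hC1] : exists C, forall N : nat, `|U N 1 - u 1| <= C / 2 ^+ N by exact: hU.
  have ci N a b : 0 < a -> itg (U1 N) a b by move=> ?; exact: prim_itg (pU N) _.
  have chi a b : 0 < a -> itg h a b by move=> ?; apply: cont_itg => //; exact: prim_cont ph.
  have kb N : `|U1 N 1 - k| <= (C2 + C1 + I) / 2 ^+ N.
    have E : oint (fun t => (U1 N t - U1 N 1) - h t) 1 2 =
        U N 2 - U N 1 - U1 N 1 - oint h 1 2.
      have le12 : 1 <= 2 :> R by rewrite ler1n.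
      have c1 : itg (fun=> U1 N 1) 1 2 by exact: itg_cst.
      have i1 : itg (U1 N) 1 2 by exact: ci.
      have i2 : itg h 1 2 by exact: chi.
      rewrite (ointB (itgB i1 c1) i2) (ointB i1 c1) -(prim_oint (pU N) ltr01 le12).
      by rewrite (oint_cst (U1 N 1) le12); ring.
    have B : `|oint (fun t => (U1 N t - U1 N 1) - h t) 1 2| <= I / 2 ^+ N.
      apply: le_trans (le_norm_oint _ (itg_cst 1 2 (I / 2 ^+ N)) _) _.
      - by apply: itgB; [apply: itgB; [exact: ci|exact: itg_cst]|exact: chi].
      - by move=> t /andP[? ?]; apply: hb; lra.
      - by rewrite oint_cst ?ler1n// (_ : 2 - 1 = 1) ?mulr1//; ring.
    have -> : U1 N 1 - k = (U N 2 - u 2) - (U N 1 - u 1) -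
        oint (fun t => (U1 N t - U1 N 1) - h t) 1 2 by rewrite E /k; ring.
    rewrite !mulrDl (le_trans (ler_normB _ _))// lerD//.
    by rewrite (le_trans (ler_normB _ _))// lerD.
  exists (C2 + C1 + I + I) => N t lt th.
  have -> : U1 N t - u1 t = (U1 N 1 - k) + ((U1 N t - U1 N 1) - h t).
      by rewrite /u1; ring.
    by rewrite (mulrDl _ I) (le_trans (ler_normD _ _))// lerD// hb.
have ci N a b : 0 < a -> itg (U1 N) a b by move=> ?; exact: prim_itg (pU N) _.
have cui a b : 0 < a -> itg u1 a b by move=> ?; apply: cont_itg => //; exact: prim_cont pu1.
exists u1; split=> // [y x y0 yx|x x0]; last first.
  have [C hC] := key x x x0 (lexx _); exists C => N; apply: hC.
    by rewrite ge_min lexx.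
  by rewrite le_max lexx.
split; first exact: cui.
have [Cu ub] := key y x y0 yx.
have [Cx hCx] : exists C, forall N : nat, `|U N x - u x| <= C / 2 ^+ N.
  by apply: hU; exact: lt_le_trans yx.
have [Cy hCy] : exists C, forall N : nat, `|U N y - u y| <= C / 2 ^+ N by exact: hU.
apply: (@eq_geo _ (Cx + Cy + Cu * (x - y))) => N.
have -> : u x - u y - oint u1 y x = - (U N x - u x) + (U N y - u y) +
    oint (fun t => U1 N t - u1 t) y x.
  by rewrite ointB ?cui ?ci// -(prim_oint (pU N))//; ring.
have B : `|oint (fun t => U1 N t - u1 t) y x| <=
    Cu * (x - y) / 2 ^+ N.
  rewrite mulrAC -(oint_cst _ yx); apply: le_norm_oint.
  - by apply: itgB; [exact: ci|exact: cui].
  - exact: itg_cst.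
  - move=> t /andP[yt tx]; apply: ub.
      by rewrite ge_min (ltW yt).
    by rewrite le_max tx.
rewrite (mulrDl _ (_ * (x - y)) (_ ^-1)) (le_trans (ler_normD _ _))//.
apply: lerD => //; rewrite mulrDl (le_trans (ler_normD _ _))// normrN.
by apply: lerD.
Qed.

Section Sum.
Variables (V p : R -> R) (u u1 : nat -> R -> R).
Hypotheses (Vi : forall y x, 0 < y -> itg V y x) (pi : forall y x, 0 < y -> itg p y x).
Hypotheses (pu : forall n, prim (u1 n) (u n)) (pu0 : prim (fun t => V t * u 0%N t) (u1 0%N))
  (puS : forall n, prim (fun t => V t * u n.+1 t + p t * u n t) (u1 n.+1)).
Hypothesis ub : forall y x (r : R), 0 < y -> 0 < r -> exists2 K, 0 <= K &
  forall n t, y < t <= x -> `|u n t| <= K / r ^+ n.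

Lemma ub_geobd (D s y x : R) (rho : nat -> R) : 0 < s -> 0 <= D -> 0 < y ->
  (forall n, `|rho n| <= D * s ^+ n) ->
  exists M, forall t, y < t <= x -> geobd M (fun n => rho n * u n t).
Proof.
move=> s0 D0 y0 hr; have s20 : 0 < 2 * s by rewrite mulr_gt0.
have [K K0 hK] := ub x y0 s20.
by exists (D * K) => t tD; apply: geobd_pow hr _ => // n; exact: hK.
Qed.

Lemma ser_cont (D s : R) (rho : nat -> R) : 0 < s -> 0 <= D ->
  (forall n, `|rho n| <= D * s ^+ n) -> cont (fun t => ser (fun n => rho n * u n t)).
Proof.
move=> s0 D0 hr.
apply: (@cont_limit (fun N t => \sum_(0 <= k < N) rho k * u k t)).
  elim=> [|N IH].
    apply: (@cont_eq R (fun=> 0)); last exact: cont_cst.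
    by move=> x _; rewrite big_nil.
  apply: (cont_eq (F := fun t => \sum_(0 <= k < N) rho k * u k t + rho N * u N t)).
    by move=> x _; rewrite big_nat_recr.
  apply: contD => //; apply: contM; [exact: cont_cst|exact: prim_cont (pu N)].
move=> y x y0; have [M hM] := ub_geobd x s0 D0 y0 hr.
by exists (2 * M) => N t tD; rewrite distrC; apply: ser_tail; exact: hM.
Qed.

Lemma shift_bd (D s : R) (rho : nat -> R) :
  (forall n, `|rho n| <= D * s ^+ n) -> forall n, `|rho n.+1| <= D * s * s ^+ n.
Proof. by move=> hr n; rewrite -mulrA -exprS. Qed.

(** The weights [rho] are [1] for the Volterra series of the perturbation [p = q], and the real or
    imaginary part of [z ^+ n] for power series in [z], where [p = -1]. The recursion for [u] shifts
    the index, which is why [rho n.+1] meets [u n] in the equation. The last clause lets the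
    derivative of the sum be read off termwise at a point. *)
Lemma ser_solution (D s : R) (rho : nat -> R) : 0 < s -> 0 <= D ->
  (forall n, `|rho n| <= D * s ^+ n) ->
  exists w1, [/\ prim w1 (fun t => ser (fun n => rho n * u n t)),
    prim (fun t => V t * ser (fun n => rho n * u n t) +
                   p t * ser (fun n => rho n.+1 * u n t)) w1 &
    forall x, 0 < x -> exists C, forall N : nat,
      `|\sum_(0 <= k < N.+1) rho k * u1 k x - w1 x| <= C / 2 ^+ N].
Proof.
move=> s0 D0 hr; have hr' := shift_bd hr.
have D0' : 0 <= D * s by rewrite mulr_ge0// ltW.
pose w t := ser (fun n => rho n * u n t); pose v t := ser (fun n => rho n.+1 * u n t).
have cw : cont w := ser_cont s0 D0 hr.
have cv : cont v := ser_cont s0 D0' hr'.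
pose F N t := V t * (\sum_(0 <= k < N.+1) rho k * u k t) +
  p t * (\sum_(0 <= k < N) rho k.+1 * u k t).
apply: (@prim2_lim (fun N t => \sum_(0 <= k < N.+1) rho k * u k t)
  (fun N t => \sum_(0 <= k < N.+1) rho k * u1 k t) F).
- elim=> [|N IH].
    by apply: eq_prim (primZ (rho 0%N) (pu 0%N)) => t _; rewrite big_nat1.
  by apply: eq_prim (primD IH (primZ (rho N.+1) (pu N.+1))) => t _;
    rewrite [RHS]big_nat_recr.
- elim=> [|N IH].
    apply: eq_prim (primZ (rho 0%N) pu0) => t _; rewrite /F ?big_nat1//.
    by rewrite big_nil; ring.
  apply: eq_prim (primD IH (primZ (rho N.+1) (puS N))) => t _; last first.
    by rewrite [RHS]big_nat_recr.
  rewrite /F [in RHS]big_nat_recr//= [X in _ = _ + _ * X]big_nat_recr//=.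
  by ring.
- move=> y x y0; apply: itgD.
    by apply: itgM_cont => //; exact: Vi.
  by apply: itgM_cont => //; exact: pi.
- move=> y x y0; have [M hM] := ub_geobd x s0 D0 y0 hr.
  have [M' hM'] := ub_geobd x s0 D0' y0 hr'.
  exists (fun t => (2 * M) * `|V t| + (2 * M') * `|p t|).
    by apply: itgD; apply/itgZ/itg_norm; [exact: Vi|exact: pi].
  move=> N t tD; have hMt := hM t tD; have hMt' := hM' t tD.
  have M0 : 0 <= M := geobd_ge0 hMt.
  rewrite /F opprD addrACA -!mulrBr mulrDl (le_trans (ler_normD _ _))//.
  apply: lerD; rewrite normrM mulrC mulrAC ler_wpM2r//; last first.
    by rewrite distrC; exact: ser_tail.
  rewrite distrC (le_trans (ser_tail _ hMt))// ler_wpM2l ?mulr_ge0//.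
  by rewrite lef_pV2 ?posrE ?exp2_gt0// ler_weXn2l// ler1n.
- move=> x x0; have x20 : 0 < x / 2 by lra.
  have [M hM] := ub_geobd x s0 D0 x20 hr.
  have hMt : geobd M (fun n => rho n * u n x) by apply: hM; apply/andP; split; lra.
  have M0 : 0 <= M := geobd_ge0 hMt.
  exists (2 * M) => N; rewrite distrC (le_trans (ser_tail _ hMt))// ler_wpM2l ?mulr_ge0//.
  by rewrite lef_pV2 ?posrE ?exp2_gt0// ler_weXn2l// ler1n.
Qed.

End Sum.
End SeriesOfSolutions.

(** * The free equation *)

Section FreeSolutions.
Context {R : realType}.
Implicit Types (l x y t : R).

Lemma powR_sub1 x (s : R) : 0 < x -> x `^ (s - 1) = x `^ s / x.
Proof. by move=> x0; rewrite powRD ?powR_inv1 ?ltW// (gt_eqF x0) implybT. Qed.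

Lemma powR_add1 x (s : R) : 0 < x -> x `^ (s + 1) = x `^ s * x.
Proof. by move=> x0; rewrite powRD ?powRr1 ?ltW// (gt_eqF x0) implybT. Qed.

Lemma powR_add x (s u : R) : 0 < x -> x `^ (s + u) = x `^ s * x `^ u.
Proof. by move=> x0; rewrite powRD// (gt_eqF x0) implybT. Qed.

Lemma cont_powR (s : R) : cont (fun x : R => x `^ s).
Proof.
move=> x x0; apply: differentiable_continuous; apply/derivable1_diffP.
exact: (@ex_derive _ _ _ _ _ _ _ (is_derive1_powR s x0)).
Qed.

Lemma cont_ln : cont (@ln R).
Proof. by move=> x x0; exact: continuous_ln. Qed.

Lemma cont_inv (F : R -> R) : cont F -> (forall x, 0 < x -> F x != 0) ->
  cont (fun x => (F x)^-1).
Proof. by move=> cF F0 x x0; apply: continuousV; [exact: F0|exact: cF]. Qed.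

Lemma cont_norm (F : R -> R) : cont F -> cont (fun x => `|F x|).
Proof.
by move=> cF x x0; apply: (continuous_comp (cF _ x0)); exact: norm_continuous.
Qed.

Lemma cont_id : cont (fun x : R => x).
Proof. by move=> x x0. Qed.

(* For [l = - 1/2] the solution [fb] vanishes at [1], so it is majorized by [fB],
   where [1 + |ln x|] replaces [- ln x]. *)
Definition lw l x : R := if - 2^-1 < l then 1 else 1 + `|ln x|.
Definition fA l x : R := x `^ (l + 1).
Definition fA1 l x : R := (l + 1) * x `^ l.
Definition fB l x : R := x `^ (- l) * lw l x.
Definition fb l x : R :=
  if - 2^-1 < l then x `^ (- l) / (2 * l + 1) else - ln x * x `^ 2^-1.
Definition fb1 l x : R :=
  if - 2^-1 < l then - l * x `^ (- l - 1) / (2 * l + 1)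
  else - (x `^ (2^-1 - 1) * (1 + ln x / 2)).
Definition V0 l x : R := l * (l + 1) / x ^+ 2.

Variable l : R.
Hypothesis hl : - 2^-1 <= l.

Let lcase : (- 2^-1 < l) + ((- 2^-1 < l) = false) * (l = - 2^-1).
Proof.
case: (ltP (- 2^-1) l) => h; [by left|right; split=> //].
by apply/eqP; rewrite eq_le hl h.
Qed.

Lemma lw_ge1 x : 1 <= lw l x.
Proof. by rewrite /lw; case: ifP => // _; rewrite lerDl. Qed.

Lemma lw_gt0 x : 0 < lw l x.
Proof. exact: lt_le_trans (lw_ge1 x). Qed.

Lemma fA_gt0 x : 0 < x -> 0 < fA l x.
Proof. exact: powR_gt0. Qed.

Lemma fB_gt0 x : 0 < x -> 0 < fB l x.
Proof. by move=> x0; rewrite mulr_gt0 ?powR_gt0 ?lw_gt0. Qed.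

Lemma cont_lw : cont (lw l).
Proof.
case: lcase => [h|[h _]].
  by apply: (@cont_eq R (fun=> 1)) => [x _|]; [rewrite /lw h|exact: cont_cst].
apply: (@cont_eq R (fun x => 1 + `|ln x|)) => [x _|]; first by rewrite /lw h.
by apply: contD; [exact: cont_cst|exact: cont_norm cont_ln].
Qed.

Lemma cont_fA : cont (fA l). Proof. exact: cont_powR. Qed.

Lemma cont_fB : cont (fB l).
Proof. by apply: contM; [exact: cont_powR|exact: cont_lw]. Qed.

(** This product is the weight against which [q] has to be integrable near [0]; it links the
    Volterra kernel with the hypotheses on [x q(x)]. *)
Lemma fAB x : 0 < x -> fA l x * fB l x = x * lw l x.
Proof.
move=> x0; rewrite /fA /fB powRN powR_add1//.
by field; rewrite gt_eqF// powR_gt0.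
Qed.

Lemma cont_V0 : cont (V0 l).
Proof.
apply: contM; first exact: cont_cst.
apply: cont_inv => [|x x0]; last by rewrite expf_neq0// gt_eqF.
by apply: (contM cont_id cont_id).
Qed.

Lemma prim_fA : prim (fA1 l) (fA l).
Proof.
apply: derive_prim; last by apply: contM; [exact: cont_cst|exact: cont_powR].
move=> x x0; apply: is_derive_eq (is_derive1_powR (l + 1) x0) _.
by rewrite addrK.
Qed.

Lemma prim_fA1 : prim (fun t => V0 l t * fA l t) (fA1 l).
Proof.
apply: derive_prim; last by apply: contM; [exact: cont_V0|exact: cont_fA].
move=> x x0.
have h := is_deriveM (is_derive_cst (l + 1) x 1) (is_derive1_powR l x0).
apply: is_derive_eq h _.
rewrite /V0 /fA powR_sub1// powR_add1// !scaler0 ?addr0 /GRing.scale/=.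
by field; rewrite gt_eqF.
Qed.

Lemma cont_fb : cont (fb l).
Proof.
case: lcase => [h|[h _]].
  apply: (@cont_eq R (fun x => x `^ (- l) / (2 * l + 1))) => [x _|].
    by rewrite /fb h.
  by apply: contM; [exact: cont_powR|exact: cont_cst].
apply: (@cont_eq R (fun x => - ln x * x `^ 2^-1)) => [x _|]; first by rewrite /fb h.
by apply: contM; [exact: contN cont_ln|exact: cont_powR].
Qed.

Lemma cont_fb1 : cont (fb1 l).
Proof.
case: lcase => [h|[h _]].
  apply: (@cont_eq R (fun x => - l * x `^ (- l - 1) / (2 * l + 1))) => [x _|].
    by rewrite /fb1 h.
  apply: contM; last exact: cont_cst.
  by apply: contM; [exact: cont_cst|exact: cont_powR].
apply: (@cont_eq R (fun x => - (x `^ (2^-1 - 1) * (1 + ln x / 2)))) => [x _|].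
  by rewrite /fb1 h.
apply: contN; apply: contM; first exact: cont_powR.
apply: contD; first exact: cont_cst.
by apply: contM; [exact: cont_ln|exact: cont_cst].
Qed.

Lemma prim_fb : prim (fb1 l) (fb l).
Proof.
apply: derive_prim; last exact: cont_fb1.
case: lcase => [h|[h lE]] x x0.
  rewrite /fb /fb1 h.
  have d := is_deriveM (is_derive1_powR (- l) x0) (is_derive_cst (2 * l + 1)^-1 x 1).
  apply: is_derive_eq d _.
  by rewrite scaler0 add0r /GRing.scale/= mulrC.
rewrite /fb /fb1 h.
have d := is_deriveM (is_deriveN (is_derive1_ln x0)) (is_derive1_powR 2^-1 x0).
apply: is_derive_eq d _.
rewrite /GRing.scale/= powR_sub1// (_ : (- @ln R) x = - ln x)//.
by field; rewrite gt_eqF.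
Qed.

Lemma prim_fb1 : prim (fun t => V0 l t * fb l t) (fb1 l).
Proof.
apply: derive_prim; last by apply: contM; [exact: cont_V0|exact: cont_fb].
case: lcase => [h|[h lE]] x x0.
  rewrite /fb /fb1 h.
  have d := is_deriveM (is_deriveM (is_derive_cst (- l) x 1)
    (is_derive1_powR (- l - 1) x0)) (is_derive_cst (2 * l + 1)^-1 x 1).
  apply: is_derive_eq d _.
  rewrite !scaler0 ?add0r ?addr0 /GRing.scale/= /V0 !powR_sub1//.
  by field; rewrite gt_eqF//=; lra.
rewrite /fb /fb1 h /V0 lE.
have d := is_deriveN (is_deriveM (is_derive1_powR (2^-1 - 1) x0)
   (is_deriveD (is_derive_cst (1 : R) x 1)
     (is_deriveM (is_derive1_ln x0) (is_derive_cst (2^-1 : R) x 1)))).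
apply: is_derive_eq d _.
rewrite !scaler0 ?add0r ?addr0 /GRing.scale/= !powR_sub1//.
rewrite (_ : (cst 1 + @ln R * cst 2^-1) x = 1 + ln x / 2)//.
by field; rewrite gt_eqF.
Qed.

Lemma wronskian_free x : 0 < x -> fb l x * fA1 l x - fb1 l x * fA l x = 1.
Proof.
move=> x0; case: lcase => [h|[h lE]]; rewrite /fb /fA1 /fb1 /fA h.
  rewrite powR_sub1// powR_add1// powRN.
  by field; rewrite !gt_eqF//= ?powR_gt0//; lra.
rewrite lE (_ : - 2^-1 + 1 = 2^-1); last by field.
rewrite powR_sub1// powRN.
have h2 : x `^ 2^-1 * x `^ 2^-1 = x.
  by rewrite -powR_add// (_ : 2^-1 + 2^-1 = 1) ?powRr1 ?ltW//; field.
have y0 := powR_gt0 2^-1 x0; move: h2 y0; set y := x `^ 2^-1 => h2 y0.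
by rewrite -h2; field; rewrite gt_eqF.
Qed.

Lemma fb_le : exists2 C, 0 < C & forall x, 0 < x -> `|fb l x| <= C * fB l x.
Proof.
case: lcase => [h|[h lE]].
  have h0 : 0 < 2 * l + 1 by lra.
  exists (2 * l + 1)^-1; first by rewrite invr_gt0.
  move=> x x0; rewrite /fb /fB /lw h mulr1 normrM mulrC (ger0_norm (powR_ge0 _ _)).
  by rewrite ger0_norm// invr_ge0 ltW.
exists 1 => // x x0; rewrite /fb /fB /lw h lE opprK mul1r normrM normrN.
by rewrite (ger0_norm (powR_ge0 _ _)) mulrC ler_wpM2l ?powR_ge0// lerDr.
Qed.

Lemma lw_mono X : exists2 k, 0 < k &
  forall t x, 0 < t -> t <= x -> x <= X -> lw l x <= k * lw l t.
Proof.
exists (1 + `|ln X|) => [|t x t0 tx xX]; first by rewrite ltr_pwDl.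
have x0 : 0 < x by exact: lt_le_trans tx.
case: lcase => [h|[h lE]]; rewrite /lw h; first by rewrite mulr1 lerDl.
have h1 : ln x <= ln X by rewrite ler_ln// posrE// (lt_le_trans x0).
have h2 : ln t <= ln x by rewrite ler_ln.
have : `|ln x| <= `|ln X| + `|ln t|.
  rewrite ler_norml; have := ler_norm (ln X); have := ler_norm (- ln t).
  rewrite normrN; have := normr_ge0 (ln t); have := normr_ge0 (ln X).
  by move=> ? ? ? ?; apply/andP; split; lra.
by have := normr_ge0 (ln t); have := normr_ge0 (ln X); nra.
Qed.

(** The kernel inequality at the singular endpoint. It amounts to [t ^ (2 l + 1) <= x ^ (2 l + 1)],
    true because [2 l + 1 >= 0], and to [lw_mono] for the logarithm. *)
Lemma fB_mono X : exists2 k, 0 < k &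
  forall t x, 0 < t -> t <= x -> x <= X -> fB l x * fA l t <= k * fA l x * fB l t.
Proof.
have [k k0 hk] := lw_mono X; exists k => // t x t0 tx xX.
have x0 : 0 < x by exact: lt_le_trans tx.
have g0 : 0 <= 2 * l + 1 by have := hl; lra.
have h : t `^ (2 * l + 1) <= x `^ (2 * l + 1).
  by rewrite ge0_ler_powR// nnegrE ltW.
have E s : 0 < s -> s `^ (2 * l + 1) = s `^ l * fA l s.
  by move=> s0; rewrite /fA -powR_add//; congr (_ `^ _); ring.
have fBE s : fB l s = (s `^ l)^-1 * lw l s by rewrite /fB powRN.
move: h; rewrite !E// !fBE => h.
have tl := powR_gt0 l t0; have xl := powR_gt0 l x0.
have At := fA_gt0 t0; have Ax := fA_gt0 x0.
have h' : (x `^ l)^-1 * fA l t <= fA l x * (t `^ l)^-1.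
  rewrite mulrC ler_pdivrMr// mulrAC ler_pdivlMr// mulrC.
  by rewrite (mulrC (fA l x)).
have tli : 0 <= (x `^ l)^-1 * fA l t by rewrite ltW// mulr_gt0// invr_gt0.
have := ler_pM tli (ltW (lw_gt0 _)) h' (hk _ _ t0 tx xX).
rewrite [X in X <= _]mulrAC => /le_trans; apply.
by rewrite le_eqVlt; apply/orP; left; apply/eqP; ring.
Qed.

(** The kernel inequality read at the fixed point [x = X], where [fA] and [fB] are positive
    numbers. *)
Lemma fA_le_fB X : exists2 k, 0 < k &
  forall t, 0 < t -> t <= X -> fA l t <= k * fB l t.
Proof.
have [X0|X0] := leP X 0.
  by exists 1 => // t t0 tX; move: (le_trans tX X0); rewrite leNgt t0.
have [k k0 hk] := fB_mono X.
exists (k * fA l X / fB l X) => [|t t0 tX].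
  by rewrite divr_gt0 ?(fB_gt0 X0)// mulr_gt0 ?(fA_gt0 X0).
by rewrite mulrAC ler_pdivlMr ?fB_gt0// mulrC; apply: hk.
Qed.

End FreeSolutions.

(** * Solutions at [z = 0] *)

Section BaseZero.
Context {R : realType}.
(** Two instances occur: [fA l], [fb l] with the perturbation [q], which produces the regular
    solution at [z = 0], and the perturbed pair [f], [g] with the perturbation [-1], which produces
    the coefficients of the powers of [z]. *)
Variables (l : R) (a b p : R -> R).
Local Notation posR := (`]0, +oo[%classic : set R).
Hypothesis hl : - 2^-1 <= l.
Hypotheses (ca : cont a) (cb : cont b).
Hypothesis ha : forall X, exists2 C, 0 <= C &
  forall t, 0 < t -> t <= X -> `|a t| <= C * fA l t.
Hypothesis hb : forall X, exists2 C, 0 <= C &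
  forall t, 0 < t -> t <= X -> `|b t| <= C * fB l t.
Hypothesis mp : measurable_fun posR p.
Hypothesis hp : forall X, itg (fun t => fA l t * fB l t * p t) 0 X.

Lemma window0 lo hi : window (0 : R) lo hi -> lo = 0.
Proof. by case=> h1 h2 _ _; apply/eqP; rewrite eq_le h1 h2. Qed.

Let norm_ABp t : 0 < t -> `|fA l t * fB l t * p t| = fA l t * fB l t * `|p t|.
Proof. by move=> t0; rewrite normrM gtr0_norm// mulr_gt0 ?fA_gt0 ?fB_gt0. Qed.

Lemma base0_locint_a : locint 0 (fun t => a t * p t * fA l t).
Proof.
move=> lo X /window0 ->.
have [C C0 hC] := ha X; have [k k0 hk] := fA_le_fB hl X.
apply: (itg_le _ _ (itgZ (C * k) (itg_norm (hp X)))).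
  apply: measurable_funM; last by apply: cont_meas => //; exact: cont_fA.
  by apply: measurable_funM; [exact: cont_meas|exact: pos_meas].
move=> t /andP[t0 tX]; have A0 := fA_gt0 l t0; have B0 := fB_gt0 l t0.
rewrite norm_ABp// normrM (gtr0_norm A0) normrM.
rewrite (_ : _ * _ * fA l t = (`|a t| * fA l t) * `|p t|); last by ring.
rewrite mulrA ler_wpM2r//; apply: le_trans (ler_wpM2r (ltW A0) (hC t t0 tX)) _.
rewrite (_ : C * fA l t * fA l t = (C * fA l t) * fA l t)//.
apply: le_trans (ler_wpM2l _ (hk t t0 tX)) _; first by rewrite mulr_ge0// ltW.
by rewrite le_eqVlt; apply/orP; left; apply/eqP; ring.
Qed.

Lemma base0_locint_b : locint 0 (fun t => b t * p t * fA l t).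
Proof.
move=> lo X /window0 ->; have [C C0 hC] := hb X.
apply: (itg_le _ _ (itgZ C (itg_norm (hp X)))).
  apply: measurable_funM; last by apply: cont_meas => //; exact: cont_fA.
  by apply: measurable_funM; [exact: cont_meas|exact: pos_meas].
move=> t /andP[t0 tX]; have A0 := fA_gt0 l t0; have B0 := fB_gt0 l t0.
rewrite norm_ABp// normrM (gtr0_norm A0) normrM.
rewrite (_ : _ * _ * fA l t = `|b t| * (fA l t * `|p t|)); last by ring.
rewrite (_ : C * _ = C * fB l t * (fA l t * `|p t|)); last by ring.
by rewrite ler_wpM2r ?hC// mulr_ge0// ltW.
Qed.

(** In the factor [1 + k] of the witness, [1] accounts for [a x * b t] and [k] for [b x * a t],
    which the kernel inequality compares with [fA l x * fB l t]. *)
Lemma base0_kernel lo hi : window 0 lo hi -> exists w, [/\ itg w lo hi,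
  (forall t, lo < t <= hi -> 0 <= w t) &
  (forall x t, lo < x <= hi -> lo < t <= hi -> 0 < t <= x \/ x < t <= 0 ->
     (`|a x * b t| + `|b x * a t|) * `|p t| * fA l t <= fA l x * w t)].
Proof.
move=> /window0 ->; have [C C0 hC] := ha hi; have [D D0 hD] := hb hi.
have [k k0 hk] := fB_mono hl hi.
exists (fun t => C * D * (1 + k) * `|fA l t * fB l t * p t|); split.
- exact: itgZ (itg_norm (hp hi)).
- by move=> t _; rewrite !mulr_ge0// addr_ge0// ltW.
move=> x t /andP[x0 xh] /andP[t0 th] [/andP[_ tx]|/andP[h1 h2]]; last first.
  by move: (lt_le_trans h1 h2); rewrite ltNge ltW.
have A0 := fA_gt0 l t0; have B0 := fB_gt0 l t0.
have Ax := fA_gt0 l x0; have Bx := fB_gt0 l x0.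
have h1 : `|a x * b t| <= C * D * (fA l x * fB l t).
  rewrite normrM (le_trans (ler_pM _ _ (hC x x0 xh) (hD t t0 th)))//.
  by rewrite le_eqVlt; apply/orP; left; apply/eqP; ring.
have h2 : `|b x * a t| <= C * D * k * (fA l x * fB l t).
  rewrite normrM (le_trans (ler_pM _ _ (hD x x0 xh) (hC t t0 th)))//.
  rewrite (_ : D * _ * _ = C * D * (fB l x * fA l t)); last by ring.
  rewrite -[_ * k * _]mulrA ler_wpM2l ?mulr_ge0//.
  by rewrite mulrA; apply: hk.
rewrite norm_ABp//.
have h3 := lerD h1 h2.
have pA : 0 <= `|p t| * fA l t by rewrite mulr_ge0// ltW.
rewrite -mulrA; apply: le_trans (ler_wpM2r pA h3) _.
by rewrite le_eqVlt; apply/orP; left; apply/eqP; ring.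
Qed.

Lemma dominated0 u : cont u -> (exists C, forall x, 0 < x -> x <= 1 ->
  `|u x| <= C * fA l x) -> dominated (fA l) 0 u.
Proof.
move=> cu [C hC]; split=> // lo X /window0 ->.
pose F t := u t / fA l t.
have cF : cont F.
  apply: contM => //; apply: cont_inv; first exact: cont_fA.
  by move=> x x0; rewrite gt_eqF// fA_gt0.
have [M M0 hM] := cont_bounded X cF ltr01.
exists (Num.max C M) => x /andP[x0 xX]; have A0 := fA_gt0 l x0.
have [x1|x1] := leP x 1.
  apply: le_trans (hC x x0 x1) _; rewrite ler_wpM2r ?(ltW A0)//.
  by rewrite le_max lexx.
have : `|F x| <= M by apply: hM; rewrite (ltW x1) xX.
rewrite /F normrM normfV (gtr0_norm A0) ler_pdivrMr// => /le_trans; apply.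
by rewrite ler_wpM2r ?(ltW A0)// le_max lexx orbT.
Qed.

(** Near [0] the integral of the majorant [w] is below [e], so on a short interval every iteration
    contracts by [e]. This gives asymptotics at [0], whereas [vseq_bound] gives decay on a whole
    window. *)
Lemma vseq_small (a1 b1 u0 : R -> R) (C e : R) : prim a1 a -> prim b1 b -> 0 <= C -> 0 < e -> dominated (fA l) 0 u0 ->
  (forall x, 0 < x -> x <= 1 -> `|u0 x| <= C * fA l x) ->
  (forall v, dominated (fA l) 0 v -> dominated (fA l) 0 (vop p a b 0 v)) ->
  exists d, [/\ 0 < d, d <= 1 & forall n x, 0 < x -> x <= d ->
    `|vseq p a b 0 u0 n x| <= C * e ^+ n * fA l x].
Proof.
move=> pa pb C0 e0 d0 hC vd.
have dom : window 0 0 (1 : R) by split.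
have [w [wi w0 hw]] := base0_kernel dom.
have [d dp hd] := oint_small wi e0.
exists (Num.min (d / 2) 1); split.
- by rewrite lt_min ltr01 andbT; lra.
- by rewrite ge_min lexx orbT.
elim=> [|n IH] x x0; rewrite le_min => /andP[xd x1].
  by rewrite expr0 mulr1; exact: hC.
have dn : dominated (fA l) 0 (vseq p a b 0 u0 n) by elim: (n) => //= k; exact: vd.
have xD : 0 < x <= 1 by rewrite x0.
have [gi h] := vop_bound pa pb (@cont_fA R l) (fA_gt0 l) mp base0_locint_a
   base0_locint_b dom dn wi w0 hw.
apply: le_trans (h x xD) _; rewrite mulrC ler_wpM2r ?(ltW (fA_gt0 _ _))//.
rewrite [X in _ + X]oint_nil ?(ltW x0)// addr0.
have wx : itg w 0 x by exact: itgS wi.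
apply: (@le_trans _ _ (oint (fun t => (C * e ^+ n) * w t) 0 x)).
  apply: le_oint => [||t /andP[t0 tx]]; [exact: itgS gi|exact: itgZ|].
  rewrite mulrC ler_wpM2r ?w0 ?t0 ?(le_trans tx)//.
  rewrite ler_pdivrMr ?fA_gt0//; apply: IH => //.
  by rewrite le_min !(le_trans tx).
rewrite ointZ// exprSr mulrA ler_wpM2l ?mulr_ge0 ?exprn_ge0 ?(ltW e0)//.
apply: (@le_trans _ _ (oint (fun t => `|w t|) 0 x)).
  by apply: le_oint => //; [exact: itg_norm|move=> t _; exact: ler_norm].
by apply: ltW; apply: hd => //; [exact: ltW|lra].
Qed.

End BaseZero.

(** * The regular solution, and solutions with data at an interior point *)

Section RegularSolution.
Context {R : realType}.
Variables (l : R) (q : R -> R).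
Local Notation posR := (`]0, +oo[%classic : set R).
Hypothesis hl : - 2^-1 <= l.
Hypothesis mq : measurable_fun posR q.
Hypothesis hq : forall X, itg (fun t => fA l t * fB l t * q t) 0 X.

Definition pot t := V0 l t + q t.

Lemma q_itg y x : 0 < y -> itg q y x.
Proof.
move=> y0; pose F t := (fA l t * fB l t)^-1.
have cF : cont F.
  apply: cont_inv; first by apply: contM; [exact: cont_fA|exact: cont_fB].
  by move=> t t0; rewrite gt_eqF// mulr_gt0 ?fA_gt0 ?fB_gt0.
have : itg (fun t => fA l t * fB l t * q t * F t) y x.
  by apply: itgM_cont => //; apply: itgS (hq x) => //; exact: ltW.
apply: eq_itg => t /andP[yt _]; have t0 : 0 < t by exact: lt_trans yt.
by rewrite /F; field; rewrite !gt_eqF ?fA_gt0 ?fB_gt0.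
Qed.

Lemma fA_bd X : exists2 C, 0 <= C &
  forall t, 0 < t -> t <= X -> `|fA l t| <= C * fA l t.
Proof.
by exists 1 => // t t0 _; rewrite mul1r gtr0_norm// fA_gt0.
Qed.

Lemma fb_bd X : exists2 C, 0 <= C &
  forall t, 0 < t -> t <= X -> `|fb l t| <= C * fB l t.
Proof.
by have [C C0 hC] := fb_le hl; exists C => [|t t0 _]; [exact: ltW|exact: hC].
Qed.

Let locA := base0_locint_a hl (@cont_fA R l) fA_bd mq hq.
Let locB := base0_locint_b (cont_fb hl) fb_bd mq hq.
Let ker := @base0_kernel _ l (fA l) (fb l) q hl fA_bd fb_bd hq.

Let vd (v : R -> R) : dominated (fA l) 0 v ->
  dominated (fA l) 0 (vop q (fA l) (fb l) 0 v).
Proof.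
exact: (vop_dominated (lexx _) (@prim_fA R l) (@prim_fA1 R l) (prim_fb hl) (prim_fb1 hl)
  (wronskian_free hl) (@cont_fA R l) (fA_gt0 l) mq locA locB ker).
Qed.

Let dfA : dominated (fA l) 0 (fA l).
Proof.
apply: dominated0; first exact: cont_fA.
by exists 1 => x x0 _; rewrite mul1r gtr0_norm// fA_gt0.
Qed.

Let ones n : `|1 : R| <= 1 * 1 ^+ n.
Proof. by rewrite normr1 expr1n mulr1. Qed.

Lemma regular_solution : exists f f1, [/\ prim f1 f,
  prim (fun t => pot t * f t) f1,
  forall X, exists2 C, 0 <= C & forall t, 0 < t -> t <= X -> `|f t| <= C * fA l t &
  forall e : R, 0 < e -> exists d, [/\ 0 < d, d <= 1 &
    forall t, 0 < t -> t <= d -> `|f t / fA l t - 1| <= e]].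
Proof.
pose u n := vseq q (fA l) (fb l) 0 (fA l) n.
pose u1 n := if n is m.+1 then vop1 q (fA l) (fA1 l) (fb l) (fb1 l) 0 (u m)
  else fA1 l.
have du n : dominated (fA l) 0 (u n).
  by rewrite /u; elim: n => //= n; exact: vd.
have pS n := vop_prim (lexx _) (@prim_fA R l) (@prim_fA1 R l) (prim_fb hl) (prim_fb1 hl)
  (wronskian_free hl) (fA_gt0 l) mq locA locB (du n).
have bd X (r : R) : 0 < r -> exists2 K, 0 <= K &
    forall n x, 0 < x <= X -> `|u n x| <= K * fA l x / r ^+ n.
  have [X0|X0] := ltP X 0.
    by exists 0 => // n x /andP[h1 h2]; move: (lt_le_trans h1 h2); rewrite ltNge ltW.
  move=> r0; apply: (vseq_bound (lexx _) (@prim_fA R l) (@prim_fA1 R l) (prim_fb hl)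
    (prim_fb1 hl) (wronskian_free hl) (@cont_fA R l) (fA_gt0 l) mq locA locB ker) => //.
pose w t := ser (fun n => 1 * u n t).
have [w1 [pw pw1 _]] : exists w1, [/\ prim w1 w,
    prim (fun t => V0 l t * w t + q t * w t) w1 &
    forall x, 0 < x -> exists C, forall N : nat,
      `|\sum_(0 <= k < N.+1) 1 * u1 k x - w1 x| <= C / 2 ^+ N].
  apply: (@ser_solution _ (V0 l) q u u1 _ _ _ _ _ _ 1 1 (fun=> 1)) => //.
  - by move=> y x y0; apply: cont_itg y0; exact: cont_V0.
  - by move=> y x; exact: q_itg.
  - by case=> [|n]; [exact: prim_fA|exact: (pS n).1].
  - exact: prim_fA1.
  - by move=> n; exact: (pS n).2.
  - move=> y x r y0 r0; have [K K0 hK] := bd x r r0.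
    have [M M0 hM] := cont_bounded x (@cont_fA R l) y0.
    exists (K * M); first by rewrite mulr_ge0// ltW.
    move=> n t /andP[yt tx]; have t0 : 0 < t by exact: lt_trans yt.
    have tD : 0 < t <= x by rewrite t0.
    apply: le_trans (hK n t tD) _.
    rewrite ler_wpM2r ?invr_ge0 ?exprn_ge0 ?(ltW r0)// ler_wpM2l//.
    by apply: le_trans (ler_norm _) (hM t _); rewrite (ltW yt) tx.
exists w, w1; split=> //.
- by apply: eq_prim pw1 => // t t0; rewrite /pot mulrDl.
- move=> X; have [K K0 hK] := bd X 2 (ltr0Sn _ _).
  exists (2 * K); first by rewrite mulr_ge0.
  move=> t t0 tX; rewrite -mulrA; apply: ser_bound => n.
  by rewrite mul1r; apply: hK; rewrite t0.
(* [e / 2] because [ser_bound] costs a factor [2]; the cap [1 / 4] keeps the contraction ratio below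
   the ratio [1 / 2] that [geobd] demands. *)
- move=> e e0; pose e' := Num.min (e / 2) (1 / 4).
  have e'0 : 0 < e' by rewrite lt_min; apply/andP; split; lra.
  have e'1 : e' <= 1 / 4 by rewrite ge_min lexx orbT.
  have e'e : 2 * e' <= e.
    by have : e' <= e / 2 by [rewrite ge_min lexx]; lra.
  have fA1b x : 0 < x -> x <= 1 -> `|fA l x| <= 1 * fA l x.
    by move=> x0 _; rewrite mul1r gtr0_norm// fA_gt0.
  have [d [d0 d1 hd]] := vseq_small hl (@cont_fA R l) (cont_fb hl) fA_bd fb_bd mq hq
    (@prim_fA R l) (prim_fb hl) ler01 e'0 dfA fA1b vd.
  exists d; split=> // t t0 td; have A0 := fA_gt0 l t0.
  have gb : geobd (e' * fA l t) (fun n => 1 * u n.+1 t).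
    move=> n; rewrite mul1r; apply: le_trans (hd n.+1 t t0 td) _.
    rewrite mul1r exprS -!mulrA ler_wpM2l ?(ltW e'0)// mulrC ler_wpM2l ?(ltW A0)//.
    rewrite -exprVn lerXn2r ?nnegrE ?invr_ge0 ?(ltW e'0)//.
    by apply: le_trans e'1 _; lra.
  have gb0 : geobd (fA l t + e' * fA l t) (fun n => 1 * u n t).
    case=> [|n].
      by rewrite mul1r expr0 divr1 gtr0_norm// lerDl mulr_ge0// ltW.
    rewrite mul1r; apply: le_trans (hd n.+1 t t0 td) _.
    rewrite mul1r mulrC; apply: ler_pM; rewrite ?exprn_ge0 ?(ltW A0) ?(ltW e'0)//.
      by rewrite lerDl mulr_ge0// ltW.
    rewrite -exprVn lerXn2r ?nnegrE ?invr_ge0 ?(ltW e'0)//.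
    by apply: le_trans e'1 _; lra.
  have -> : w t / fA l t - 1 = ser (fun n => 1 * u n.+1 t) / fA l t.
    rewrite /w (ser_recl gb0) mul1r mulrDl {1}/u/= divff ?gt_eqF//.
    by rewrite addrC addKr.
  rewrite normrM normfV (gtr0_norm A0) ler_pdivrMr//.
  by apply: le_trans (ser_bound gb) _; rewrite mulrA ler_wpM2r// ltW.
Qed.

(** All later iterates and their derivatives vanish at the base point [c], so the Cauchy data there
    are those of the term [s fA + s' fb]. Away from [0] the constant weight [1] is enough for the
    iteration. *)
Lemma ivp_solution (c s s' : R) : 0 < c -> exists f f1, [/\ prim f1 f,
  prim (fun t => pot t * f t) f1,
  f c = s * fA l c + s' * fb l c & f1 c = s * fA1 l c + s' * fb1 l c].
Proof.
move=> cp; pose u0 t := s * fA l t + s' * fb l t.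
have pu0 : prim (fun t => s * fA1 l t + s' * fb1 l t) u0.
  by apply: primD; apply: primZ; [exact: prim_fA|exact: prim_fb].
have wpos lo hi : window c lo hi -> 0 < lo.
  case=> lo0 _ _ h; rewrite lt_def lo0 andbT; apply/eqP => /h c0.
  by rewrite c0 ltxx in cp.
have itgc f lo hi : cont f -> window c lo hi -> itg (fun t => f t * q t * 1) lo hi.
  move=> cf /wpos lo0; apply: (@eq_itg _ (fun t => q t * f t)) => [t _|].
    by rewrite mulr1 mulrC.
  by apply: itgM_cont => //; exact: q_itg.
have lA : locint c (fun t => fA l t * q t * (fun=> 1) t).
  by move=> lo hi; apply: itgc; exact: cont_fA.
have lB : locint c (fun t => fb l t * q t * (fun=> 1) t).
  by move=> lo hi; apply: itgc; exact: cont_fb.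
have kerc lo hi : window c lo hi -> exists w, [/\ itg w lo hi,
  (forall t, lo < t <= hi -> 0 <= w t) &
  (forall x t, lo < x <= hi -> lo < t <= hi -> c < t <= x \/ x < t <= c ->
     (`|fA l x * fb l t| + `|fb l x * fA l t|) * `|q t| * (fun=> 1) t <=
     (fun=> 1) x * w t)].
  move=> dom; have lo0 := wpos _ _ dom.
  have [M M0 hM] := cont_bounded hi (@cont_fA R l) lo0.
  have [N N0 hN] := cont_bounded hi (cont_fb hl) lo0.
  exists (fun t => 2 * M * N * `|q t|); split.
  - exact/itgZ/itg_norm/q_itg.
  - by move=> t _; rewrite !mulr_ge0// ltW.
  move=> x t /andP[lx xh] /andP[lt th] _; rewrite mulr1 mul1r ler_wpM2r// !normrM.
  have hx : lo <= x <= hi by rewrite ltW.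
  have ht : lo <= t <= hi by rewrite ltW.
  have := ler_pM _ _ (hM x hx) (hN t ht); have := ler_pM _ _ (hN x hx) (hM t ht).
  rewrite !normr_ge0 => /(_ isT isT) ? /(_ isT isT) ?; lra.
have c1 : cont (fun _ : R => 1 : R) by exact: cont_cst.
have p1 (x : R) : 0 < x -> (0 : R) < (fun=> 1) x by [].
have dom0 : dominated (fun=> 1) c u0.
  split; first exact: prim_cont pu0.
  move=> lo hi /wpos lo0; have [M M0 hM] := cont_bounded hi (prim_cont pu0) lo0.
  by exists M => x /andP[lx xh]; rewrite mulr1; apply: hM; rewrite ltW.
pose u n := vseq q (fA l) (fb l) c u0 n.
pose u1 n := if n is m.+1 then vop1 q (fA l) (fA1 l) (fb l) (fb1 l) c (u m)
  else (fun t => s * fA1 l t + s' * fb1 l t).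
have du n : dominated (fun=> 1) c (u n).
  have H := vseq_dominated (ltW cp) (@prim_fA R l) (@prim_fA1 R l) (prim_fb hl)
    (prim_fb1 hl) (wronskian_free hl) c1 p1 mq lA lB kerc.
  exact: H.
have pS n := vop_prim (ltW cp) (@prim_fA R l) (@prim_fA1 R l) (prim_fb hl) (prim_fb1 hl)
  (wronskian_free hl) p1 mq lA lB (du n).
have bd x y (r : R) : 0 < y -> 0 < r -> exists2 K, 0 <= K &
    forall n t, y < t <= x -> `|u n t| <= K / r ^+ n.
  move=> y0 r0; have [yx|xy] := leP y x; last first.
    exists 0 => // n t /andP[h1 h2]; move: (lt_le_trans h1 h2).
    by rewrite ltNge ltW.
  have [lo [hi [dom ly xh]]] := window_cover (ltW cp) y0 yx.
  have [K K0 hK] := vseq_bound (ltW cp) (@prim_fA R l) (@prim_fA1 R l) (prim_fb hl)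
    (prim_fb1 hl) (wronskian_free hl) c1 p1 mq lA lB kerc dom0 dom r0.
  exists K => // n t /andP[h1 h2]; rewrite -[K]mulr1; apply: hK.
  by rewrite (lt_trans ly h1) (le_trans h2).
pose w t := ser (fun n => 1 * u n t).
have [w1 [pw pw1 hw1]] : exists w1, [/\ prim w1 w,
    prim (fun t => V0 l t * w t + q t * w t) w1 &
    forall x, 0 < x -> exists C, forall N : nat,
      `|\sum_(0 <= k < N.+1) 1 * u1 k x - w1 x| <= C / 2 ^+ N].
  apply: (@ser_solution _ (V0 l) q u u1 _ _ _ _ _ _ 1 1 (fun=> 1)) => //.
  - by move=> y x y0; apply: cont_itg y0; exact: cont_V0.
  - by move=> y x; exact: q_itg.
  - by case=> [|n]; [|exact: (pS n).1].
  - apply: eq_prim (primD (primZ s (@prim_fA1 R l)) (primZ s' (prim_fb1 hl))) => // t _.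
    by rewrite /u/= /u0; ring.
  - by move=> n; exact: (pS n).2.
  - by move=> y x r; exact: bd.
have z f : sint c f c = 0 by rewrite /sint subrr.
exists w, w1; split=> //.
- by apply: eq_prim pw1 => // t t0; rewrite /pot mulrDl.
- have c20 : 0 < c / 2 by lra.
  have [K K0 hK] := bd c (c / 2) 2 c20 (ltr0Sn _ _).
  apply: (@ser_unique _ K `|u0 c|) => [n|[|N]].
  + by rewrite mul1r; apply: hK; apply/andP; split; lra.
  + by rewrite big_nil subr0 expr0 divr1.
  rewrite big_nat_recl// big1 ?addr0 => [|i _].
    by rewrite mul1r /u/= subrr normr0 divr_ge0// exprn_ge0.
  by rewrite /u/= /vop !z !mulr0 subrr mulr0.
- have [C hC] := hw1 c cp; apply/esym; apply: (@eq_geo _ C) => N.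
  have := hC N; rewrite big_nat_recl// big1 ?addr0 ?mul1r// => i _.
  by rewrite /u1 /vop1 !z !mulr0 subrr mulr0.
Qed.

End RegularSolution.

(** * The singular solution and its asymptotics at zero *)

Section SingularSolution.
Context {R : realType}.
Variables (l : R) (q : R -> R).
Local Notation posR := (`]0, +oo[%classic : set R).
Hypothesis hl : - 2^-1 <= l.
Hypothesis mq : measurable_fun posR q.
Hypothesis hq : forall X, itg (fun t => fA l t * fB l t * q t) 0 X.

(** The quotient is [x ^ (- (2 l + 1)) / (2 l + 1)] or, for [l = -1/2], [- ln x]. In the logarithmic
    case [d <= 1/2] is also what makes [fb] positive. *)
Lemma fb_fA_large (K : R) : exists d, [/\ 0 < d, d <= 2^-1 &
  forall x, 0 < x -> x <= d -> 0 < fb l x /\ K <= fb l x / fA l x].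
Proof.
have [h|h] := ltP (- 2^-1) l.
  pose g := 2 * l + 1; have g0 : 0 < g by rewrite /g; lra.
  have K0 : 0 < 1 + `|K| * g by rewrite ltr_pwDl// mulr_ge0// ltW.
  pose e := (1 + `|K| * g)^-1; have e0 : 0 < e by rewrite invr_gt0.
  exists (Num.min 2^-1 (e `^ g^-1)); split.
  - by rewrite lt_min powR_gt0// andbT; lra.
  - by rewrite ge_min lexx.
  move=> x x0; rewrite le_min => /andP[_ xe].
  rewrite /fb h; split; first by rewrite divr_gt0 ?powR_gt0.
  have xg : x `^ g <= e.
    have : x `^ g <= (e `^ g^-1) `^ g.
      by rewrite ge0_ler_powR// ?nnegrE ?powR_ge0// ltW.
    by rewrite -powRrM mulVf ?gt_eqF// powRr1// ltW.
  have E : x `^ (- l) / (2 * l + 1) / fA l x = (x `^ g)^-1 / g.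
    have -> : x `^ g = x `^ l * fA l x.
      by rewrite /fA -powR_add//; congr (_ `^ _); rewrite /g; ring.
    rewrite powRN -/g; have := fA_gt0 l x0 => A0.
    by field; rewrite !gt_eqF ?powR_gt0.
  rewrite E ler_pdivlMr// -(invrK (_ * _)).
  apply: (@le_trans _ _ e^-1); last first.
    by rewrite lef_pV2 ?posrE ?powR_gt0.
  rewrite invrK /e invrK; have := ler_norm K; nra.
have lE : (- 2^-1 < l) = false by rewrite ltNge h.
have lE' : l = - 2^-1 by apply/eqP; rewrite eq_le h hl.
exists (Num.min 2^-1 (expR (- `|K|))); split.
- by rewrite lt_min expR_gt0 andbT; lra.
- by rewrite ge_min lexx.
move=> x x0; rewrite le_min => /andP[x2 xK].
have lx : ln x < 0 by apply: ln_lt0; rewrite x0/=; lra.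
rewrite /fb /fA lE lE' (_ : - 2^-1 + 1 = 2^-1); last by field.
split; first by rewrite mulr_gt0 ?powR_gt0// oppr_gt0.
rewrite mulfK ?gt_eqF ?powR_gt0// lerNr (le_trans (_ : _ <= - `|K|))//.
  by rewrite -(expRK (- `|K|)) ler_ln// posrE expR_gt0.
by rewrite lerN2 ler_norm.
Qed.

(** In the logarithmic case [x <= exp (-1)] gives [- ln x >= 1], hence [1 + |ln x| <= 2 (- ln x)];
    this is the origin of the constant [2]. *)
Lemma fB_le_fb : exists C d, [/\ 0 < C, 0 < d & forall x, 0 < x -> x <= d ->
  fB l x <= C * fb l x].
Proof.
have [h|h] := ltP (- 2^-1) l.
  exists (2 * l + 1), 1; split=> //; first lra.
  move=> x x0 _; rewrite /fB /fb /lw h mulr1 mulrCA divff ?mulr1//.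
  by rewrite gt_eqF//; lra.
have lE : (- 2^-1 < l) = false by rewrite ltNge h.
have lE' : l = - 2^-1 by apply/eqP; rewrite eq_le h hl.
exists 2, (expR (- 1)); split; rewrite ?expR_gt0// => x x0 xe.
have lx : ln x <= - 1 by rewrite -[X in _ <= X]expRK ler_ln// posrE expR_gt0.
rewrite /fB /fb /lw lE lE' opprK ltr0_norm; last by lra.
rewrite mulrC mulrA ler_wpM2r ?powR_ge0//; lra.
Qed.

Lemma is_derive_div (F G : R -> R) (x f g : R) : G x != 0 ->
  is_derive x 1 F f -> is_derive x 1 G g ->
  is_derive x 1 (fun t => F t / G t) ((f * G x - F x * g) / G x ^+ 2).
Proof.
move=> G0 dF dG; have dV := is_deriveV G0 dG.
apply: is_derive_eq (is_deriveM dF dV) _.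
by rewrite /GRing.scale/= ; field.
Qed.

Lemma le_derive (F dF : R -> R) (x y : R) : x <= y ->
  (forall t, x <= t <= y -> is_derive t 1 F (dF t)) ->
  (forall t, x <= t <= y -> dF t <= 0) -> F y <= F x.
Proof.
rewrite le_eqVlt => /predU1P[->//|xy] hF hd.
have cF : {within `[x, y], continuous F}.
  apply: continuous_in_subspaceT => t; rewrite inE/= in_itv/= => tD.
  apply: differentiable_continuous; apply/derivable1_diffP.
  exact: (@ex_derive _ _ _ _ _ _ _ (hF _ tD)).
have [t|t /=] := MVT xy _ cF (df := dF).
  by rewrite in_itv/= => /andP[h1 h2]; apply: hF; rewrite !ltW.
rewrite in_itv/= => /andP[h1 h2] E; rewrite -subr_le0 E mulr_le0_ge0//.
  by apply: hd; rewrite !ltW.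
by rewrite subr_ge0 ltW.
Qed.

Let near1_le (a h : R) : h <= 2^-1 -> `|a - 1| <= h -> `|a| <= 3 / 2.
Proof. by move=> h2; rewrite !ler_norml => /andP[? ?]; apply/andP; split; lra. Qed.

Let product_near1 (a b c h e : R) : `|a| <= 12 * h -> `|b| <= 3 / 2 -> `|c| <= h ->
  19 * h <= e -> `|a * b + c| <= e.
Proof.
move=> ha hb hc he; rewrite (le_trans (ler_normD _ _))// normrM.
by have := ler_pM (normr_ge0 _) (normr_ge0 _) ha hb; lra.
Qed.

Let shift_bound (a b H H' h : R) : 0 < h -> `|b| + 6 * h * `|H'| <= H * (6 * h) ->
  `|a - b| <= 6 * h * (H - H') -> `|a| <= 12 * h * H.
Proof.
move=> h0 hb hab; have -> : a = (a - b) + b by ring.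
apply: le_trans (ler_normD _ _) _; have := ler_norm (- H'); rewrite normrN.
by nra.
Qed.

Let is_derive_sign (x y k : R) : `|x - y| <= k * y ->
  k * (- y) + (- x - - y) <= 0 /\ k * (- y) - (- x - - y) <= 0.
Proof. by rewrite ler_norml => /andP[? ?]; split; lra. Qed.

Lemma singular_solution (f f1 : R -> R) : prim f1 f ->
  prim (fun t => pot l q t * f t) f1 ->
  (forall e : R, 0 < e -> exists d, [/\ 0 < d, d <= 1 &
    forall t, 0 < t -> t <= d -> `|f t / fA l t - 1| <= e]) ->
  exists g g1, [/\ prim g1 g, prim (fun t => pot l q t * g t) g1,
    forall x, 0 < x -> g x * f1 x - g1 x * f x = 1,
    forall X, exists2 C, 0 <= C & forall t, 0 < t -> t <= X -> `|g t| <= C * fB l t &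
    forall e : R, 0 < e -> exists d, [/\ 0 < d, d <= 1 &
      forall t, 0 < t -> t <= d -> 0 < fb l t /\ `|g t / fb l t - 1| <= e]].
Proof.
(* [(g / f)' = - 1 / f ^+ 2] is close to [(fb / fA)' = - 1 / fA ^+ 2] near [0], and
   [fb / fA] tends to infinity, whence [(g / f) / (fb / fA) --> 1]. *)
move=> pf pf1 hf.
have fpos (e t : R) : 0 < t -> e <= 2^-1 -> `|f t / fA l t - 1| <= e ->
    [/\ 0 < f t, fA l t / f t <= 2, 0 < fA l t / f t & `|fA l t / f t - 1| <= 2 * e].
  move=> t0 e2 ht; have A0 := fA_gt0 l t0.
  pose r := f t / fA l t; have r1 : `|r - 1| <= e by [].
  have r2 : 2^-1 <= r by move: (r1); rewrite ler_norml => /andP[? ?]; lra.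
  have r0 : 0 < r by lra.
  have fE : f t = r * fA l t by rewrite /r divfK// gt_eqF.
  have f0 : 0 < f t by rewrite fE mulr_gt0.
  have E : fA l t / f t = r^-1 by rewrite /r invf_div.
  rewrite E; split=> //.
  - by rewrite invf_ple ?posrE.
  - by rewrite invr_gt0.
  have -> : r^-1 - 1 = (1 - r) / r by field; rewrite gt_eqF.
  rewrite normrM normfV (gtr0_norm r0) ler_pdivrMr// distrC (le_trans r1)//.
  have e0 : 0 <= e by apply: le_trans r1.
  nra.
have [c [c0 _ hc]] := hf 2^-1 (ltac:(lra)).
have [fc _ _ _] := fpos _ _ c0 (lexx _) (hc c c0 (lexx _)).
(* The data are chosen so that [g c = 0] and [g1 c = - 1 / f c], which normalizes the Wronskian with
   [f] to [1]; the point [c] was taken where [f] is positive. *)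
have [g [g1 [pg pg1 gc g1c]]] :=
  ivp_solution hl mq hq (- (f c)^-1 * fb l c) ((f c)^-1 * fA l c) c0.
have W x : 0 < x -> g x * f1 x - g1 x * f x = 1.
  move=> x0; rewrite (wronskian_cst pg pg1 pf pf1 x0 c0) gc g1c.
  have := wronskian_free hl c0 => w.
  transitivity ((f c)^-1 * (fA l c * fb l c - fb l c * fA l c) * f1 c +
    (f c)^-1 * f c * (fb l c * fA1 l c - fb1 l c * fA l c)); first by ring.
  by rewrite w mulVf ?gt_eqF//; ring.
have asy (e : R) : 0 < e -> exists d, [/\ 0 < d, d <= 1 &
    forall t, 0 < t -> t <= d -> 0 < fb l t /\ `|g t / fb l t - 1| <= e].
  (* [19] is [12] times [3 / 2], plus [1]: the relative error [12 h] of [g / f] against [fb / fA] is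
     multiplied by [|f / fA| <= 3 / 2], and the error [h] of [f / fA] is added. *)
  move=> e0; pose h := Num.min 2^-1 (e / 19).
  have h0 : 0 < h by rewrite lt_min; apply/andP; split; lra.
  have h2 : h <= 2^-1 by rewrite ge_min lexx.
  have he : 19 * h <= e by have : h <= e / 19 by [rewrite ge_min lexx orbT]; lra.
  have [d [d0 d1 hd]] := hf h h0.
  pose G t := g t / f t; pose H t := fb l t / fA l t.
  have dG (t : R) : 0 < t -> t <= d -> is_derive t 1 G (- (f t ^+ 2)^-1).
    move=> t0 td; have [ft _ _ _] := fpos _ _ t0 h2 (hd t t0 td).
    apply: is_derive_eq (is_derive_div _ (prim_derive pg t0 (prim_cont pg1 t0))
      (prim_derive pf t0 (prim_cont pf1 t0))) _; first by rewrite gt_eqF.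
    by rewrite -(opprB (g t * f1 t)) W// mulN1r.
  have dH (t : R) : 0 < t -> is_derive t 1 H (- (fA l t ^+ 2)^-1).
    move=> t0; have A0 := fA_gt0 l t0.
    apply: is_derive_eq (is_derive_div _ (prim_derive (prim_fb hl) t0
      (prim_cont (prim_fb1 hl) t0)) (prim_derive (@prim_fA R l) t0
      (prim_cont (@prim_fA1 R l) t0))) _; first by rewrite gt_eqF.
    by rewrite -(opprB (fb l t * fA1 l t)) (wronskian_free hl)// mulN1r.
  (* The ratio [r = fA / f] is at most [2] and within [2 h] of [1], so [|r ^+ 2 - 1| <= 2 h * 3]. *)
  have dGH t : 0 < t -> t <= d ->
      `|(f t ^+ 2)^-1 - (fA l t ^+ 2)^-1| <= 6 * h / fA l t ^+ 2.
    move=> t0 td; have A0 := fA_gt0 l t0.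
    have [ft r2 r0 r1] := fpos _ _ t0 h2 (hd t t0 td).
    have -> : (f t ^+ 2)^-1 - (fA l t ^+ 2)^-1 =
        ((fA l t / f t - 1) * (fA l t / f t + 1)) / fA l t ^+ 2.
      by field; rewrite !gt_eqF.
    rewrite normrM [X in _ * X]gtr0_norm ?invr_gt0 ?exprn_gt0//.
    rewrite ler_wpM2r ?invr_ge0 ?exprn_ge0 ?(ltW A0)// normrM.
    rewrite [X in _ * X]gtr0_norm ?addr_gt0//.
    by have := normr_ge0 (fA l t / f t - 1); nra.
  have cmp t : 0 < t -> t <= d -> `|(G t - H t) - (G d - H d)| <= 6 * h * (H t - H d).
    move=> t0 td; rewrite ler_norml; apply/andP; split.
      pose D (s : R) : R := 6 * h * H s + (G s - H s).
      pose dD (s : R) : R := 6 * h * (- (fA l s ^+ 2)^-1) +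
             (- (f s ^+ 2)^-1 - - (fA l s ^+ 2)^-1).
      suff : D d <= D t by rewrite /D; lra.
      apply: (@le_derive D dD _ _ td) => s /andP[ts sd].
        have s0 : 0 < s by exact: lt_le_trans ts.
        exact: is_deriveD (is_deriveZ (6 * h) (dH s s0)) (is_deriveB (dG s s0 sd) (dH s s0)).
      have s0 : 0 < s by exact: lt_le_trans ts.
      exact: (is_derive_sign (dGH s s0 sd)).1.
    pose D (s : R) : R := 6 * h * H s - (G s - H s).
    pose dD (s : R) : R := 6 * h * (- (fA l s ^+ 2)^-1) -
             (- (f s ^+ 2)^-1 - - (fA l s ^+ 2)^-1).
    suff : D d <= D t by rewrite /D; lra.
    apply: (@le_derive D dD _ _ td) => s /andP[ts sd].
      have s0 : 0 < s by exact: lt_le_trans ts.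
      exact: is_deriveB (is_deriveZ (6 * h) (dH s s0)) (is_deriveB (dG s s0 sd) (dH s s0)).
    have s0 : 0 < s by exact: lt_le_trans ts.
    exact: (is_derive_sign (dGH s s0 sd)).2.
  (* With [H t >= K] the constant of integration coming from the endpoint [d] is at most
     [6 h * H t]; this doubles the error [6 h] to [12 h]. *)
  pose K := (`|G d - H d| + 6 * h * `|H d|) / (6 * h).
  have [d' [d'0 d'2 hd']] := fb_fA_large K.
  exists (Num.min d d'); split.
  - by rewrite lt_min d0.
  - by rewrite ge_min d1.
  move=> t t0; rewrite le_min => /andP[td td'].
  have [b0 KH] := hd' t t0 td'; split=> //.
  have A0 := fA_gt0 l t0; have H0 : 0 < H t by rewrite divr_gt0.
  have h60 : 0 < 6 * h by rewrite mulr_gt0.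
  have B : `|G t - H t| <= 12 * h * H t.
    apply: shift_bound h0 _ (cmp t t0 td).
    by move: KH; rewrite ler_pdivrMr.
  have [ft r2 r0 r1] := fpos _ _ t0 h2 (hd t t0 td).
  have -> : g t / fb l t - 1 = (G t - H t) / H t * (f t / fA l t) + (f t / fA l t - 1).
    by rewrite /G /H; field; rewrite !gt_eqF.
  have B1 : `|(G t - H t) / H t| <= 12 * h.
    by rewrite normrM normfV (gtr0_norm H0) ler_pdivrMr.
  have B2 := hd t t0 td.
  exact: product_near1 B1 (near1_le h2 B2) B2 he.
exists g, g1; split=> // X.
(* Close to [0] the bound comes from the asymptotics, on the rest of []0, X]] from compactness;
   [fB], unlike [fb], has no zero there. *)
have [d [d0 d1 hd]] := asy 1 ltr01; have [Cb Cb0 hCb] := fb_le hl.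
pose F t := g t / fB l t.
have cF : cont F.
  apply: contM; first exact: prim_cont pg.
  apply: cont_inv; first exact: cont_fB.
  by move=> t t0; rewrite gt_eqF// fB_gt0.
have [M M0 hM] := cont_bounded X cF d0.
exists (Num.max M (2 * Cb)); first by rewrite le_max (ltW M0).
move=> t t0 tX; have B0 := fB_gt0 l t0; have [td|dt] := leP t d; last first.
  have : `|F t| <= M by apply: hM; rewrite (ltW dt).
  rewrite /F normrM normfV (gtr0_norm B0) ler_pdivrMr// => /le_trans; apply.
  by rewrite ler_wpM2r ?(ltW B0)// le_max lexx.
have [b0 gb] := hd t t0 td.
have : `|g t| <= 2 * fb l t.
  have : `|g t / fb l t| <= 2.
    rewrite -(subrK 1 (g t / fb l t)) (le_trans (ler_normD _ _))// normr1.
    by rewrite -[2]/(1 + 1) lerD2r.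
  by rewrite normrM normfV (gtr0_norm b0) ler_pdivrMr.
move=> /le_trans; apply.
apply: (@le_trans _ _ (2 * (Cb * fB l t))).
  by rewrite ler_wpM2l// (le_trans (ler_norm _))// hCb.
by rewrite mulrA ler_wpM2r ?(ltW B0)// le_max lexx orbT.
Qed.

End SingularSolution.

(** * Coefficients of the powers of [z] *)

Section Coefficients.
Context {R : realType}.
Variables (l : R) (q : R -> R).
Local Notation posR := (`]0, +oo[%classic : set R).
Hypothesis hl : - 2^-1 <= l.
Hypothesis mq : measurable_fun posR q.
Hypothesis hq : forall X, itg (fun t => fA l t * fB l t * q t) 0 X.

Lemma bounded_extend (F : R -> R) (M X : R) : cont F ->
  (forall x, 0 < x -> x <= 1 -> `|F x| <= M) ->
  exists2 M', 0 <= M' & forall x, 0 < x -> x <= X -> `|F x| <= M'.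
Proof.
move=> cF hM; have [N N0 hN] := cont_bounded X cF ltr01.
exists (Num.max N M) => [|x x0 xX]; first by rewrite le_max (ltW N0).
have [x1|/ltW x1] := leP x 1; first by rewrite le_max (hM _ x0 x1) orbT.
by rewrite le_max hN ?x1.
Qed.

Lemma locint0_bounded (F : R -> R) (M : R) : cont F ->
  (forall x, 0 < x -> x <= 1 -> `|F x| <= M) -> locint 0 F.
Proof.
move=> cF hM lo X /window0 ->; have [N N0 hN] := bounded_extend X cF hM.
apply: (itg_le _ _ (itg_cst 0 X N)); first exact: cont_meas.
by move=> t /andP[t0 tX]; exact: hN.
Qed.

(** For [s = sqrt t] the inequality [ln y < y] at [y = 1 / s] gives [- ln t <= 2 / s], hence
    [s (1 + |ln t|) <= s + 2 <= 3]; squaring produces the [9]. *)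
Lemma lw_sqr (t : R) : 0 < t -> t <= 1 -> t * lw (- 2^-1) t ^+ 2 <= 9.
Proof.
move=> t0 t1; rewrite /lw ltxx; set s := t `^ 2^-1.
have s0 : 0 < s by exact: powR_gt0.
have ts : t = s ^+ 2 by rewrite /s -powR_mulrn ?powR_ge0// -powRrM mulVf ?powRr1// ltW.
have s1 : s <= 1.
  by rewrite leNgt; apply/negP => s1; move: t1; rewrite ts leNgt expr_gt1 ?s1 ?(ltW s0).
have lt0 : ln t <= 0 by exact: ln_le0.
have h : - ln t <= 2 / s.
  have : ln s^-1 < s^-1 by apply: ln_sublinear; rewrite invr_gt0.
  rewrite lnV// ts lnXn// => h; lra.
have h2 : s * (1 + `|ln t|) <= 3.
  rewrite ler0_norm// mulrDr mulr1.
  have : s * - ln t <= 2 by rewrite mulrC -ler_pdivlMr.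
  lra.
have h3 : 0 <= s * (1 + `|ln t|) by rewrite mulr_ge0 ?addr_ge0// ltW.
rewrite {1}ts -exprMn (_ : 9 = 3 ^+ 2 :> R); last by ring.
by rewrite lerXn2r// nnegrE.
Qed.

Lemma lw_lin (t : R) : 0 < t -> t <= 1 -> t * lw l t <= 9.
Proof.
move=> t0 t1; have [h|h] := ltP (- 2^-1) l; first by rewrite /lw h mulr1; lra.
have lE' : l = - 2^-1 by apply/eqP; rewrite eq_le h hl.
have := lw_sqr t0 t1; rewrite -lE'; have := lw_ge1 l t; nra.
Qed.

(* The recursion is closed under multiplication by [z]: [sum_n z^n u_n] solves
   [- w'' + V w = z w]. *)
Definition coef_family (V w : R -> R) (u u1 : nat -> R -> R) :=
  [/\ forall n, prim (u1 n) (u n), prim (fun t => V t * u 0%N t) (u1 0%N),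
      forall n, prim (fun t => V t * u n.+1 t + (fun=> -1) t * u n t) (u1 n.+1) &
      forall (X r : R), 0 < r -> exists2 K, 0 <= K &
        forall n x, 0 < x -> x <= X -> `|u n x| <= K * w x / r ^+ n].

Variables (f f1 g g1 : R -> R).
Let V := pot l q.
Hypotheses (pf : prim f1 f) (pf1 : prim (fun t => V t * f t) f1)
  (pg : prim g1 g) (pg1 : prim (fun t => V t * g t) g1)
  (W : forall x, 0 < x -> g x * f1 x - g1 x * f x = 1).
Hypothesis hf : forall X, exists2 C, 0 <= C &
  forall t, 0 < t -> t <= X -> `|f t| <= C * fA l t.
Hypothesis hg : forall X, exists2 C, 0 <= C &
  forall t, 0 < t -> t <= X -> `|g t| <= C * fB l t.

Let m1 := (fun=> -1) : R -> R.
Let mm1 : measurable_fun posR m1. Proof. exact: measurable_cst. Qed.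

Let hm1 X : itg (fun t => fA l t * fB l t * m1 t) 0 X.
Proof.
have : locint 0 (fun t => fA l t * fB l t * m1 t).
  apply: (@locint0_bounded _ 9).
    apply: contM; last exact: cont_cst.
    by apply: contM; [exact: cont_fA|exact: cont_fB].
  move=> x x0 x1; rewrite /m1 mulrN1 normrN fAB// gtr0_norm ?mulr_gt0 ?lw_gt0//.
  exact: lw_lin.
have [X0|X0] := ltP X 0; first by move=> _; apply: itg_nil; exact: ltW.
by apply; split.
Qed.

Let cf : cont f := prim_cont pf.
Let cg : cont g := prim_cont pg.
Let locA := base0_locint_a hl cf hf mm1 hm1.
Let locB := base0_locint_b cg hg mm1 hm1.
Let ker := @base0_kernel _ l f g m1 hl hf hg hm1.

Let vd (v : R -> R) : dominated (fA l) 0 v -> dominated (fA l) 0 (vop m1 f g 0 v).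
Proof.
exact: (vop_dominated (lexx _) pf pf1 pg pg1 W (@cont_fA R l) (fA_gt0 l) mm1 locA locB ker).
Qed.

Let vp (v : R -> R) : dominated (fA l) 0 v ->
  prim (vop1 m1 f f1 g g1 0 v) (vop m1 f g 0 v) /\
  prim (fun t => V t * vop m1 f g 0 v t + m1 t * v t) (vop1 m1 f f1 g g1 0 v).
Proof.
exact: (vop_prim (lexx _) pf pf1 pg pg1 W (fA_gt0 l) mm1 locA locB).
Qed.

Let vb u0 X (r : R) : dominated (fA l) 0 u0 -> 0 < r -> exists2 K, 0 <= K &
  forall n x, 0 < x -> x <= X -> `|vseq m1 f g 0 u0 n x| <= K * fA l x / r ^+ n.
Proof.
move=> d0 r0; have [X0|X0] := ltP X 0.
  by exists 0 => // n x h1 h2; move: (lt_le_trans h1 h2); rewrite ltNge ltW.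
have dom : window 0 0 X by split.
have [K K0 hK] := vseq_bound (lexx _) pf pf1 pg pg1 W (@cont_fA R l) (fA_gt0 l) mm1
  locA locB ker d0 dom r0.
by exists K => // n x h1 h2; apply: hK; rewrite h1.
Qed.

Let df : dominated (fA l) 0 f.
Proof.
apply: dominated0 => //; have [C C0 hC] := hf 1.
by exists C => x x0 x1; exact: hC.
Qed.

Lemma phi_coef : exists u u1, [/\ coef_family V (fA l) u u1, u 0%N = f &
  forall n (e : R), 0 < e -> exists2 d, 0 < d &
    forall t, 0 < t -> t <= d -> `|u n.+1 t| <= e * fA l t].
Proof.
pose u n := vseq m1 f g 0 f n.
pose u1 n := if n is m.+1 then vop1 m1 f f1 g g1 0 (u m) else f1.
have du n : dominated (fA l) 0 (u n) by rewrite /u; elim: n => //= n; exact: vd.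
exists u, u1; split=> //.
  split=> //.
  - by case=> [|n]; [|exact: (vp (du n)).1].
  - by move=> n; exact: (vp (du n)).2.
  - by move=> X r; exact: vb.
move=> n e e0; have [C C0 hC] := hf 1.
pose e' := Num.min 1 (e / (C + 1)).
have e'0 : 0 < e' by rewrite lt_min ltr01 divr_gt0// ltr_wpDl.
have e'1 : e' <= 1 by rewrite ge_min lexx.
have e'e : e' * (C + 1) <= e.
  by rewrite -ler_pdivlMr ?ltr_wpDl// ge_min lexx orbT.
have [d [d0 d1 hd]] := vseq_small hl cf cg hf hg mm1 hm1 pf pg C0 e'0 df hC vd.
exists d => // t t0 td; apply: le_trans (hd n.+1 t t0 td) _.
rewrite ler_wpM2r ?(ltW (fA_gt0 _ _))// exprS mulrCA mulrA.
have : e' ^+ n <= 1 by rewrite exprn_ile1// ltW.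
have : 0 <= e' ^+ n by rewrite exprn_ge0// ltW.
nra.
Qed.

(** The integral against [f] is based at [0] throughout, while the one against [g] converges at [0]
    only once [v] is small enough, so it gets its own base point [c]. Another choice of [c] adds a
    multiple of [f] and does not affect the equation. *)
Let step c v x := f x * sint c (fun t => g t * (m1 t * v t)) x -
  g x * sint 0 (fun t => f t * (m1 t * v t)) x.
Let step1 c v x := f1 x * sint c (fun t => g t * (m1 t * v t)) x -
  g1 x * sint 0 (fun t => f t * (m1 t * v t)) x.

Let step_prim c v : 0 <= c -> locint c (fun t => g t * (m1 t * v t)) ->
  locint 0 (fun t => f t * (m1 t * v t)) ->
  prim (step1 c v) (step c v) /\
  prim (fun t => V t * step c v t + m1 t * v t) (step1 c v).
Proof. by move=> c0 h1 h2; apply: VOC => //; exact: sint_prim. Qed.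

Let cm v : cont v -> cont (fun t => m1 t * v t).
Proof. by move=> cv; apply: contM cv; exact: cont_cst. Qed.

Let Q_locint v (n : nat) C : cont v ->
  (forall x, 0 < x -> x <= 1 -> `|v x| <= C * x ^+ n * fB l x) ->
  locint 0 (fun t => f t * (m1 t * v t)).
Proof.
move=> cv hv; have [D D0 hD] := hf 1.
have cF : cont (fun t => f t * (m1 t * v t)) by apply: contM => //; exact: cm.
apply: (@locint0_bounded _ (D * (`|C| * 9)) cF) => x x0 x1.
rewrite /m1 mulN1r mulrN normrN normrM.
apply: le_trans (ler_pM _ _ (hD x x0 x1) (hv x x0 x1)) _ => //.
rewrite [X in X <= _](_ : _ = D * (C * (x ^+ n * (fA l x * fB l x)))); last by ring.
rewrite ler_wpM2l// fAB//.
have xl0 : 0 <= x * lw l x by rewrite mulr_ge0 ?(ltW (lw_gt0 _ _)) ?ltW.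
have xn0 : 0 <= x ^+ n by rewrite exprn_ge0// ltW.
have xn1 : x ^+ n <= 1 by rewrite exprn_ile1// ltW.
apply: (@le_trans _ _ (`|C| * (x ^+ n * (x * lw l x)))).
  by apply: ler_wpM2r; [rewrite mulr_ge0|exact: ler_norm].
rewrite ler_wpM2l// -[9]mul1r ler_pM//; exact: lw_lin.
Qed.

Let P_locint1 v : cont v -> locint 1 (fun t => g t * (m1 t * v t)).
Proof.
move=> cv lo hi [lo0 _ _ h]; apply: cont_itg; first by apply: contM => //; exact: cm.
by rewrite lt_def lo0 andbT; apply/eqP => /h/eqP; rewrite oner_eq0.
Qed.

(** The [g]-integrand is [O(t ^ (n - 2 l))] with a nonpositive exponent, so on []x, 1]] it is
    bounded by its value at [x]. Multiplied by [fA] this gains one power of [x] over [x ^+ n * fB],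
    which is all the recursion needs, and no logarithm arises. The hypothesis forces [l >= 0]. *)
Let step1_bound v (n : nat) : n%:R <= 2 * l -> cont v ->
  (exists C, forall x, 0 < x -> x <= 1 -> `|v x| <= C * x ^+ n * fB l x) ->
  exists C, forall x, 0 < x -> x <= 1 -> `|step 1 v x| <= C * x ^+ n.+1 * fB l x.
Proof.
move=> nl cv [C0 hv]; pose C := Num.max C0 0.
have Cp : 0 <= C by rewrite le_max lexx orbT.
have l0 : 0 <= l by have := ler0n R n; lra.
have hl' : - 2^-1 < l by lra.
have fBE x : fB l x = x `^ (- l) by rewrite /fB /lw hl' mulr1.
have {hv}hC x : 0 < x -> x <= 1 -> `|v x| <= C * x ^+ n * fB l x.
  move=> x0 x1; apply: le_trans (hv x x0 x1) _.
  rewrite ler_wpM2r ?(ltW (fB_gt0 _ _))// ler_wpM2r ?exprn_ge0 ?(ltW x0)//.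
  by rewrite le_max lexx.
have [D D0 hD] := hf 1; have [E E0 hE] := hg 1.
have cG : cont (fun t => g t * (m1 t * v t)) by apply: contM => //; exact: cm.
have cF : cont (fun t => f t * (m1 t * v t)) by apply: contM => //; exact: cm.
have Fi x : 0 <= x -> itg (fun t => f t * (m1 t * v t)) 0 x.
  by move=> x0; apply: (Q_locint cv hC); split.
exists (D * E * C + E * D * C) => x x0 x1.
have A0 := fA_gt0 l x0; have B0 := fB_gt0 l x0.
have PB : `|sint 1 (fun t => g t * (m1 t * v t)) x| <=
    E * C * (x ^+ n * (x `^ (- l) * x `^ (- l))).
  rewrite /sint (oint_nil _ x1) sub0r normrN.
  apply: le_trans (le_norm_oint (cont_itg _ cG x0)
    (itg_cst x 1 (E * C * (x ^+ n * (x `^ (- l) * x `^ (- l))))) _) _; last first.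
    rewrite oint_cst// ler_piMr//; last by lra.
    by rewrite !mulr_ge0 ?powR_ge0// exprn_ge0// ltW.
  move=> t /andP[xt t1]; have t0 : 0 < t by exact: lt_trans xt.
  rewrite /m1 mulN1r mulrN normrN normrM.
  apply: le_trans (ler_pM _ _ (hE t t0 t1) (hC t t0 t1)) _ => //.
  rewrite !fBE [X in X <= _](_ : _ = E * C * (t ^+ n * (t `^ (- l) * t `^ (- l)))); last by ring.
  rewrite ler_wpM2l ?mulr_ge0//.
  have pE s : 0 < s -> s ^+ n * (s `^ (- l) * s `^ (- l)) = (s `^ (2 * l - n%:R))^-1.
    move=> s0; rewrite -powR_mulrn ?(ltW s0)// -!powR_add// -powRN.
    by congr (_ `^ _); ring.
  rewrite !pE// lef_pV2 ?posrE ?powR_gt0// ge0_ler_powR ?nnegrE ?(ltW x0) ?(ltW t0) ?(ltW xt)//.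
  by rewrite subr_ge0.
have QB : `|sint 0 (fun t => f t * (m1 t * v t)) x| <= D * C * x ^+ n.+1.
  rewrite /sint (oint_nil _ (ltW x0)) subr0.
  apply: le_trans (le_norm_oint (Fi _ (ltW x0)) (itg_cst 0 x (D * C * x ^+ n.+1)) _) _; last first.
    rewrite oint_cst ?(ltW x0)// subr0 ler_piMr//.
    by rewrite !mulr_ge0// exprn_ge0// ltW.
  move=> t /andP[t0 tx]; have t1 : t <= 1 by exact: le_trans x1.
  rewrite /m1 mulN1r mulrN normrN normrM.
  apply: le_trans (ler_pM _ _ (hD t t0 t1) (hC t t0 t1)) _ => //.
  rewrite [X in X <= _](_ : _ = D * C * (t ^+ n * (fA l t * fB l t))); last by ring.
  rewrite ler_wpM2l ?mulr_ge0// fAB// /lw hl' mulr1 -exprSr.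
  by rewrite lerXn2r// nnegrE ltW.
rewrite /step (le_trans (ler_normB _ _))// !normrM.
rewrite (mulrDl (D * E * C)) mulrDl; apply: lerD.
  apply: le_trans (ler_pM _ _ (hD x x0 x1) PB) _ => //.
  rewrite [X in X <= _](_ : _ = D * E * C * (x ^+ n * (fA l x * x `^ (- l)) * x `^ (- l))); last by ring.
  by rewrite -(fBE x) fAB// /lw hl' mulr1 -exprSr mulrA.
apply: le_trans (ler_pM _ _ (hE x x0 x1) QB) _ => //.
by rewrite le_eqVlt; apply/orP; left; apply/eqP; ring.
Qed.

(** Once [n > 2 l], the product [fB |v|] is bounded near [0], by [lw_sqr] when [l = -1/2]. Hence
    both integrals may start at [0]; the kernel inequality then reduces the term with [g x] to the
    size of [fA]. *)
Let last_step v (n : nat) : 2 * l < n%:R -> cont v ->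
  (exists C, forall x, 0 < x -> x <= 1 -> `|v x| <= C * x ^+ n * fB l x) ->
  locint 0 (fun t => g t * (m1 t * v t)) /\
  exists C, forall x, 0 < x -> x <= 1 -> `|step 0 v x| <= C * fA l x.
Proof.
move=> nl cv [C0 hv]; pose C := Num.max C0 0.
have Cp : 0 <= C by rewrite le_max lexx orbT.
have {hv}hC x : 0 < x -> x <= 1 -> `|v x| <= C * x ^+ n * fB l x.
  move=> x0 x1; apply: le_trans (hv x x0 x1) _.
  rewrite ler_wpM2r ?(ltW (fB_gt0 _ _))// ler_wpM2r ?exprn_ge0 ?(ltW x0)//.
  by rewrite le_max lexx.
have [D D0 hD] := hf 1; have [E E0 hE] := hg 1.
have cG : cont (fun t => g t * (m1 t * v t)) by apply: contM => //; exact: cm.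
have BB x : 0 < x -> x <= 1 -> fB l x * `|v x| <= 9 * C.
  move=> x0 x1; have B0 := fB_gt0 l x0.
  apply: le_trans (ler_wpM2l (ltW B0) (hC x x0 x1)) _.
  rewrite [X in X <= _](_ : _ = (x ^+ n * (fB l x * fB l x)) * C); last by ring.
  rewrite ler_wpM2r//; have [h|h] := ltP (- 2^-1) l.
    rewrite /fB /lw h mulr1 -powR_mulrn ?(ltW x0)// -!powR_add//.
    rewrite (_ : _ + _ = n%:R - 2 * l); last by ring.
    apply: (@le_trans _ _ (1 `^ (n%:R - 2 * l))); last by rewrite powR1 ler1n.
    by rewrite ge0_ler_powR ?nnegrE ?subr_ge0 ?(ltW nl) ?(ltW x0).
  have lE' : l = - 2^-1 by apply/eqP; rewrite eq_le h hl.
  have xn1 : x ^+ n <= 1 by rewrite exprn_ile1// ltW.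
  rewrite -[9]mul1r; apply: ler_pM => //; first by rewrite exprn_ge0// ltW.
    by rewrite mulr_ge0// ltW.
  rewrite /fB mulrACA -powR_add// lE' opprK (_ : 2^-1 + 2^-1 = 1); last by field.
  by rewrite powRr1 ?(ltW x0)// -expr2; exact: lw_sqr.
have LG : locint 0 (fun t => g t * (m1 t * v t)).
  apply: (@locint0_bounded _ (E * (9 * C)) cG) => x x0 x1.
  rewrite /m1 mulN1r mulrN normrN normrM.
  apply: le_trans (ler_wpM2r (normr_ge0 _) (hE x x0 x1)) _.
  by rewrite -mulrA ler_wpM2l// BB.
have LF := Q_locint cv hC.
split=> //; have [k k0 hk] := fB_mono hl 1.
exists (D * (E * (9 * C)) + E * (D * (k * (9 * C)))) => x x0 x1.
have A0 := fA_gt0 l x0; have B0 := fB_gt0 l x0.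
have dom : window 0 0 x by split=> //; exact: ltW.
have PB : `|sint 0 (fun t => g t * (m1 t * v t)) x| <= E * (9 * C).
  rewrite /sint (oint_nil _ (ltW x0)) subr0.
  apply: le_trans (le_norm_oint (LG _ _ dom) (itg_cst 0 x (E * (9 * C))) _) _; last first.
    rewrite oint_cst ?(ltW x0)// subr0 ler_piMr//.
    by rewrite !mulr_ge0.
  move=> t /andP[t0 tx]; have t1 : t <= 1 by exact: le_trans x1.
  rewrite /m1 mulN1r mulrN normrN normrM.
  apply: le_trans (ler_wpM2r (normr_ge0 _) (hE t t0 t1)) _.
  by rewrite -mulrA ler_wpM2l// BB.
have QB : fB l x * `|sint 0 (fun t => f t * (m1 t * v t)) x| <=
    D * (k * (9 * C)) * fA l x.
  rewrite /sint (oint_nil _ (ltW x0)) subr0 mulrC -ler_pdivlMr//.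
  apply: le_trans (le_norm_oint (LF _ _ dom)
    (itg_cst 0 x (D * (k * (9 * C)) * fA l x / fB l x)) _) _; last first.
    rewrite oint_cst ?(ltW x0)// subr0 ler_piMr//.
    by rewrite !mulr_ge0// ?invr_ge0 ltW.
  move=> t /andP[t0 tx]; have t1 : t <= 1 by exact: le_trans x1.
  rewrite /m1 mulN1r mulrN normrN normrM ler_pdivlMr//.
  apply: le_trans (ler_wpM2r (ltW B0) (ler_wpM2r (normr_ge0 _) (hD t t0 t1))) _.
  rewrite [X in X <= _](_ : _ = D * ((fB l x * fA l t) * `|v t|)); last by ring.
  rewrite [X in _ <= X](_ : _ = D * (k * (9 * C * fA l x))); last by ring.
  rewrite ler_wpM2l//.
  apply: le_trans (ler_wpM2r (normr_ge0 (v t)) (hk t x t0 tx x1)) _.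
  rewrite [X in X <= _](_ : _ = k * (fB l t * `|v t| * fA l x)); last by ring.
  by rewrite ler_wpM2l ?(ltW k0)// ler_wpM2r ?(ltW A0)// BB.
rewrite /step (le_trans (ler_normB _ _))// !normrM mulrDl; apply: lerD.
  apply: le_trans (ler_pM _ _ (hD x x0 x1) PB) _ => //.
  by rewrite le_eqVlt; apply/orP; left; apply/eqP; ring.
apply: le_trans (ler_wpM2r (normr_ge0 _) (hE x x0 x1)) _.
by rewrite -!mulrA ler_wpM2l//; move: QB; rewrite -!mulrA.
Qed.

(* [theta_n = O(x ^+ n * fB)] with integrals taken from [1] as long as [n <= 2 l];
   after that [theta_n] is integrable against [g] at [0], the base point moves
   there, and all later terms are of the size of [fA]. *)
Lemma theta_coef : exists u u1, [/\ coef_family V (fB l) u u1, u 0%N = g &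
  forall n (e : R), 0 < e -> exists2 d, 0 < d &
    forall t, 0 < t -> t <= d -> `|u n.+1 t| <= e * fB l t].
Proof.
(* [N] is the least natural number above [2 l]; for [l < 0] it is [0] and all integrals start at
   [0]. *)
have [N lN Nl] : exists2 N : nat, 2 * l < N%:R &
    forall n, (n < N)%N -> n%:R <= 2 * l.
  have ex : exists n : nat, 2 * l < n%:R.
    by exists (Num.bound `|2 * l|); rewrite (le_lt_trans (ler_norm _))// archi_boundP.
  exists (ex_minn ex); first by case: ex_minnP.
  case: ex_minnP => m _ hm n; apply: contraTle => h; rewrite -leqNgt; exact: hm.
pose c (n : nat) : R := if (n < N)%N then 1 else 0.
pose u := fix u n := if n is m.+1 then step (c m) (u m) else g.
pose u1 n := if n is m.+1 then step1 (c m) (u m) else g1.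
have c0 n : 0 <= c n by rewrite /c; case: ifP.
have T1 n : (n <= N)%N -> cont (u n) /\
    exists C, forall x, 0 < x -> x <= 1 -> `|u n x| <= C * x ^+ n * fB l x.
  elim: n => [_|n IH nN].
    split=> //; have [C C0 hC] := hg 1; exists C => x x0 x1.
    by rewrite expr0 mulr1; exact: hC.
  have [cu [C hC]] := IH (ltnW nN).
  have cn : c n = 1 by rewrite /c nN.
  split=> /=; rewrite cn.
    apply: prim_cont (step_prim ler01 (P_locint1 cu) (Q_locint cu hC)).1.
  by apply: step1_bound => //; [exact: Nl|exists C].
have [cN bN] := T1 N (leqnn _).
have cnN : c N = 0 by rewrite /c ltnn.
have [LG [C1 hC1]] := last_step lN cN bN.
have LF : locint 0 (fun t => f t * (m1 t * u N t)).
  by have [C hC] := bN; exact: Q_locint cN hC.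
have pN := step_prim (lexx 0) LG LF.
have dN : dominated (fA l) 0 (u N.+1).
  rewrite /= cnN; apply: dominated0; last by exists C1.
  exact: prim_cont pN.1.
have uE m : u (N.+1 + m)%N = vseq m1 f g 0 (u N.+1) m.
  elim: m => [|m IH]; first by rewrite addn0.
  rewrite addnS.
  have -> : u (N.+1 + m).+1 = step (c (N.+1 + m)%N) (u (N.+1 + m)%N) by [].
  rewrite IH /c ifF//.
  by apply/negbTE; rewrite -leqNgt addSn -addnS leq_addr.
have dm m : dominated (fA l) 0 (u (N.+1 + m)%N).
  by rewrite uE; elim: m => //= m; exact: vd.
have P n : prim (u1 n.+1) (u n.+1) /\
    prim (fun t => V t * u n.+1 t + m1 t * u n t) (u1 n.+1).
  have [nN|nN|nN] := ltngtP n N.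
  - have [cu [C hC]] := T1 n (ltnW nN).
    rewrite /= /c nN; apply: step_prim => //; first exact: P_locint1.
    exact: Q_locint cu hC.
  - have cn : c n = 0 by rewrite /c ltnNge (ltnW nN).
    have uS : u n.+1 = step (c n) (u n) by [].
    have u1S : u1 n.+1 = step1 (c n) (u n) by [].
    have dn : dominated (fA l) 0 (u n) by rewrite -(subnKC nN).
    by rewrite uS u1S cn; exact: vp dn.
  - by rewrite nN /= cnN.
exists u, u1; split=> //.
  split=> //.
  - by case=> [|n]; [|exact: (P n).1].
  - by move=> n; exact: (P n).2.
  move=> X r r0; have [K K0 hK] := vb X dN r0; have [k k0 hk] := fA_le_fB hl X.
  have bn n : (n <= N)%N -> exists2 C, 0 <= C & forall x, 0 < x -> x <= X ->
      `|u n x| <= C * fB l x.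
    move=> /T1[cu [C hC]]; pose F t := u n t / fB l t.
    have cF : cont F.
      apply: contM => //; apply: cont_inv; first exact: cont_fB.
      by move=> t t0; rewrite gt_eqF// fB_gt0.
    have [|M M0 hM] := @bounded_extend F `|C| X cF.
      move=> x x0 x1; have B0 := fB_gt0 l x0.
      rewrite /F normrM normfV (gtr0_norm B0) ler_pdivrMr//.
      apply: le_trans (hC x x0 x1) _; rewrite ler_wpM2r ?(ltW B0)//.
      have xn1 : x ^+ n <= 1 by rewrite exprn_ile1// ltW.
      have xn0 : 0 <= x ^+ n by rewrite exprn_ge0// ltW.
      by have := ler_norm C; have := normr_ge0 C; nra.
    exists M => // x x0 xX; have B0 := fB_gt0 l x0.
    by have := hM x x0 xX; rewrite /F normrM normfV (gtr0_norm B0) ler_pdivrMr.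
  have [K' K'0 hK'] : exists2 K', 0 <= K' & forall n x, (n <= N)%N -> 0 < x -> x <= X ->
      `|u n x| <= K' * fB l x / r ^+ n.
    elim: {1 3}N (leqnn N) => [_|M IH MN].
      have [C C0 hC] := bn 0%N (leq0n _); exists C => // n x.
      by rewrite leqn0 => /eqP -> x0 xX; rewrite expr0 divr1; exact: hC.
    have [K' K'0 hK'] := IH (ltnW MN); have [C C0 hC] := bn _ MN.
    exists (Num.max K' (C * r ^+ M.+1)); first by rewrite le_max K'0.
    move=> n x; rewrite leq_eqVlt => /predU1P[->|nM] x0 xX.
      rewrite ler_pdivlMr ?exprn_gt0//.
      apply: le_trans (ler_wpM2r _ (hC x x0 xX)) _; first by rewrite exprn_ge0// ltW.
      rewrite mulrAC ler_wpM2r ?(ltW (fB_gt0 _ _))//.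
      by rewrite le_max lexx orbT.
    apply: le_trans (hK' n x nM x0 xX) _.
    rewrite ler_wpM2r ?invr_ge0 ?exprn_ge0 ?(ltW r0)//.
    by rewrite ler_wpM2r ?(ltW (fB_gt0 _ _))// le_max lexx.
  (* The finitely many terms up to [N] are absorbed in [K']; the later ones are Volterra iterates
     counted from [N.+1], so the index shift costs the factor [r ^+ N.+1], and [k] turns [fA] into
     [fB]. *)
  exists (Num.max K' (K * k * r ^+ N.+1)); first by rewrite le_max K'0.
  move=> n x x0 xX; have B0 := fB_gt0 l x0; have [nN|nN] := leqP n N.
    apply: le_trans (hK' n x nN x0 xX) _.
    rewrite ler_wpM2r ?invr_ge0 ?exprn_ge0 ?(ltW r0)//.
    by rewrite ler_wpM2r ?(ltW B0)// le_max lexx.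
  rewrite -(subnKC nN) uE; apply: le_trans (hK _ x x0 xX) _.
  rewrite exprD invfM.
  apply: (@le_trans _ _ (K * k * r ^+ N.+1 * fB l x * ((r ^+ N.+1)^-1 * (r ^+ (n - N.+1))^-1))).
    rewrite [X in _ <= X](_ : _ = K * (k * fB l x) / r ^+ (n - N.+1)); last first.
      by field; rewrite !gt_eqF ?exprn_gt0.
    by rewrite ler_wpM2r ?invr_ge0 ?exprn_ge0 ?(ltW r0)// ler_wpM2l// hk.
  rewrite ler_wpM2r ?mulr_ge0 ?invr_ge0 ?exprn_ge0 ?(ltW r0)//.
  by rewrite ler_wpM2r ?(ltW B0)// le_max lexx orbT.
move=> n e e0; have [nN|nN] := leqP n.+1 N.
  have [_ [C hC]] := T1 _ nN.
  exists (Num.min 1 (e / (`|C| + 1))).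
    by rewrite lt_min ltr01 divr_gt0// ltr_wpDl.
  move=> t t0; rewrite le_min => /andP[t1 te]; have B0 := fB_gt0 l t0.
  apply: le_trans (hC t t0 t1) _; rewrite ler_wpM2r ?(ltW B0)// exprS.
  have tn1 : t ^+ n <= 1 by rewrite exprn_ile1// ltW.
  have tn0 : 0 <= t ^+ n by rewrite exprn_ge0// ltW.
  move: te; rewrite ler_pdivlMr ?ltr_wpDl// => te.
  have C0 := normr_ge0 C; apply: (@le_trans _ _ (`|C| * t)); last by nra.
  apply: le_trans (ler_wpM2r _ (ler_norm C)) _; first by rewrite mulr_ge0// ltW.
  by rewrite ler_wpM2l// ler_piMr// ltW.
have [C hC] : exists C, forall x, 0 < x -> x <= 1 -> `|u n.+1 x| <= C * fA l x.
  rewrite -(subnKC nN); have dom : window 0 0 (1 : R) by split.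
  have [_ h] := dm (n.+1 - N.+1)%N; have [C hC] := h 0 1 dom.
  by exists C => x x0 x1; apply: hC; rewrite x0.
have [Cb Cb0 hCb] := fb_le hl.
(* The late terms are only [O(fA)], and [fA] is negligible against [fB]: with this threshold
   [(|C| + 1) fA <= e fB], where [Cb] pays for passing from [fb] to [fB]. *)
have [d [d0 d1 hd]] := fb_fA_large hl (Cb * (`|C| + 1) / e).
exists d => // t t0 td; have [b0 h] := hd t t0 td.
have A0 := fA_gt0 l t0; have B0 := fB_gt0 l t0.
have t1 : t <= 1 by apply: le_trans td _; lra.
apply: le_trans (hC t t0 t1) _.
move: h; rewrite ler_pdivrMr// mulrAC ler_pdivlMr// => h.
have := hCb t t0; rewrite gtr0_norm// => h2.
have C0 := normr_ge0 C; have C1' := ler_norm C.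
have h3 : Cb * (`|C| + 1) * fA l t <= Cb * fB l t * e.
  by apply: le_trans h _; rewrite ler_wpM2r// ltW.
have h4 : (`|C| + 1) * fA l t <= fB l t * e.
  have : Cb * ((`|C| + 1) * fA l t) <= Cb * (fB l t * e) by lra.
  by rewrite ler_pM2l.
apply: (@le_trans _ _ ((`|C| + 1) * fA l t)); last by lra.
by rewrite ler_wpM2r ?(ltW A0)//; lra.
Qed.

End Coefficients.

(** * Hardy inequalities and regularity *)

Section LpUnitInterval.
Context {R : realType}.
Local Notation mu := (@lebesgue_measure R).
Local Notation posR := (`]0, +oo[%classic : set R).
Local Notation D01 := (`]0, 1[%classic : set R).
Implicit Types (f h E G : R -> R).

Let sub01 : D01 `<=` posR.
Proof. by move=> x; rewrite /= !in_itv/= andbT => /andP[]. Qed.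

Let mes01 f : measurable_fun posR f -> measurable_fun setT (f \_ D01).
Proof.
by move=> mf; apply/(measurable_restrictT _ _).1 => //; exact: measurable_funS mf.
Qed.

Lemma measurable_powR_norm f (p : R) (D : set R) : measurable_fun D f ->
  measurable_fun D (fun t => `|f t| `^ p).
Proof.
move=> mf; apply: (@measurableT_comp _ _ _ _ _ _ (@powR R ^~ p)) => //.
exact: measurableT_comp.
Qed.

Lemma ae_imp (P Q : R -> Prop) : (forall x, P x -> Q x) ->
  {ae mu, forall x, P x} -> {ae mu, forall x, Q x}.
Proof.
move=> PQ; apply: filterS; last exact: PQ.
exact: (ae_filter_ringOfSetsType mu).
Qed.

(** Monotone convergence along the sets []X / (i + 1), X]] turns a bound that is uniform away from
    [0] into integrability up to [0]. *)
Lemma itg_exhaust f (M X : R) : 0 < X -> measurable_fun posR f ->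
  (forall t, 0 < t -> t <= X -> 0 <= f t) ->
  (forall d, 0 < d -> d <= X -> itg f d X /\ oint f d X <= M) ->
  itg f 0 X /\ oint f 0 X <= M.
Proof.
move=> X0 mf f0 hf.
pose F (i : nat) : set R := `]X / i.+1%:R, X]%classic.
have FU : \bigcup_i F i = `]0, X]%classic :> set R.
  apply/seteqP; split=> [x [i _]|x].
    rewrite /F /= !in_itv/= => /andP[h1 ->]; rewrite andbT.
    by apply: le_lt_trans h1; rewrite divr_ge0// ltW.
  rewrite /= in_itv/= => /andP[x0 x1]; exists (Num.bound (X / x)) => //.
  rewrite /F /= in_itv/= x1 andbT ltr_pdivrMr// mulrC -ltr_pdivrMr//.
  apply: lt_trans (archi_boundP _) _; first by rewrite divr_ge0// ltW.
  by rewrite ltr_nat.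
have fF i : forall x, F i x -> (0 <= `|(f x)%:E|)%E by [].
have mF i : measurable (F i) by exact: measurable_itv.
have mFf i : measurable_fun (F i) (fun x => `|(f x)%:E|%E).
  apply: (measurableT_comp (@abse_measurable R setT)); apply/measurable_EFinP.
  by apply: pos_meas => //; rewrite divr_ge0// ltW.
have nd : {homo F : n m / (n <= m)%N >-> (n <= m)%O}.
  move=> n m nm; apply/subsetPset/subset_itv; rewrite bnd_simp//.
  by rewrite ler_pM2l// lef_pV2 ?posrE// ler_nat ltnS.
have cv : (\int[mu]_(x in F i) `|(f x)%:E|)%E @[i --> \oo] -->
    (\int[mu]_(x in \bigcup_i F i) `|(f x)%:E|)%E.
  exact: ge0_nondecreasing_set_cvg_integral.
have b i : (\int[mu]_(x in F i) `|(f x)%:E| <= M%:E)%E.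
  have d0 : 0 < X / i.+1%:R by rewrite divr_gt0.
  have d1 : X / i.+1%:R <= X by rewrite ler_pdivrMr// ler_peMr ?ler1n// ltW.
  have [fi fM] := hf _ d0 d1.
  have : (oint f (X / i.+1%:R) X)%:E = (\int[mu]_(x in F i) (f x)%:E)%E.
    by rewrite /oint /Rintegral fineK//; apply: integrable_fin_num fi.
  rewrite [X in (X <= _)%E](_ : _ = \int[mu]_(x in F i) (f x)%:E)%E => [<-|].
    by rewrite lee_fin.
  apply: eq_integral => x; rewrite inE /F /= in_itv/= => /andP[h1 h2].
  by rewrite ger0_norm// f0// (lt_trans d0 h1).
have I : (\int[mu]_(x in `]0%R, X]) `|(f x)%:E| <= M%:E)%E.
  rewrite -FU -(cvg_lim _ cv)//; apply: lime_le; last by exact: nearW.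
  by apply/cvg_ex; eexists; exact: cv.
have fi : itg f 0 X.
  apply/integrableP; split; first by apply/measurable_EFinP; exact: pos_meas.
  by apply: le_lt_trans I _; rewrite ltry.
split=> //; rewrite -lee_fin; apply: le_trans I.
rewrite /oint /Rintegral fineK; last by apply: integrable_fin_num fi.
by apply: le_integral => //; [exact: integrable_abse|move=> x _; rewrite lee_fin ler_norm].
Qed.

Let itg_open f : measurable_fun posR f ->
  (mu.-integrable D01 (EFin \o f) <-> itg f 0 1).
Proof.
move=> mf; split=> fi; last first.
  by apply: integrableS fi => //; apply: subset_itv; rewrite bnd_simp.
apply/integrableP; split; first by apply/measurable_EFinP; exact: pos_meas.
move/integrableP : (fi) => [_]; apply: le_lt_trans.
rewrite le_eqVlt; apply/orP; left; apply/eqP/esym.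
apply: integral_itv_bndo_bndc.
apply: (measurableT_comp (@abse_measurable R setT)).
by apply/measurable_EFinP; apply: measurable_funS mf.
Qed.

Lemma Lp01_finP (p : R) h : 1 <= p -> measurable_fun posR h ->
  (Lp01 p%:E h <-> itg (fun t => `|h t| `^ p) 0 1).
Proof.
move=> p1 mh; have p0 : p != 0 by rewrite gt_eqF// (lt_le_trans ltr01).
have mhp := measurable_powR_norm p mh.
have E : (fun x => (`|(h \_ D01) x| `^ p)%:E) = (EFin \o (fun t => `|h t| `^ p)) \_ D01.
  apply/funext => x; rewrite !patchE; case: ifP => // _.
  by rewrite normr0 powR0.
split.
  move=> /(Lfun_integrable p1); rewrite E => h1.
  by apply/(itg_open mhp); apply/integrable_mkcond.
move=> /(itg_open mhp) h1.
have : mu.-integrable setT ((EFin \o (fun t => `|h t| `^ p)) \_ D01).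
  by apply: (integrable_mkcond _ _).1.
rewrite -E => /integrableP[_ fi].
rewrite /Lp01 inE; apply/andP; split; rewrite inE/=; first exact: mes01.
rewrite /finite_norm; apply: (lty_poweRy p0); rewrite powR_Lnorm//.
apply: le_lt_trans fi; rewrite le_eqVlt; apply/orP; left; apply/eqP;
  apply: eq_integral => x _; by rewrite [RHS]gee0_abs ?lee_fin ?powR_ge0.
Qed.

Lemma Lp01_inftyP h : measurable_fun posR h ->
  (Lp01 +oo%E h <-> exists M, {ae mu, forall x, 0 < x < 1 -> `|h x| <= M}).
Proof.
move=> mh; have muT : (0 < mu [set: R])%E.
  apply: (@lt_le_trans _ _ (mu `]0%R, 1%R])); last first.
    by apply: le_measure; rewrite ?inE.
  by rewrite lebesgue_measure_itv/= lte_fin ltr01 sube0 lte_fin.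
split.
  rewrite /Lp01 inE => /andP[_]; rewrite inE/= /finite_norm unlock /Lnorm muT.
  move=> /ess_supr_bounded[M hM]; exists M; apply: ae_imp hM => x /= + xD.
  by rewrite patchE mem_set//= in_itv.
move=> [M hM]; rewrite /Lp01 inE; apply/andP; split; rewrite inE/=; first exact: mes01.
rewrite /finite_norm unlock /Lnorm muT.
apply: (@le_lt_trans _ _ (Num.max M 0)%:E); last exact: ltry.
apply/ess_supP; apply: ae_imp hM => x /= xM; rewrite patchE.
case: ifPn => [|_]; last by rewrite normr0 lee_fin le_max lexx orbT.
by rewrite inE/= in_itv/= => /xM; rewrite lee_fin le_max => ->.
Qed.

Lemma Lp01_le (p : \bar R) h E (C : R) : (1 <= p)%E -> measurable_fun posR h ->
  measurable_fun posR E -> (forall t, 0 < t -> t <= 1 -> `|h t| <= C * `|E t|) ->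
  Lp01 p E -> Lp01 p h.
Proof.
move=> p1 mh mE hE; have {}hE t : 0 < t -> t <= 1 -> `|h t| <= `|C| * `|E t|.
  by move=> t0 t1; rewrite (le_trans (hE _ t0 t1))// ler_wpM2r// ler_norm.
case: p p1 => [p|_|//].
- rewrite lee_fin => p1 /(Lp01_finP p1 mE) Ei; apply/(Lp01_finP p1 mh).
  have p0 : 0 <= p by exact: le_trans p1.
  apply: (itg_le _ _ (itgZ (`|C| `^ p) Ei)).
    by apply: pos_meas => //; exact: measurable_powR_norm.
  move=> t /andP[t0 t1]; rewrite ger0_norm ?powR_ge0// -powRM//.
  by rewrite ge0_ler_powR ?nnegrE ?mulr_ge0 ?hE.
- move=> /(Lp01_inftyP mE)[M hM]; apply/(Lp01_inftyP mh); exists (`|C| * M).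
  apply: ae_imp hM => x xM /andP[x0 x1].
  by apply: le_trans (hE _ x0 (ltW x1)) _; rewrite ler_wpM2l// xM ?x0 ?x1.
Qed.

Lemma ae_le_oint f G a b : itg f a b -> itg G a b ->
  (forall t, a < t <= b -> 0 <= f t) -> (forall t, a < t <= b -> 0 <= G t) ->
  {ae mu, forall t, a < t <= b -> f t <= G t} -> oint f a b <= oint G a b.
Proof.
move=> fi Gi f0 G0 h; rewrite /oint /Rintegral fine_le//.
- by apply: integrable_fin_num fi.
- by apply: integrable_fin_num Gi.
apply: ae_ge0_le_integral => //.
- by case/integrableP : fi.
- by case/integrableP : Gi.
Qed.

End LpUnitInterval.

(** * Hardy's inequalities through cut levels and integration by parts *)

Section Hardy.
Context {R : realType}.
Local Notation mu := (@lebesgue_measure R).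
Local Notation posR := (`]0, +oo[%classic : set R).
Implicit Types (f h E G : R -> R).

Lemma ae_imp2 (P Q S : R -> Prop) : (forall x, P x -> Q x -> S x) ->
  {ae mu, forall x, P x} -> {ae mu, forall x, Q x} -> {ae mu, forall x, S x}.
Proof.
move=> PQS; apply: filterS2; last exact: PQS.
exact: (ae_filter_ringOfSetsType mu).
Qed.

Lemma ae_neq (a : R) : {ae mu, forall t, t != a}.
Proof.
exists [set a]; split => //; first exact: lebesgue_measure_set1.
by move=> t /=/negP; rewrite negbK => /eqP.
Qed.

(** Above the level [c] one has [y / c > 1], hence [y <= y (y / c) ^ (p - 1)]. The inequality trades
    a first power for a [p]-th power at a level that may depend on the point. *)
Lemma le_cut (p y c : R) : 1 <= p -> 0 <= y -> 0 < c ->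
  y <= c + y `^ p * c `^ (1 - p).
Proof.
move=> p1 y0 c0; have [yc|cy] := leP y c.
  by rewrite (le_trans yc)// lerDl mulr_ge0 ?powR_ge0.
have yp : 0 < y by exact: lt_trans cy.
apply: (@le_trans _ _ (y `^ p * c `^ (1 - p))); last by rewrite lerDr ltW.
have -> : y `^ p = y `^ (p - 1) * y by rewrite -powR_add1// subrK.
rewrite (_ : 1 - p = - (p - 1)); last by ring.
rewrite powRN mulrAC ler_peMl// ler_pdivlMr ?powR_gt0// mul1r.
by rewrite ge0_ler_powR ?nnegrE ?subr_ge0 ?(ltW c0) ?(ltW cy).
Qed.

(* Optimization over the cut level of [le_cut]; this replaces Hoelder's
   inequality below. *)
Lemma cut_optimal (p E a b : R) : 1 <= p -> 0 <= E -> 0 < a -> 0 <= b ->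
  (forall k, 0 < k -> E <= k * a + k `^ (1 - p) * b) ->
  E `^ p <= 2 `^ p * a `^ (p - 1) * b.
Proof.
move=> p1 E0 a0 b0 h; have p0 : 0 < p by exact: lt_le_trans p1.
move: E0; rewrite le_eqVlt => /predU1P[<-|E0].
  by rewrite powR0 ?gt_eqF// !mulr_ge0 ?powR_ge0.
have a20 : 0 < 2 * a by rewrite mulr_gt0.
(* At [k = E / (2 a)] the first term on the right equals [E / 2] and is absorbed on the left. *)
have k0 : 0 < E / (2 * a) by rewrite divr_gt0.
have := h _ k0; rewrite (_ : E / (2 * a) * a = E / 2); last first.
  by field; rewrite gt_eqF.
rewrite (_ : 1 - p = - (p - 1)); last by ring.
rewrite powRN => {}h.
have h1 : E / 2 * (E / (2 * a)) `^ (p - 1) <= b.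
  rewrite -ler_pdivlMr ?powR_gt0// mulrC; lra.
have e0 := powR_gt0 (p - 1) E0; have x0 := powR_gt0 (p - 1) a0.
have y0 := powR_gt0 (p - 1) (ltr0Sn R 1); have ai0 : 0 <= a^-1 by rewrite invr_ge0 ltW.
have Ep s : 0 < s -> s `^ p = s `^ (p - 1) * s.
  by move=> s0; rewrite -powR_add1// subrK.
rewrite !Ep//; move: h1.
have -> : (E / (2 * a)) `^ (p - 1) = E `^ (p - 1) / (2 `^ (p - 1) * a `^ (p - 1)).
  have -> : E `^ (p - 1) = (E / (2 * a)) `^ (p - 1) * (2 `^ (p - 1) * a `^ (p - 1)).
    rewrite -(powRM _ (ler0n R 2) (ltW a0)) -powRM ?(ltW k0) ?(ltW a20)//.
    by rewrite divfK// gt_eqF.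
  by rewrite mulfK// gt_eqF// mulr_gt0.
rewrite mulrA ler_pdivrMr ?mulr_gt0// => h1.
have {}h1 := ler_wpM2l (ltW (ltr0Sn R 1)) h1.
apply: le_trans (_ : _ <= 2 * (b * (2 `^ (p - 1) * a `^ (p - 1)))) _; last first.
  by rewrite le_eqVlt; apply/orP; left; apply/eqP; ring.
apply: le_trans h1; rewrite le_eqVlt; apply/orP; left; apply/eqP.
by field.
Qed.

Lemma powR_prim (s : R) : s != 0 -> prim (fun t => t `^ (s - 1)) (fun t : R => t `^ s / s).
Proof.
move=> s0; apply: derive_prim; last exact: cont_powR.
move=> x x0.
have d := is_deriveM (is_derive1_powR s x0) (is_derive_cst s^-1 x 1).
apply: is_derive_eq d _.
by rewrite scaler0 add0r /GRing.scale/= mulrA mulVf// mul1r.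
Qed.

Lemma powR_int0 (s x : R) : -1 < s -> 0 < x ->
  itg (fun t => t `^ s) 0 x /\ oint (fun t => t `^ s) 0 x <= x `^ (s + 1) / (s + 1).
Proof.
move=> s1 x0; have s0 : 0 < s + 1 by lra.
have pw : prim (fun t => t `^ s) (fun t : R => t `^ (s + 1) / (s + 1)).
  by have := @powR_prim (s + 1) _; rewrite addrK; apply; rewrite gt_eqF.
apply: itg_exhaust => // [|t _ _|d d0 dx].
- exact: cont_measT (@cont_powR R _).
- exact: powR_ge0.
split; first exact: prim_itg pw d0.
by rewrite -(prim_oint pw)// gerBl divr_ge0 ?powR_ge0// ltW.
Qed.

(** Extension by zero beyond [1]: [j] is controlled on []0, 1]] only, whereas [locint] asks for
    integrability on every window. *)
Let cut (j : R -> R) t := if t <= 1 then j t else 0.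

Let cut_itg j a : 0 <= a -> measurable_fun posR j -> itg j a 1 ->
  forall X, itg (cut j) a X.
Proof.
move=> a0 mj ji X; apply: (@itg_cat _ _ a (Num.min 1 (Num.max a X))).
  have h : itg j a (Num.min 1 (Num.max a X)).
    by apply: itgS ji => //; rewrite ge_min lexx.
  by apply: eq_itg h => t; rewrite le_min /cut => /andP[_ /andP[-> _]].
apply: (@eq_itg _ (fun=> 0)); last exact: itg_cst.
move=> t /andP[h1 h2]; rewrite /cut; move: h1; rewrite gt_min => /orP[h|].
  by rewrite leNgt h.
by rewrite gt_max => /andP[_]; rewrite ltNge h2.
Qed.

(** The exchange of integrals is an integration by parts with [Phi' = - psi]. The boundary term at
    [d] is harmless because [Phi] is nonincreasing, so [Phi d] times the integral of [j] over []0,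
    d]] is at most the integral of [Phi j] there. *)
Lemma volterra_tonelli (j psi Phi : R -> R) : measurable_fun posR j ->
  (forall t, 0 < t -> t <= 1 -> 0 <= j t) -> itg j 0 1 ->
  prim (fun t => - psi t) Phi -> cont psi ->
  (forall t, 0 < t -> t <= 1 -> 0 <= psi t) ->
  (forall t, 0 < t -> t <= 1 -> 0 <= Phi t) ->
  itg (fun t => Phi t * j t) 0 1 -> itg (fun x => psi x * oint j 0 x) 0 1.
Proof.
move=> mj j0 ji pPhi cpsi psi0 Phi0 Pi.
have ci := cut_itg (lexx 0) mj ji.
have lc : locint 0 (cut j) by move=> lo hi /window0 ->; exact: ci.
pose J := sint 0 (cut j); have pJ : prim (cut j) J by apply: sint_prim.
have JE x : 0 < x -> x <= 1 -> J x = oint j 0 x.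
  move=> x0 x1; rewrite /J /sint (oint_nil _ (ltW x0)) subr0.
  by apply: eq_oint => t /andP[_ tx]; rewrite /cut (le_trans tx).
have cj0 t : 0 < t -> t <= 1 -> 0 <= cut j t by move=> t0 t1; rewrite /cut t1 j0.
have cPhi := prim_cont pPhi; have cJ := prim_cont pJ.
have Pci : itg (fun t => Phi t * cut j t) 0 1.
  by apply: eq_itg Pi => t /andP[_ t1]; rewrite /cut t1.
have pPJ := prim_mul pPhi pJ.
have J0 x : 0 < x -> x <= 1 -> 0 <= J x.
  move=> x0 x1; rewrite JE//; apply: oint_ge0 => t /andP[t0 tx].
  by apply: j0 => //; exact: le_trans x1.
suff : itg (fun x => psi x * J x) 0 1.
  by apply: eq_itg => t /andP[t0 t1]; rewrite JE.
apply: (itg_exhaust (M := oint (fun t => Phi t * cut j t) 0 1) ltr01 _ _ _).1.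
- by apply: cont_measT; exact: contM.
- by move=> t t0 t1; rewrite mulr_ge0 ?psi0 ?J0.
move=> d d0 d1; have pJi : itg (fun x => psi x * J x) d 1.
  by apply: cont_itg => //; exact: contM.
split=> //.
have := prim_oint pPJ d0 d1.
have Pcd : itg (fun t => Phi t * cut j t) d 1 by apply: itgS Pci => //; exact: ltW.
rewrite ointD//; last first.
  by apply: eq_itg (itgN pJi) => t _; rewrite mulNr.
rewrite (_ : oint (fun t => - psi t * J t) d 1 = - oint (fun t => psi t * J t) d 1); last first.
  by rewrite -mulN1r -ointZ//; apply: eq_oint => t _; rewrite mulN1r mulNr.
rewrite (@oint_split _ _ 0 d 1) ?(ltW d0)//.
have B : Phi d * J d <= oint (fun t => Phi t * cut j t) 0 d.
  rewrite /J /sint (oint_nil _ (ltW d0)) subr0 -ointZ//.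
  apply: le_oint => [||t /andP[t0 td]].
  - exact: itgZ.
  - by apply: itgS Pci.
  have t1 : t <= 1 by exact: le_trans d1.
  rewrite ler_wpM2r ?cj0// -subr_le0 (prim_oint pPhi)//.
  have -> : oint (fun t => - psi t) t d = - oint psi t d.
    by rewrite -mulN1r -ointZ ?cont_itg//; apply: eq_oint => s _; rewrite mulN1r.
  rewrite oppr_le0; apply: oint_ge0 => s /andP[ts sd]; apply: psi0.
    exact: lt_trans ts.
  exact: le_trans d1.
have P1 : 0 <= Phi 1 * J 1 by rewrite mulr_ge0 ?Phi0 ?J0.
by move=> h; lra.
Qed.

(** The same integration by parts for integrals from [x] to [1]: the boundary term at [d] has the
    favourable sign, the one at [1] contributes [Psi 1]. The summand [1] makes room for a constant
    of integration. *)
Lemma dual_tonelli (j psi Psi : R -> R) : measurable_fun posR j ->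
  (forall t, 0 < t -> t <= 1 -> 0 <= j t) -> (forall d, 0 < d -> itg j d 1) ->
  prim psi Psi -> cont psi ->
  (forall t, 0 < t -> t <= 1 -> 0 <= psi t) ->
  (forall t, 0 < t -> t <= 1 -> 0 <= Psi t) ->
  itg (fun t => Psi t * j t) 0 1 ->
  itg (fun x => psi x * (1 + oint j x 1)) 0 1.
Proof.
move=> mj j0 ji pPsi cpsi psi0 Psi0 Pi.
have ci d X : 0 < d -> itg (cut j) d X.
  by move=> d0; apply: cut_itg => //; [exact: ltW|exact: ji].
have lc : locint 1 (cut j).
  move=> lo hi [lo0 _ _ h]; apply: ci; rewrite lt_def lo0 andbT.
  by apply/eqP => /h/eqP; rewrite oner_eq0.
pose J t := 1 - sint 1 (cut j) t.
have pJ : prim (fun t => - cut j t) J.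
  apply: eq_prim (primB (prim_cst 1) (sint_prim ler01 lc)) => // t _.
  by rewrite sub0r.
have JE x : 0 < x -> x <= 1 -> J x = 1 + oint j x 1.
  move=> x0 x1; rewrite /J /sint (oint_nil _ x1) sub0r opprK.
  by congr (_ + _); apply: eq_oint => t /andP[_ tx]; rewrite /cut tx.
have cPsi := prim_cont pPsi; have cJ := prim_cont pJ.
have Pci : itg (fun t => Psi t * cut j t) 0 1.
  by apply: eq_itg Pi => t /andP[_ t1]; rewrite /cut t1.
have pPJ := prim_mul pPsi pJ.
have J0 x : 0 < x -> x <= 1 -> 0 <= J x.
  move=> x0 x1; rewrite JE// addr_ge0//; apply: oint_ge0 => t /andP[xt t1].
  by apply: j0 => //; exact: lt_trans xt.
have J1 : J 1 = 1 by rewrite JE// oint_nil// addr0.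
suff : itg (fun x => psi x * J x) 0 1.
  by apply: eq_itg => t /andP[t0 t1]; rewrite JE.
apply: (itg_exhaust (M := Psi 1 + oint (fun t => Psi t * cut j t) 0 1) ltr01 _ _ _).1.
- by apply: cont_measT; exact: contM.
- by move=> t t0 t1; rewrite mulr_ge0 ?psi0 ?J0.
move=> d d0 d1; have pJi : itg (fun x => psi x * J x) d 1.
  by apply: cont_itg => //; exact: contM.
split=> //.
have := prim_oint pPJ d0 d1.
have Pcd : itg (fun t => Psi t * cut j t) d 1 by apply: itgS Pci => //; exact: ltW.
rewrite ointD//; last first.
  by apply: eq_itg (itgN Pcd) => t _; rewrite mulrN.
rewrite (_ : oint (fun t => Psi t * - cut j t) d 1 = - oint (fun t => Psi t * cut j t) d 1); last first.
  by rewrite -mulN1r -ointZ//; apply: eq_oint => t _; rewrite mulN1r mulrN.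
have B : oint (fun t => Psi t * cut j t) d 1 <= oint (fun t => Psi t * cut j t) 0 1.
  apply: le_oint_itv => //; first exact: ltW.
  by move=> t /andP[t0 t1]; rewrite mulr_ge0 ?Psi0// /cut t1 j0.
have P1 : 0 <= Psi d * J d by rewrite mulr_ge0 ?Psi0 ?J0.
by rewrite J1 mulr1 => h; lra.
Qed.

Section WithWeight.
Variable (G : R -> R).
Hypotheses (mG : measurable_fun posR G) (G0 : forall t, 0 <= G t).

Lemma itg_pow_mul (s X : R) f : 0 <= s -> measurable_fun posR f ->
  itg f 0 X -> itg (fun t => t `^ s * f t) 0 X.
Proof.
move=> s0 mf fi; apply: (itg_le _ _ (itgZ (X `^ s) (itg_norm fi))).
  by apply: pos_meas => //; apply: measurable_funM => //; exact: cont_measT (@cont_powR R _).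
move=> t /andP[t0 tX]; rewrite normrM ger0_norm ?powR_ge0//.
rewrite ler_wpM2r// ge0_ler_powR// nnegrE ltW//; exact: lt_le_trans tX.
Qed.

(** For finite [p] the integral is cut at the level [k t ^ (-1/2)] and [k] is optimized at each [x];
    what remains is a bound of first order in [G ^ p], settled by [volterra_tonelli]. For [p = +oo]
    the power [t ^ b] is integrated directly. *)
Lemma hardy0 (b : R) (p : \bar R) : 0 <= b -> (1 <= p)%E ->
  (forall X, itg G 0 X) -> Lp01 p G ->
  (b = 0 -> p = 1%:E -> itg (fun t => - ln t * G t) 0 1) ->
  Lp01 p (fun x => x `^ (- b - 1) * oint (fun t => t `^ b * G t) 0 x).
Proof.
move=> b0 p1 Gi Gp Gln; pose E x := x `^ (- b - 1) * oint (fun t => t `^ b * G t) 0 x.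
have bGi X : itg (fun t => t `^ b * G t) 0 X by apply: itg_pow_mul.
have mE : measurable_fun posR E.
  have lb : locint 0 (fun t => t `^ b * G t) by move=> lo hi /window0 ->.
  apply: cont_measT; apply: (@cont_eq R (fun x => x `^ (- b - 1) * sint 0 (fun t => t `^ b * G t) x)).
    by move=> x x0; rewrite /sint (oint_nil _ (ltW x0)) subr0.
  by apply: contM; [exact: cont_powR|exact: prim_cont (sint_prim (lexx _) lb)].
have E0 x : 0 <= E x.
  by rewrite mulr_ge0 ?powR_ge0//; apply: oint_ge0 => t _; rewrite mulr_ge0 ?powR_ge0.
case: p p1 Gp Gln => [p|_ Gp _|//]; last first.
  apply/(Lp01_inftyP mE); have [M hM] := (Lp01_inftyP mG).1 Gp.
  have M'0 : 0 <= Num.max M 0 by rewrite le_max lexx orbT.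
  exists (Num.max M 0 / (b + 1)); apply: nearW => x /andP[x0 x1].
  rewrite ger0_norm//; have b1 : -1 < b by lra.
  have [pi pe] := powR_int0 b1 x0.
  have : oint (fun t => t `^ b * G t) 0 x <= oint (fun t => Num.max M 0 * t `^ b) 0 x.
    apply: ae_le_oint => //.
    - exact: itgZ.
    - by move=> t _; rewrite mulr_ge0 ?powR_ge0.
    - by move=> t _; rewrite mulr_ge0 ?powR_ge0.
    apply: ae_imp hM => t ht /andP[t0 tx].
    rewrite mulrC ler_wpM2r ?powR_ge0// le_max; apply/orP; left.
    by apply: le_trans (ler_norm _) (ht _); rewrite t0 (le_lt_trans tx).
  rewrite ointZ// => h; apply: le_trans (ler_wpM2l (powR_ge0 _ _) h) _.
  apply: le_trans (ler_wpM2l (powR_ge0 _ _) (ler_wpM2l M'0 pe)) _.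
  rewrite [X in X <= _](_ : _ = Num.max M 0 / (b + 1) * (x `^ (- b - 1) * x `^ (b + 1))); last by ring.
  by rewrite -powR_add// (_ : - b - 1 + (b + 1) = 0) ?powRr0 ?mulr1//; ring.
rewrite lee_fin => p1 Gp Gln; have p0 : 0 < p by exact: lt_le_trans p1.
apply/(Lp01_finP p1 mE).
have Gpi := (Lp01_finP p1 mG).1 Gp.
(* In the exceptional case the exponent [m] below would be [0], and the primitive [t ^ (- m) / m] is
   replaced by [- ln t]: this is where the logarithmic integrability is consumed. *)
have [[bz pE]|bp] : (b = 0 /\ p = 1) \/ 0 < b + (p - 1) / 2.
  have [bz|bz] := eqVneq b 0; last by right; have : 0 < b by [rewrite lt_def bz]; lra.
  have [pz|pz] := eqVneq p 1; first by left.
  by right; have : 1 < p by [rewrite lt_def pz]; lra.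
  have Gl := Gln bz (congr1 EFin pE).
  apply: (@eq_itg _ (fun x => x^-1 * oint G 0 x)).
    move=> x /andP[x0 x1]; rewrite pE powRr1// ger0_norm// /E bz oppr0 sub0r.
    by rewrite powR_inv1 ?(ltW x0)//; congr (_ * _); apply: eq_oint => t _; rewrite powRr0 mul1r.
  apply: (volterra_tonelli (Phi := fun t => - ln t)) => //.
  - apply: derive_prim => [x x0|]; first by apply: is_deriveN; exact: is_derive1_ln.
    by apply/contN/cont_inv => [|x x0]; [exact: cont_id|rewrite gt_eqF].
  - by apply: cont_inv => [|x x0]; [exact: cont_id|rewrite gt_eqF].
  - by move=> t t0 _; rewrite invr_ge0 ltW.
  - by move=> t t0 t1; rewrite oppr_ge0; exact: ln_le0.
(* The exponent of [t ^ b] times the level [t ^ (-1/2)] raised to [1 - p]. Any level exponent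
   strictly between [-1] and [0] would serve: above [-1] for integrability at [0] even if [b = 0],
   below [0] for [m > 0]. *)
pose m := b + (p - 1) / 2; have m0 : 0 < m by [].
pose j t := t `^ m * G t `^ p.
have mGp : measurable_fun posR (fun t => G t `^ p).
  apply: (@measurableT_comp _ _ _ _ _ _ (@powR R ^~ p)) => //.
have Gpi' : itg (fun t => G t `^ p) 0 1 by apply: eq_itg Gpi => t _; rewrite ger0_norm.
have ji : itg j 0 1 by apply: itg_pow_mul => //; exact: ltW.
have j0 t : 0 <= j t by rewrite mulr_ge0 ?powR_ge0.
have mj : measurable_fun posR j.
  by apply: measurable_funM => //; exact: cont_measT (@cont_powR R _).
have J : itg (fun x => x `^ (- m - 1) * oint j 0 x) 0 1.
  apply: (volterra_tonelli (Phi := fun t => t `^ (- m) / m)) => //.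
  - have := @powR_prim (- m) _; rewrite oppr_eq0 gt_eqF// => /(_ isT).
    move=> /primN; apply: eq_prim => t _ //.
    by rewrite invrN mulrN opprK.
  - exact: cont_powR.
  - by move=> t _ _; exact: powR_ge0.
  - by move=> t _ _; rewrite divr_ge0 ?powR_ge0// ltW.
  - apply: eq_itg (itgZ m^-1 Gpi') => t /andP[t0 _]; rewrite /j powRN.
    by field; rewrite !gt_eqF ?powR_gt0.
pose c := (b + 2^-1)^-1; have b20 : 0 < b + 2^-1 by lra.
have c0 : 0 < c by rewrite invr_gt0.
apply: (itg_le _ _ (itgZ (2 `^ p * c `^ (p - 1)) J)).
  by apply: pos_meas => //; exact: measurable_powR_norm.
move=> x /andP[x0 x1]; rewrite !ger0_norm ?powR_ge0//.
have xji : itg j 0 x by exact: itgS ji.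
have J0 : 0 <= oint j 0 x by apply: oint_ge0.
have opt : forall k, 0 < k -> E x <= k * (c * x `^ (- 2^-1)) +
    k `^ (1 - p) * (x `^ (- b - 1) * oint j 0 x).
  move=> k k0.
  have s1 : -1 < b - 2^-1 by lra.
  have [pi pe] := powR_int0 s1 x0.
  have : oint (fun t => t `^ b * G t) 0 x <=
      oint (fun t => k * t `^ (b - 2^-1) + k `^ (1 - p) * j t) 0 x.
    apply: le_oint => //; first by apply: itgD; exact: itgZ.
    move=> t /andP[t0 tx].
    have kt : 0 < k * t `^ (- 2^-1) by rewrite mulr_gt0// powR_gt0.
    have := ler_wpM2l (powR_ge0 t b) (le_cut p1 (G0 t) kt) => /le_trans; apply.
    rewrite powRM ?powR_ge0 ?(ltW k0)// -powRrM mulrDr /j.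
    have -> : t `^ (b - 2^-1) = t `^ b * t `^ (- 2^-1) by rewrite powR_add.
    have -> : t `^ m = t `^ b * t `^ (- 2^-1 * (1 - p)).
      by rewrite -powR_add//; congr (_ `^ _); rewrite /m; field.
    by rewrite le_eqVlt; apply/orP; left; apply/eqP; ring.
  rewrite ointD ?ointZ//; try exact: itgZ.
  move=> h; apply: le_trans (ler_wpM2l (powR_ge0 x (- b - 1)) h) _.
  rewrite mulrDr; apply: lerD; last first.
    by rewrite le_eqVlt; apply/orP; left; apply/eqP; ring.
  apply: le_trans (ler_wpM2l (powR_ge0 _ _) (ler_wpM2l (ltW k0) pe)) _.
  have -> : x `^ (- 2^-1) = x `^ (- b - 1) * x `^ (b - 2^-1 + 1).
    by rewrite -powR_add//; congr (_ `^ _); field.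
  have -> : b - 2^-1 + 1 = b + 2^-1 by field.
  by rewrite /c le_eqVlt; apply/orP; left; apply/eqP; ring.
have a0 : 0 < c * x `^ (- 2^-1) by rewrite mulr_gt0// powR_gt0.
have bb0 : 0 <= x `^ (- b - 1) * oint j 0 x by rewrite mulr_ge0 ?powR_ge0.
apply: le_trans (cut_optimal p1 (E0 x) a0 bb0 opt) _.
rewrite powRM ?powR_ge0 ?(ltW c0)// -powRrM.
have -> : x `^ (- m - 1) = x `^ (- 2^-1 * (p - 1)) * x `^ (- b - 1).
  by rewrite -powR_add//; congr (_ `^ _); rewrite /m; field.
by rewrite le_eqVlt; apply/orP; left; apply/eqP; ring.
Qed.

(** The conditions on [p] and [g] make [x ^ (g - 1)], the contribution of the constant [1], belong
    to [L^p]. With [g = 2 l + 1] they become [- 2 l r < 1] for a finite exponent [r], the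
    restriction on [r] in the theorem. For [p = +oo] the value [g = 1] is excluded, since the
    integral may then grow logarithmically. *)
Lemma hardy1 (g : R) (p : \bar R) : 0 < g -> (1 <= p)%E ->
  (forall X, itg G 0 X) -> Lp01 p G ->
  (forall r, p = r%:E -> r * (1 - g) < 1) -> (p = +oo%E -> 1 < g) ->
  Lp01 p (fun x => x `^ (g - 1) * (1 - sint 1 (fun t => t `^ (- g) * G t) x)).
Proof.
move=> g0 p1 Gi Gp pg pgy.
pose E x := x `^ (g - 1) * (1 - sint 1 (fun t => t `^ (- g) * G t) x).
have cpow (s : R) : cont (fun x : R => x `^ s) by exact: cont_powR.
have Gii y x : 0 < y -> itg G y x by move=> y0; apply: itgS (Gi x) => //; exact: ltW.
have gGi y x : 0 < y -> itg (fun t => t `^ (- g) * G t) y x.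
  move=> y0; apply: (@eq_itg _ (fun t => G t * t `^ (- g))) => [t _|]; first by rewrite mulrC.
  by apply: itgM_cont => //; exact: Gii.
have l1 : locint 1 (fun t => t `^ (- g) * G t).
  move=> lo hi [lo0 _ _ h]; apply: gGi; rewrite lt_def lo0 andbT.
  by apply/eqP => /h/eqP; rewrite oner_eq0.
have mE : measurable_fun posR E.
  apply: cont_measT; apply: contM => //; apply: contB; first exact: cont_cst.
  exact: prim_cont (sint_prim ler01 l1).
have EE x : x <= 1 -> E x = x `^ (g - 1) * (1 + oint (fun t => t `^ (- g) * G t) x 1).
  by move=> x1; rewrite /E /sint (oint_nil _ x1) sub0r opprK.
have E0 x : x <= 1 -> 0 <= E x.
  move=> x1; rewrite EE// mulr_ge0 ?powR_ge0// addr_ge0//.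
  by apply: oint_ge0 => t _; rewrite mulr_ge0 ?powR_ge0.
case: p p1 Gp pg pgy => [p|_ Gp _ pgy|//]; last first.
  have g1 := pgy erefl.
  apply/(Lp01_inftyP mE); have [M hM] := (Lp01_inftyP mG).1 Gp.
  have M'0 : 0 <= Num.max M 0 by rewrite le_max lexx orbT.
  exists (1 + Num.max M 0 / (g - 1)); apply: nearW => x /andP[x0 x1].
  rewrite ger0_norm ?E0 ?EE ?(ltW x1)//.
  have pw := @powR_prim (1 - g) _; have {pw}pw := pw (ltac:(by rewrite lt_eqF// subr_lt0)).
  have pi : itg (fun t => t `^ (- g)) x 1 by apply: cont_itg.
  have : oint (fun t => t `^ (- g) * G t) x 1 <= oint (fun t => Num.max M 0 * t `^ (- g)) x 1.
    apply: ae_le_oint; [exact: gGi|exact: itgZ| | |].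
    - by move=> t _; rewrite mulr_ge0 ?powR_ge0.
    - by move=> t _; rewrite mulr_ge0 ?powR_ge0.
    apply: ae_imp2 (ae_neq 1) hM => t t1 ht /andP[xt tx].
    rewrite mulrC ler_wpM2r ?powR_ge0// le_max; apply/orP; left.
    apply: le_trans (ler_norm _) (ht _); rewrite (lt_trans x0 xt)/=.
    by rewrite lt_def eq_sym t1.
  rewrite ointZ// => h.
  have pe : oint (fun t => t `^ (- g)) x 1 <= x `^ (1 - g) / (g - 1).
    have pE : (fun t : R => t `^ (1 - g - 1)) = (fun t => t `^ (- g)).
      by apply/funext => t; congr (_ `^ _); ring.
    rewrite pE in pw; rewrite -(prim_oint pw x0 (ltW x1)) /= powR1.
    rewrite (_ : (1 - g)^-1 = - (g - 1)^-1); last first.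
      by rewrite -invrN; congr (_^-1); ring.
    have : 0 <= (g - 1)^-1 by rewrite invr_ge0; lra.
    lra.
  have {}h := le_trans h (ler_wpM2l M'0 pe).
  rewrite mulrDr mulr1; apply: lerD.
    apply: (@le_trans _ _ (1 `^ (g - 1))); last by rewrite powR1.
    by rewrite ge0_ler_powR ?nnegrE ?subr_ge0 ?(ltW g1) ?(ltW x0) ?(ltW x1).
  apply: le_trans (ler_wpM2l (powR_ge0 _ _) h) _.
  rewrite [X in X <= _](_ : _ = Num.max M 0 / (g - 1) * (x `^ (g - 1) * x `^ (1 - g))); last by ring.
  by rewrite -powR_add// (_ : g - 1 + (1 - g) = 0) ?powRr0 ?mulr1//; ring.
rewrite lee_fin => p1 Gp pg _; have p0 : 0 < p by exact: lt_le_trans p1.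
apply/(Lp01_finP p1 mE).
have Gpi := (Lp01_finP p1 mG).1 Gp; have {}pg := pg p erefl.
(* [d] is the slack in the hypothesis. Half of it moves the level exponent [s] just above [1 - g],
   so that [t ^ (- g - s)] integrates to [O(x ^ (1 - g - s))]; the rest keeps
   [m = d (1 - (p - 1) / (2 p))] positive. *)
pose d := 1 - p * (1 - g); have d0 : 0 < d by rewrite /d; lra.
pose s := 1 - g + d / (2 * p).
have dp : d / (2 * p) * p = d / 2 by field; rewrite gt_eqF.
have dp0 : 0 < d / (2 * p) by rewrite divr_gt0// mulr_gt0.
have s1 : 0 < g + s - 1 by rewrite /s; lra.
pose m := g - s * (p - 1).
have m0 : 0 < m by rewrite /m /s; move: dp dp0; set e := d / (2 * p); rewrite /d; nra.
pose j t := t `^ (- m) * G t `^ p.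
have mGp : measurable_fun posR (fun t => G t `^ p).
  by apply: (@measurableT_comp _ _ _ _ _ _ (@powR R ^~ p)).
have Gpi' : itg (fun t => G t `^ p) 0 1 by apply: eq_itg Gpi => t _; rewrite ger0_norm.
have ji y x : 0 < y -> x <= 1 -> itg j y x.
  move=> y0 x1; apply: (@eq_itg _ (fun t => G t `^ p * t `^ (- m))) => [t _|].
    by rewrite mulrC.
  by apply: itgM_cont => //; apply: itgS Gpi' => //; exact: ltW.
have j0 t : 0 <= j t by rewrite mulr_ge0 ?powR_ge0.
have mj : measurable_fun posR j.
  by apply: measurable_funM => //; exact: cont_measT.
have J : itg (fun x => x `^ (m - 1) * (1 + oint j x 1)) 0 1.
  apply: (dual_tonelli (Psi := fun t => t `^ m / m)) => //.
  - by move=> e e0; exact: ji.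
  - by apply: powR_prim; rewrite gt_eqF.
  - by move=> t _ _; exact: powR_ge0.
  - by move=> t _ _; rewrite divr_ge0 ?powR_ge0// ltW.
  - apply: eq_itg (itgZ m^-1 Gpi') => t /andP[t0 _]; rewrite /j powRN.
    by field; rewrite !gt_eqF ?powR_gt0.
(* The inverse comes from the integral of [t ^ (- g - s)], the [1] from cutting the constant term
   [x ^ (g - 1)] at the same level. *)
pose c := (g + s - 1)^-1 + 1.
have c0 : 0 < c by rewrite /c addr_gt0// invr_gt0.
apply: (itg_le _ _ (itgZ (2 `^ p * c `^ (p - 1)) J)).
  by apply: pos_meas => //; exact: measurable_powR_norm.
move=> x /andP[x0 x1]; rewrite !ger0_norm ?powR_ge0 ?E0//.
have J0 : 0 <= oint j x 1 by apply: oint_ge0.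
have opt : forall k, 0 < k -> E x <= k * (c * x `^ (- s)) +
    k `^ (1 - p) * (x `^ (g - 1) * (1 + oint j x 1)).
  move=> k k0; rewrite EE//.
  have gs : 1 - g - s != 0 by rewrite lt_eqF//; lra.
  have pw := powR_prim gs.
  have pE : (fun t : R => t `^ (1 - g - s - 1)) = (fun t => t `^ (- g - s)).
    by apply/funext => t; congr (_ `^ _); ring.
  rewrite pE in pw.
  have pi : itg (fun t => t `^ (- g - s)) x 1 by exact: prim_itg pw x0.
  have pe : oint (fun t => t `^ (- g - s)) x 1 <= x `^ (1 - g - s) / (g + s - 1).
    rewrite -(prim_oint pw)// powR1.
    rewrite (_ : (1 - g - s)^-1 = - (g + s - 1)^-1); last first.
      by rewrite -invrN; congr (_^-1); ring.
    have : 0 <= (g + s - 1)^-1 by rewrite invr_ge0 ltW.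
    lra.
  have B1 : oint (fun t => t `^ (- g) * G t) x 1 <=
      oint (fun t => k * t `^ (- g - s) + k `^ (1 - p) * j t) x 1.
    apply: le_oint; [exact: gGi|by apply: itgD; apply: itgZ => //; exact: ji|].
    move=> t /andP[xt t1]; have t0 : 0 < t by exact: lt_trans xt.
    have kt : 0 < k * t `^ (- s) by rewrite mulr_gt0// powR_gt0.
    have := ler_wpM2l (powR_ge0 t (- g)) (le_cut p1 (G0 t) kt) => /le_trans; apply.
    rewrite powRM ?powR_ge0 ?(ltW k0)// -powRrM mulrDr /j.
    have -> : t `^ (- g - s) = t `^ (- g) * t `^ (- s) by rewrite powR_add.
    have -> : t `^ (- m) = t `^ (- g) * t `^ (- s * (1 - p)).
      by rewrite -powR_add//; congr (_ `^ _); rewrite /m; ring.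
    by rewrite le_eqVlt; apply/orP; left; apply/eqP; ring.
  move: B1; rewrite ointD ?ointZ//; try (by apply: itgZ => //; exact: ji); last exact: ji.
  move=> B1.
  have B2 : x `^ (g - 1) <= k * x `^ (- s) + k `^ (1 - p) * x `^ (g - 1).
    have kx : 0 < k * x `^ (- s) by rewrite mulr_gt0// powR_gt0.
    apply: le_trans (le_cut p1 (powR_ge0 _ _) kx) _; rewrite lerD2l.
    rewrite powRM ?powR_ge0 ?(ltW k0)// -!powRrM mulrCA ler_wpM2l ?powR_ge0//.
    rewrite -powR_add//.
    have -> : x `^ (g - 1) = 1 * x `^ (g - 1) by rewrite mul1r.
    have -> : (g - 1) * p + - s * (1 - p) = (g + s - 1) * (p - 1) + (g - 1) by ring.
    rewrite (powR_add ((g + s - 1) * (p - 1)) (g - 1) x0) ler_wpM2r ?powR_ge0//.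
    apply: (@le_trans _ _ (1 `^ ((g + s - 1) * (p - 1)))); last by rewrite powR1.
    have gsp : 0 <= (g + s - 1) * (p - 1) by apply: mulr_ge0; lra.
    by rewrite ge0_ler_powR ?nnegrE ?(ltW x0).
  have B3 := le_trans B1 (lerD (ler_wpM2l (ltW k0) pe) (lexx _)).
  rewrite mulrDr mulr1.
  apply: le_trans (lerD B2 (ler_wpM2l (powR_ge0 x (g - 1)) B3)) _.
  have -> : x `^ (- s) = x `^ (g - 1) * x `^ (1 - g - s).
    by rewrite -powR_add//; congr (_ `^ _); ring.
  by rewrite /c le_eqVlt; apply/orP; left; apply/eqP; ring.
have a0 : 0 < c * x `^ (- s) by rewrite mulr_gt0// powR_gt0.
have bb0 : 0 <= x `^ (g - 1) * (1 + oint j x 1) by rewrite mulr_ge0 ?powR_ge0// addr_ge0.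
apply: le_trans (cut_optimal p1 (E0 x x1) a0 bb0 opt) _.
rewrite powRM ?powR_ge0 ?(ltW c0)// -powRrM.
have -> : x `^ (m - 1) = x `^ (- s * (p - 1)) * x `^ (g - 1).
  by rewrite -powR_add//; congr (_ `^ _); rewrite /m; ring.
by rewrite le_eqVlt; apply/orP; left; apply/eqP; ring.
Qed.

End WithWeight.
End Hardy.

(** * Derivatives of the quotients by free solutions *)

Section Regularity.
Context {R : realType}.
Local Notation mu := (@lebesgue_measure R).
Local Notation posR := (`]0, +oo[%classic : set R).
Variables (l : R) (q : R -> R).
Hypothesis hl : - 2^-1 <= l.
Hypothesis mq : measurable_fun posR q.
Hypothesis hq : forall X, itg (fun t => fA l t * fB l t * q t) 0 X.

(** After multiplication by [t <= 1], the summand [1] majorizes the contribution of the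
    inhomogeneity [v], that is, of the spectral parameter. *)
Definition Gw t : R := `|t * q t| + 1.

Lemma Gw_ge0 t : 0 <= Gw t. Proof. by rewrite addr_ge0. Qed.

Lemma measurable_idM (f : R -> R) : measurable_fun posR f ->
  measurable_fun posR (fun t => t * f t).
Proof. by move=> mf; apply: measurable_funM => //; exact: measurable_id. Qed.

Lemma Gw_meas : measurable_fun posR Gw.
Proof.
apply: measurable_funD; last exact: measurable_cst.
by apply: measurableT_comp => //; exact: measurable_idM.
Qed.

Lemma tq_itg X : itg (fun t => t * q t) 0 X.
Proof.
apply: (itg_le _ _ (itg_norm (hq X))); first by apply: pos_meas => //; exact: measurable_idM.
move=> t /andP[t0 _]; rewrite fAB// !normrM ler_wpM2r// ler_peMr//.
by rewrite ger0_norm ?lw_ge1// ltW// lw_gt0.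
Qed.

Lemma Gw_itg X : itg Gw 0 X.
Proof. by apply: itgD; [exact: itg_norm (tq_itg X)|exact: itg_cst]. Qed.

(** [D] is the Wronskian of the free solution [F] and [u]: it equals [F ^+ 2] times the derivative
    of [u / F], and the singular part [V0] of the potential cancels in its own derivative. The
    inhomogeneity [v] stands for the real or imaginary part of [z U]. *)
Lemma ratio_derive (F F1 u u1 v : R -> R) :
  (forall x, 0 < x -> 0 < F x) -> prim F1 F -> prim (fun t => V0 l t * F t) F1 ->
  prim u1 u -> prim (fun t => pot l q t * u t + (-1) * v t) u1 ->
  let D t := F t * u1 t - F1 t * u t in
  prim (fun t => F t * (q t * u t - v t)) D /\
  prim (fun t => D t / F t ^+ 2) (fun t => u t / F t).
Proof.
move=> F0 pF pF1 pu pu1 D; split.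
  apply: eq_prim (primB (prim_mul pF pu1) (prim_mul pF1 pu)) => t t0 //.
  by rewrite /pot; ring.
have cF := prim_cont pF; have cF1 := prim_cont pF1.
have cu := prim_cont pu; have cu1 := prim_cont pu1.
apply: derive_prim => [x x0|].
  have Fx := F0 x x0.
  apply: is_derive_eq (is_derive_div _ (prim_derive pu x0 (cu1 x x0))
    (prim_derive pF x0 (cF1 x x0))) _; first by rewrite gt_eqF.
  by rewrite /D; congr (_ / _); ring.
apply: contM; first by apply: contB; exact: contM.
apply: cont_inv; first exact: (contM cF cF).
by move=> x x0; rewrite expf_neq0// gt_eqF// F0.
Qed.

Section RegularRatio.
Variables (u u1 v : R -> R) (C : R).
Hypotheses (pu : prim u1 u) (pu1 : prim (fun t => pot l q t * u t + (-1) * v t) u1)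
  (cv : cont v).
Hypotheses (ub : forall t, 0 < t -> t <= 1 -> `|u t| <= C * fA l t)
  (vb : forall t, 0 < t -> t <= 1 -> `|v t| <= C * fA l t).

Let D t := fA l t * u1 t - fA1 l t * u t.
Let f t := fA l t * (q t * u t - v t).

Let pD : prim f D /\ prim (fun t => D t / fA l t ^+ 2) (fun t => u t / fA l t).
Proof.
exact: (ratio_derive (fA_gt0 l) (@prim_fA R l) (@prim_fA1 R l) pu pu1).
Qed.

Let cu : cont u := prim_cont pu.

Let C0 : 0 <= C.
Proof.
have := ub ltr01 (lexx _); have := fA_gt0 l (ltr01 (R := R)) => A0 h.
by have := le_trans (normr_ge0 _) h; rewrite pmulr_lge0.
Qed.

Let fle t : 0 < t -> t <= 1 -> `|f t| <= C * (t `^ (2 * l + 1) * Gw t).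
Proof.
move=> t0 t1; have A0 := fA_gt0 l t0.
have h : `|q t * u t - v t| <= C * fA l t * (`|q t| + 1).
  apply: le_trans (ler_normB _ _) _; rewrite normrM mulrDr mulr1 lerD ?vb//.
  by rewrite mulrC ler_wpM2r// ub.
rewrite /f normrM (gtr0_norm A0).
apply: le_trans (ler_wpM2l (ltW A0) h) _.
have -> : t `^ (2 * l + 1) = fA l t * t `^ l.
  by rewrite /fA -powR_add//; congr (_ `^ _); ring.
have AE : fA l t = t `^ l * t by rewrite /fA powR_add1.
have tl := powR_gt0 l t0.
rewrite [X in X <= _](_ : _ = C * fA l t * (fA l t * (`|q t| + 1))); last by ring.
rewrite [X in _ <= X](_ : _ = C * fA l t * (t `^ l * Gw t)); last by ring.
rewrite ler_wpM2l ?mulr_ge0 ?(ltW A0)// {1}AE -mulrA ler_wpM2l ?(ltW tl)//.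
by rewrite /Gw normrM (gtr0_norm t0) mulrDr mulr1 lerD2l.
Qed.

Let bGi X : itg (fun t => t `^ (2 * l + 1) * Gw t) 0 X.
Proof. by apply: itg_pow_mul; [have := hl; lra|exact: Gw_meas|exact: Gw_itg]. Qed.

Let fm : measurable_fun posR f.
Proof.
apply: measurable_funM; first exact: cont_measT (@cont_fA R l).
apply: measurable_funB; last exact: cont_measT.
by apply: measurable_funM => //; exact: cont_measT.
Qed.

Let fi X : itg f 0 X.
Proof.
apply: (@itg_cat _ _ 0 1); last by exact: prim_itg pD.1 ltr01.
apply: (itg_le _ _ (itgZ C (bGi 1))); first exact: pos_meas.
by move=> t /andP[t0 t1]; exact: fle.
Qed.

Let lf : locint 0 f. Proof. by move=> lo hi /window0 ->. Qed.

(* the constant of integration vanishes because [u / fA] stays bounded whereas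
   [fb / fA], whose derivative is [- 1 / fA ^+ 2], does not *)
Lemma regular_flux x : 0 < x -> x <= 1 -> D x = oint f 0 x.
Proof.
pose S := sint 0 f; have pS : prim f S by apply: sint_prim.
pose K := D 1 - S 1.
have DE t : 0 < t -> D t = K + S t.
  move=> t0; have pDS : prim (fun=> 0) (fun t => D t - S t).
    by apply: eq_prim (primB pD.1 pS) => // r _; rewrite subrr.
  by rewrite /K -(prim0_cst pDS t0 ltr01); ring.
suff K0 : K = 0.
  by move=> x0 x1; rewrite DE// K0 add0r /S /sint (oint_nil _ (ltW x0)) subr0.
apply/eqP/negP => /negP K0; pose k := `|K| / 2.
have k0 : 0 < k by rewrite divr_gt0// normr_gt0.
have [d d0 hd] := oint_small (fi 1) k0.
pose e := Num.min (d / 2) 1.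
have e0 : 0 < e by rewrite lt_min ltr01 andbT; lra.
have e1 : e <= 1 by rewrite ge_min lexx orbT.
have ed : e <= d / 2 by rewrite ge_min lexx.
have [s [sK s1]] : exists s : R, s * K = `|K| /\ `|s| = 1.
  have [K1|K1] := leP 0 K; first by exists 1; rewrite mul1r ger0_norm// normr1.
  by exists (-1); rewrite mulN1r ltr0_norm// normrN normr1.
pose H t := fb l t / fA l t; pose w t := u t / fA l t.
have wb t : 0 < t -> t <= 1 -> `|s * w t| <= C.
  move=> t0 t1; have A0 := fA_gt0 l t0.
  by rewrite normrM s1 mul1r normrM normfV (gtr0_norm A0) ler_pdivrMr// ub.
have [d' [d'0 d'2 hd']] := fb_fA_large hl ((2 * C + k * `|H e|) / k + 1).
pose y := Num.min e d'.
have y0 : 0 < y by rewrite lt_min e0.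
have ye : y <= e by rewrite ge_min lexx.
have yd : y <= d' by rewrite ge_min lexx orbT.
have [_ Hy] := hd' y y0 yd.
have y1 : y <= 1 by exact: le_trans e1.
have dw (t : R) : 0 < t -> is_derive t 1 w (D t / fA l t ^+ 2).
  move=> t0; apply: (prim_derive pD.2) => //.
  apply: contM => //; first exact: prim_cont pD.1.
  apply: cont_inv; first exact: (contM (@cont_fA R l) (@cont_fA R l)).
  by move=> r r0; rewrite expf_neq0// gt_eqF// fA_gt0.
have dH (t : R) : 0 < t -> is_derive t 1 H (- (fA l t ^+ 2)^-1).
  move=> t0; have A0 := fA_gt0 l t0.
  apply: is_derive_eq (is_derive_div _ (prim_derive (prim_fb hl) t0
    (prim_cont (prim_fb1 hl) t0)) (prim_derive (@prim_fA R l) t0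
    (prim_cont (@prim_fA1 R l) t0))) _; first by rewrite gt_eqF.
  by rewrite -(opprB (fb l t * fA1 l t)) (wronskian_free hl)// mulN1r.
(* [s] is the sign of [K]. As [s * D >= k] near [0], [Fn] is nonincreasing on []0, e]]; comparing
   [y] with [e] gives [k H y <= 2 C + k H e], against the choice of [y]. *)
pose Fn t := (- s) * w t + (- k) * H t.
pose dFn t := (- s) * (D t / fA l t ^+ 2) + (- k) * (- (fA l t ^+ 2)^-1).
have : Fn e <= Fn y.
  apply: (@le_derive _ Fn dFn _ _ ye) => t /andP[yt te].
    have t0 : 0 < t by exact: lt_le_trans yt.
    exact: is_deriveD (is_deriveZ (- s) (dw t t0)) (is_deriveZ (- k) (dH t t0)).
  have t0 : 0 < t by exact: lt_le_trans yt.
  have A20 : 0 < fA l t ^+ 2 by rewrite exprn_gt0// fA_gt0.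
  rewrite /dFn (_ : _ + _ = (k - s * D t) / fA l t ^+ 2); last by ring.
  rewrite pmulr_lle0 ?invr_gt0// subr_le0 DE// mulrDr sK.
  have : `|S t| <= k.
    rewrite /S /sint (oint_nil _ (ltW t0)) subr0.
    have t1 : t <= 1 by exact: le_trans e1.
    apply: le_trans (le_norm_oint (fi t) (itg_norm (fi t)) _) _ => //.
    by apply/ltW/hd => //; [exact: ltW|lra].
  have : - `|S t| <= s * S t.
    by rewrite -[`|S t|]mul1r -s1 -normrM; have := ler_norm (- (s * S t)); rewrite normrN; lra.
  have K2 : `|K| = 2 * k by rewrite /k; field.
  by lra.
rewrite /Fn; have := wb e e0 e1; have := wb y y0 y1; rewrite !ler_norml.
move=> /andP[? ?] /andP[? ?] h.
have h2 : k * H y <= 2 * C + k * `|H e|.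
  by have := ler_wpM2l (ltW k0) (ler_norm (H e)); lra.
have : k * ((2 * C + k * `|H e|) / k + 1) <= k * H y by rewrite ler_pM2l.
have -> : k * ((2 * C + k * `|H e|) / k + 1) = 2 * C + k * `|H e| + k.
  by field; rewrite gt_eqF.
by lra.
Qed.

Let b := 2 * l + 1.

(** The bound is the flux formula divided by [fA ^+ 2]. For the limit of [x w], the factor
    [t ^ b <= x ^ b] is taken out of the integral: all powers of [x] cancel and the integral of [Gw]
    over []0, x]] remains, which tends to [0]. *)
Lemma regular_ratio : exists w, [/\ prim w (fun t => u t / fA l t), cont w,
  forall x, 0 < x -> x <= 1 ->
    `|w x| <= C * `|x `^ (- b - 1) * oint (fun t => t `^ b * Gw t) 0 x| &
  forall e : R, 0 < e -> exists2 d, 0 < d & forall x, 0 < x -> x <= d -> `|x * w x| <= e].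
Proof.
have b0 : 0 <= b by have := hl; rewrite /b; lra.
exists (fun t => D t / fA l t ^+ 2).
have bnd x : 0 < x -> x <= 1 -> `|D x / fA l x ^+ 2| <=
    C * (x `^ (- b - 1) * oint (fun t => t `^ b * Gw t) 0 x).
  move=> x0 x1; have A0 := fA_gt0 l x0.
  rewrite regular_flux// normrM normfV [X in _ / X]gtr0_norm ?exprn_gt0//.
  have -> : (fA l x ^+ 2)^-1 = x `^ (- b - 1).
    rewrite (_ : - b - 1 = - ((l + 1) + (l + 1))); last by rewrite /b; ring.
    by rewrite powRN powR_add// -expr2.
  rewrite mulrCA [X in X <= _]mulrC ler_wpM2l ?powR_ge0// -ointZ; last exact: bGi.
  apply: le_norm_oint; [exact: fi|exact/itgZ/bGi|].
  by move=> t /andP[t0 tx]; apply: fle => //; exact: le_trans x1.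
split.
- exact: pD.2.
- apply: contM; first exact: prim_cont pD.1.
  apply: cont_inv; first exact: (contM (@cont_fA R l) (@cont_fA R l)).
  by move=> r r0; rewrite expf_neq0// gt_eqF// fA_gt0.
- move=> x x0 x1; apply: le_trans (bnd x x0 x1) _.
  by rewrite ler_wpM2l// ler_norm.
move=> e e0; have e'0 : 0 < e / (C + 1) by rewrite divr_gt0// ltr_wpDl.
have [d d0 hd] := oint_small (Gw_itg 1) e'0.
exists (Num.min (d / 2) 1); first by rewrite lt_min ltr01 andbT; lra.
move=> x x0; rewrite le_min => /andP[xd x1].
rewrite normrM (gtr0_norm x0).
apply: le_trans (ler_wpM2l (ltW x0) (bnd x x0 x1)) _.
have B : oint (fun t => t `^ b * Gw t) 0 x <= x `^ b * oint Gw 0 x.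
  rewrite -ointZ; last exact: Gw_itg.
  apply: le_oint; [exact: bGi|exact/itgZ/Gw_itg|move=> t /andP[t0 tx]].
  by rewrite ler_wpM2r ?Gw_ge0// ge0_ler_powR ?nnegrE ?(ltW t0) ?(ltW x0).
have E : x * (x `^ (- b - 1) * x `^ b) = 1.
  have {1}-> : x = x `^ 1 by rewrite powRr1// ltW.
  by rewrite -!powR_add// (_ : 1 + _ = 0) ?powRr0//; ring.
have g0 : 0 <= oint Gw 0 x by apply: oint_ge0 => t _; exact: Gw_ge0.
have ge : oint Gw 0 x <= e / (C + 1).
  apply: le_trans (_ : _ <= oint (fun t => `|Gw t|) 0 x) _.
    by apply: le_oint; [exact: Gw_itg|exact/itg_norm/Gw_itg|move=> t _; exact: ler_norm].
  by apply/ltW/hd => //; [exact: ltW|lra].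
apply: (@le_trans _ _ (C * oint Gw 0 x)).
  rewrite mulrCA ler_wpM2l// mulrA.
  apply: le_trans (ler_wpM2l _ B) _; first by rewrite mulr_ge0 ?powR_ge0// ltW.
  by rewrite mulrA -[x * _ * _]mulrA E mul1r.
apply: (@le_trans _ _ (C * (e / (C + 1)))); first by rewrite ler_wpM2l.
by rewrite mulrA ler_pdivrMr ?ltr_wpDl//; nra.
Qed.

End RegularRatio.

Section SingularRatio.
Variables (u u1 v : R -> R) (C : R).
Hypothesis hl' : - 2^-1 < l.
Hypotheses (pu : prim u1 u) (pu1 : prim (fun t => pot l q t * u t + (-1) * v t) u1).
Hypotheses (ub : forall t, 0 < t -> t <= 1 -> `|u t| <= C * t `^ (- l))
  (vb : forall t, 0 < t -> t <= 1 -> `|v t| <= C * t `^ (- l)).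

Let g := 2 * l + 1.

(** Here the flux is integrated from [1] and its value [D 1] need not vanish; it goes into [C'] and
    is multiplied by the constant [1] in the bound. *)
Lemma singular_ratio : exists w C', [/\ prim w (fun t => u t / t `^ (- l)), cont w,
  forall x, 0 < x -> x <= 1 ->
    `|w x| <= C' * `|x `^ (g - 1) * (1 - sint 1 (fun t => t `^ (- g) * Gw t) x)| &
  forall e : R, 0 < e -> exists2 d, 0 < d & forall x, 0 < x -> x <= d -> `|x * w x| <= e].
Proof.
have g0 : 0 < g by have := hl'; rewrite /g; lra.
pose F (t : R) := t `^ (- l); pose F1 t := g * fb1 l t.
have FE t : F t = g * fb l t.
  by rewrite /F /fb hl' mulrCA divff ?mulr1// gt_eqF.
have F0 t : 0 < t -> 0 < F t by exact: powR_gt0.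
have pF : prim F1 F by apply: eq_prim (primZ g (prim_fb hl)) => // t _; rewrite FE.
have pF1 : prim (fun t => V0 l t * F t) F1.
  by apply: eq_prim (primZ g (prim_fb1 hl)) => // t _; rewrite FE; ring.
have [pD pw] := ratio_derive F0 pF pF1 pu pu1.
set D := fun t => F t * u1 t - F1 t * u t in pD pw.
set f := fun t => F t * (q t * u t - v t) in pD.
have cF := prim_cont pF; have cu := prim_cont pu.
have C0 : 0 <= C.
  have := ub ltr01 (lexx _); have := F0 1 ltr01; rewrite /F => h1 h.
  by have := le_trans (normr_ge0 _) h; rewrite pmulr_lge0.
have Gi y x : 0 < y -> itg (fun t => t `^ (- g) * Gw t) y x.
  move=> y0; apply: (@eq_itg _ (fun t => Gw t * t `^ (- g))) => [t _|].
    by rewrite mulrC.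
  apply: itgM_cont => //; first exact: cont_powR.
  by apply: itgS (Gw_itg x) => //; exact: ltW.
have fle t : 0 < t -> t <= 1 -> `|f t| <= C * (t `^ (- g) * Gw t).
  move=> t0 t1; have Ft := F0 t t0.
  have h : `|q t * u t - v t| <= C * F t * (`|q t| + 1).
    apply: le_trans (ler_normB _ _) _; rewrite normrM mulrDr mulr1 lerD ?vb//.
    by rewrite mulrC ler_wpM2r// ub.
  rewrite /f normrM (gtr0_norm Ft).
  apply: le_trans (ler_wpM2l (ltW Ft) h) _.
  have E : t `^ (- g) * t = F t * F t.
    by rewrite -powR_add1// -powR_add//; congr (_ `^ _); rewrite /g; ring.
  rewrite [X in X <= _](_ : _ = C * (F t * F t * (`|q t| + 1))); last by ring.
  rewrite ler_wpM2l// -E -mulrA ler_wpM2l ?powR_ge0//.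
  by rewrite /Gw normrM (gtr0_norm t0) mulrDr mulr1 lerD2l.
pose C' := `|D 1| + C; have C'0 : 0 <= C' by rewrite addr_ge0.
have bnd x : 0 < x -> x <= 1 -> `|D x / F x ^+ 2| <=
    C' * (x `^ (g - 1) * (1 + oint (fun t => t `^ (- g) * Gw t) x 1)).
  move=> x0 x1; have Fx := F0 x x0.
  rewrite normrM normfV [X in _ / X]gtr0_norm ?exprn_gt0//.
  have -> : (F x ^+ 2)^-1 = x `^ (g - 1).
    by rewrite expr2 -powR_add// -powRN; congr (_ `^ _); rewrite /g; ring.
  rewrite mulrCA [X in X <= _]mulrC ler_wpM2l ?powR_ge0//.
  have -> : D x = D 1 - oint f x 1 by rewrite -(prim_oint pD x0 x1); ring.
  apply: le_trans (ler_normB _ _) _.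
  have : `|oint f x 1| <= C * oint (fun t => t `^ (- g) * Gw t) x 1.
    rewrite -ointZ; last exact: Gi.
    apply: le_norm_oint; [exact: prim_itg pD x0|exact/itgZ/Gi|].
    by move=> t /andP[xt t1]; apply: fle => //; exact: lt_trans xt.
  have I0 : 0 <= oint (fun t => t `^ (- g) * Gw t) x 1.
    by apply: oint_ge0 => t _; rewrite mulr_ge0 ?powR_ge0 ?Gw_ge0.
  by rewrite /C'; have := normr_ge0 (D 1); nra.
exists (fun t => D t / F t ^+ 2), C'; split.
- exact: pw.
- apply: contM; first exact: prim_cont pD.
  apply: cont_inv; first exact: (contM cF cF).
  by move=> r r0; rewrite expf_neq0// gt_eqF// F0.
- move=> x x0 x1; apply: le_trans (bnd x x0 x1) _.
  by rewrite ler_wpM2l// /sint (oint_nil _ x1) sub0r opprK ler_norm.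
move=> e e0; have e'0 : 0 < e / (2 * (C' + 1)) by rewrite divr_gt0// mulr_gt0// ltr_wpDl.
have [d d0 hd] := oint_small (Gw_itg 1) e'0.
(* Two scales: [y] makes the integral of [Gw] over []0, y]] small, which handles []x, y]] because
   [x ^ g * t ^ (- g) <= 1] there; then [x] is taken so small that [x ^ g] beats the fixed remainder
   [K]. *)
pose y := Num.min (d / 2) 1.
have y0 : 0 < y by rewrite lt_min ltr01 andbT; lra.
have y1 : y <= 1 by rewrite ge_min lexx orbT.
have yd : y <= d / 2 by rewrite ge_min lexx.
pose K := 1 + oint (fun t => t `^ (- g) * Gw t) y 1.
have K0 : 0 < K.
  by rewrite ltr_pwDl//; apply: oint_ge0 => t _; rewrite mulr_ge0 ?powR_ge0 ?Gw_ge0.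
pose h := e / (2 * (C' + 1)) / K; have h0 : 0 < h by rewrite divr_gt0.
exists (Num.min y (h `^ g^-1)); first by rewrite lt_min y0 powR_gt0.
move=> x x0; rewrite le_min => /andP[xy xh].
have x1 : x <= 1 by exact: le_trans y1.
have xg : x `^ g <= h.
  have : x `^ g <= (h `^ g^-1) `^ g.
    by rewrite ge0_ler_powR// ?nnegrE ?powR_ge0// ltW.
  by rewrite -powRrM mulVf ?gt_eqF// powRr1// ltW.
rewrite normrM (gtr0_norm x0).
apply: le_trans (ler_wpM2l (ltW x0) (bnd x x0 x1)) _.
have E : x * x `^ (g - 1) = x `^ g by rewrite mulrC -powR_add1// subrK.
rewrite mulrCA mulrA mulrA -[C' * x * _]mulrA E.
rewrite (@oint_split _ _ x y 1)//; last exact: Gi.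
have B : x `^ g * oint (fun t => t `^ (- g) * Gw t) x y <= e / (2 * (C' + 1)).
  rewrite -ointZ; last exact: Gi.
  apply: le_trans (_ : _ <= oint (fun t => `|Gw t|) 0 y) _; last first.
    by apply/ltW/hd => //; [exact: ltW|lra].
  apply: (@le_trans _ _ (oint (fun t => `|Gw t|) x y)); last first.
    by apply: le_oint_itv => //; [exact: ltW|exact/itg_norm/Gw_itg].
  apply: le_oint; [exact/itgZ/Gi|apply/itg_norm/(itgS _ _ (Gw_itg y)) => //; exact: ltW|].
  move=> t /andP[xt ty]; have t0 : 0 < t by exact: lt_trans xt.
  rewrite ger0_norm ?Gw_ge0// mulrA ler_piMl ?Gw_ge0//.
  rewrite powRN ler_pdivrMr ?powR_gt0// mul1r.
  by rewrite ge0_ler_powR ?nnegrE ?(ltW x0) ?(ltW t0) ?(ltW xt) ?(ltW g0).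
have B2 : x `^ g * K <= e / (2 * (C' + 1)).
  by apply: le_trans (ler_wpM2r (ltW K0) xg) _; rewrite /h divfK// gt_eqF.
have E2 : e / (2 * (C' + 1)) + e / (2 * (C' + 1)) = e / (C' + 1).
  by field; rewrite gt_eqF// ltr_wpDl.
have B3 : x `^ g * (1 + (oint (fun t => t `^ (- g) * Gw t) x y +
    oint (fun t => t `^ (- g) * Gw t) y 1)) <= e / (C' + 1).
  by rewrite -E2; move: B2; rewrite /K; lra.
rewrite -mulrA; apply: le_trans (ler_wpM2l C'0 B3) _.
by rewrite mulrA ler_pdivrMr ?ltr_wpDl//; nra.
Qed.

End SingularRatio.

Section WeightLp.
Variable h : R -> R.
Hypothesis mh : measurable_fun posR h.

Lemma measurable_norm_add1 : measurable_fun posR (fun t => `|h t| + 1).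
Proof.
apply: measurable_funD; last exact: measurable_cst.
exact: measurableT_comp.
Qed.
Let mG := measurable_norm_add1.

Let G0 t : 0 <= `|h t| + 1. Proof. by rewrite addr_ge0. Qed.

Lemma Lp01_norm_add1 (p : \bar R) : (1 <= p)%E -> Lp01 p h ->
  Lp01 p (fun t => `|h t| + 1).
Proof.
case: p => [p|_|//].
  rewrite lee_fin => p1 /(Lp01_finP p1 mh) hi; apply/(Lp01_finP p1 mG).
  have p0 : 0 <= p by exact: le_trans p1.
  apply: (itg_le _ _ (itgZ (2 `^ p) (itgD hi (itg_cst 0 1 1)))).
    by apply: pos_meas => //; exact: measurable_powR_norm.
  move=> t _; rewrite (ger0_norm (G0 t)) (ger0_norm (powR_ge0 _ _)) [cst 1 t]/1.
  have [h1|h1] := leP `|h t| 1.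
    apply: (@le_trans _ _ (2 `^ p)).
      by rewrite ge0_ler_powR ?nnegrE ?addr_ge0//; lra.
    by rewrite ler_peMr ?powR_ge0// lerDr powR_ge0.
  apply: (@le_trans _ _ ((2 * `|h t|) `^ p)).
    by rewrite ge0_ler_powR ?nnegrE ?addr_ge0 ?mulr_ge0//; lra.
  by rewrite powRM// ler_wpM2l ?powR_ge0// lerDl.
move=> /(Lp01_inftyP mh)[M hM]; apply/(Lp01_inftyP mG); exists (M + 1).
by apply: ae_imp hM => x hx xD; rewrite (ger0_norm (G0 x)) lerD2r hx.
Qed.

(** Adding [1] makes the function at least [1], so its powers increase with the exponent; this gives
    the inclusion of the Lebesgue spaces on a finite interval without Hoelder's inequality. *)
Lemma Lp01_norm_add1_le (p r : \bar R) : (1 <= r)%E -> (r <= p)%E -> Lp01 p h ->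
  Lp01 r (fun t => `|h t| + 1).
Proof.
case: r => [r|_|//]; last first.
  by rewrite leye_eq => /eqP -> hp; apply: Lp01_norm_add1; rewrite ?leey.
rewrite lee_fin => r1; case: p => [p|_|//].
  rewrite lee_fin => rp hp; have p1 : 1 <= p by exact: le_trans rp.
  have p1' : (1 <= p%:E)%E by rewrite lee_fin.
  have /(Lp01_finP p1 mG) hi := Lp01_norm_add1 p1' hp; apply/(Lp01_finP r1 mG).
  apply: (itg_le _ _ hi); first by apply: pos_meas => //; exact: measurable_powR_norm.
  by move=> t _; rewrite !(ger0_norm (powR_ge0 _ _)) !(ger0_norm (G0 t)) ler_powR// lerDr.
move=> /(Lp01_norm_add1 (leey _))/(Lp01_inftyP mG)[M hM]; apply/(Lp01_finP r1 mG).
have mGr := measurable_powR_norm r mG.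
apply/integrableP; split; first by apply/measurable_EFinP; exact: pos_meas.
apply: (@le_lt_trans _ _ (\int[mu]_(x in `]0%R, 1%R]) (cst (Num.max M 0 `^ r)%:E x))%E).
  apply: ae_ge0_le_integral => //.
  - by apply: (measurableT_comp (@abse_measurable R setT)); apply/measurable_EFinP; exact: pos_meas.
  - by move=> x _; rewrite lee_fin powR_ge0.
  apply: ae_imp2 (ae_neq 1) hM => t t1 ht; rewrite /= in_itv/= => /andP[t0 t1'].
  rewrite lee_fin ger0_norm ?powR_ge0// ge0_ler_powR ?nnegrE ?le_max ?lexx ?orbT//.
    by exact: le_trans r1.
  by rewrite ht// t0 lt_def eq_sym t1.
by rewrite integral_cst//= lebesgue_measure_itv/= lte_fin ltr01 sube0 mule1 ltry.
Qed.

Lemma Lp01_itg (p : \bar R) : (1 <= p)%E -> Lp01 p h -> itg h 0 1.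
Proof.
move=> p1 hp; have /(Lp01_finP (lexx 1) mG) := Lp01_norm_add1_le (lexx 1%E) p1 hp.
apply: itg_le; first exact: pos_meas.
by move=> t _; rewrite powRr1// (ger0_norm (G0 t)) lerDl.
Qed.

End WeightLp.

Lemma hardy0_meas (b : R) : 0 <= b ->
  measurable_fun posR (fun x => x `^ (- b - 1) * oint (fun t => t `^ b * Gw t) 0 x).
Proof.
move=> b0; have lb : locint 0 (fun t => t `^ b * Gw t).
  move=> lo hi /window0 ->; apply: itg_pow_mul => //; [exact: Gw_meas|exact: Gw_itg].
apply: (@eq_measurable_fun _ _ _ _ posR (fun x => x `^ (- b - 1) * sint 0 (fun t => t `^ b * Gw t) x)).
  move=> x; rewrite inE/= in_itv/= andbT => x0.
  by rewrite /sint (oint_nil _ (ltW x0)) subr0.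
apply: cont_measT; apply: contM; first exact: (@cont_powR R _).
exact: prim_cont (sint_prim (lexx _) lb).
Qed.

Lemma hardy1_meas (g : R) :
  measurable_fun posR (fun x => x `^ (g - 1) * (1 - sint 1 (fun t => t `^ (- g) * Gw t) x)).
Proof.
have lb : locint 1 (fun t => t `^ (- g) * Gw t).
  move=> lo hi [lo0 _ _ h]; have {lo0}lo0 : 0 < lo.
    by rewrite lt_def lo0 andbT; apply/eqP => /h/eqP; rewrite oner_eq0.
  apply: (@eq_itg _ (fun t => Gw t * t `^ (- g))) => [t _|]; first by rewrite mulrC.
  apply: itgM_cont => //; first exact: cont_powR.
  by apply: itgS (Gw_itg hi) => //; exact: ltW.
apply: cont_measT; apply: contM; first exact: (@cont_powR R _).
by apply: contB; [exact: cont_cst|exact: prim_cont (sint_prim ler01 lb)].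
Qed.

End Regularity.

(** * From the integrability hypotheses on the potential to the weights *)

Section Hypotheses.
Context {R : realType}.
Local Notation mu := (@lebesgue_measure R).
Local Notation posR := (`]0, +oo[%classic : set R).
Variables (l : R) (p : \bar R) (q : R -> R).

Lemma locally_integrable_itg : locally_integrable posR q ->
  measurable_fun posR q /\ forall y x, 0 < y -> itg q y x.
Proof.
move=> [mq _ hq]; split=> // y x y0; apply/integrableP; split.
  by apply/measurable_EFinP; apply: pos_meas => //; exact: ltW.
apply: le_lt_trans (hq `[y, x]%classic _ (@segment_compact R y x)).
  apply: ge0_subset_integral => //=.
    apply/measurable_EFinP; apply: measurableT_comp => //.
    apply: measurable_funS mq => // t; rewrite /= !in_itv/= andbT => /andP[yt _].
    exact: lt_le_trans yt.
  by apply: subset_itvr; rewrite bnd_simp.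
by move=> t; rewrite /= !in_itv/= andbT => /andP[yt _]; exact: lt_le_trans yt.
Qed.

(** The inequality [ln y <= y - 1] at [y = t ^ (- s)]. *)
Lemma ln_le_powR (s t : R) : 0 < s -> 0 < t -> t <= 1 -> - ln t <= t `^ (- s) / s.
Proof.
move=> s0 t0 t1; rewrite ler_pdivlMr//.
have h := powR_gt0 (- s) t0.
have : ln (1 + (t `^ (- s) - 1)) <= t `^ (- s) - 1 by apply: le_ln1Dx; lra.
by rewrite addrC subrK ln_powR; lra.
Qed.

Hypothesis mq : measurable_fun posR q.
Hypothesis qi : forall y x, 0 < y -> itg q y x.

Let mtq : measurable_fun posR (fun t => t * q t) := measurable_idM mq.
Let mG : measurable_fun posR (Gw q) := Gw_meas mq.

Lemma weight_itg : - 2^-1 <= l -> itg (fun t => t * q t * lw l t) 0 1 ->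
  forall X, itg (fun t => fA l t * fB l t * q t) 0 X.
Proof.
move=> hl h X; apply: (@itg_cat _ _ 0 1).
  by apply: eq_itg h => t /andP[t0 _]; rewrite fAB//; ring.
apply: (@eq_itg _ (fun t => q t * (fA l t * fB l t))) => [t _|]; first by rewrite mulrC.
apply: itgM_cont => //; last exact: qi.
by apply: contM; [exact: cont_fA|exact: cont_fB].
Qed.

(** The logarithm is [O(t ^ (- s))]. Cutting [Gw] at the level [t ^ (-1/2)] with a finite exponent
    [r > 1] leaves [t ^ (- 1/2 - s)] and [Gw ^ r * t ^ ((r - 1) / 2 - s)]; the bounds [s <= 1/4] and
    [s <= (r - 1) / 2] make the first integrable and the second at most [Gw ^ r]. *)
Lemma lw_log_itg : l = - 2^-1 -> (1 < p)%E -> Lp01 p (fun t => t * q t) ->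
  itg (fun t => t * q t * lw l t) 0 1.
Proof.
move=> lE p1 hp; have [r [r1 hr]] : exists r : R, 1 < r /\ itg (fun t => Gw q t `^ r) 0 1.
  suff [r [r1 rp]] : exists r : R, 1 < r /\ (r%:E <= p)%E.
    exists r; split=> //; have r1' : (1 <= r%:E)%E by rewrite lee_fin ltW.
    have /(Lp01_finP (ltW r1) mG) := Lp01_norm_add1_le mtq r1' rp hp.
    by apply: eq_itg => t _; rewrite (ger0_norm (Gw_ge0 q t)).
  case: p p1 => [s|_|//]; first by rewrite lte_fin => s1; exists s.
  by exists 2; rewrite ltr1n leey.
pose s := Num.min (1 / 4) ((r - 1) / 2).
have s0 : 0 < s by rewrite lt_min; apply/andP; split; lra.
have s4 : s <= 1 / 4 by rewrite ge_min lexx.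
have sr : s <= (r - 1) / 2 by rewrite ge_min lexx orbT.
have [ti _] := @powR_int0 R (- (3 / 4)) 1 ltac:(lra) ltr01.
have mlw : measurable_fun posR (lw l) by apply: cont_measT; apply: cont_lw; rewrite lE.
apply: (itg_le _ _ (itgZ (1 + s^-1) (itgD ti hr))).
  by apply: pos_meas => //; apply: measurable_funM.
move=> t /andP[t0 t1].
have lwE : lw l t <= (1 + s^-1) * t `^ (- s).
  rewrite /lw lE ltxx ler0_norm ?ln_le0// mulrDl mul1r lerD//.
    by rewrite -(powRr0 t) ger_powR ?t0//; lra.
  by rewrite mulrC ln_le_powR.
have lw0 : 0 <= lw l t by apply/ltW/lw_gt0.
rewrite normrM (ger0_norm lw0).
have G0 := Gw_ge0 q t.
have : `|t * q t| * lw l t <= Gw q t * ((1 + s^-1) * t `^ (- s)).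
  by apply: ler_pM => //; rewrite /Gw lerDl.
move=> /le_trans; apply; rewrite mulrCA ler_wpM2l ?addr_ge0 ?invr_ge0 ?(ltW s0)//.
have c0 : 0 < t `^ (- 2^-1) by exact: powR_gt0.
have := ler_wpM2r (powR_ge0 t (- s)) (le_cut (ltW r1) G0 c0).
move=> /le_trans; apply; rewrite mulrDl; apply: lerD.
  by rewrite -powR_add// ger_powR ?t0//; lra.
rewrite -mulrA ler_piMr ?powR_ge0// -powRrM -powR_add//.
by rewrite -[X in _ <= X](powRr0 t) ger_powR ?t0//; nra.
Qed.

Lemma singular_weights : - 2^-1 < l -> (1 <= p)%E -> Lp01 p (fun t => t * q t) ->
  forall X, itg (fun t => fA l t * fB l t * q t) 0 X.
Proof.
move=> hl p1 hp; apply: weight_itg; first exact: ltW.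
by apply: eq_itg (Lp01_itg mtq p1 hp) => t _; rewrite /lw hl mulr1.
Qed.

Lemma log_weights : l = - 2^-1 -> Lp01 1%:E (fun t => (1 - ln t) * t * q t) ->
  [/\ forall X, itg (fun t => fA l t * fB l t * q t) 0 X,
      Lp01 1%:E (fun t => t * q t) &
      itg (fun t => - ln t * Gw q t) 0 1].
Proof.
move=> lE hp.
have mln : measurable_fun posR (@ln R) by apply: cont_measT; exact: cont_ln.
have mh : measurable_fun posR (fun t => (1 - ln t) * t * q t).
  apply: (@eq_measurable_fun _ _ _ _ posR (fun t => (1 - ln t) * (t * q t))).
    by move=> t _; rewrite mulrA.
  by apply: measurable_funM => //; apply: measurable_funB.
have hi : itg (fun t => (1 - ln t) * t * q t) 0 1.
  have /(Lp01_finP (lexx 1) mh) := hp; apply: itg_le; first exact: pos_meas.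
  by move=> t _; rewrite powRr1.
have hl : - 2^-1 <= l by rewrite lE.
have [ti _] := @powR_int0 R (- 2^-1) 1 ltac:(lra) ltr01.
split.
- apply: weight_itg => //; apply: eq_itg hi => t /andP[t0 t1].
  by rewrite /lw lE ltxx ler0_norm ?ln_le0//; ring.
- apply: (Lp01_le (C := 1) _ _ mh) hp => // t t0 t1; rewrite mul1r -mulrA [X in _ <= X]normrM ler_peMl//.
  by apply: le_trans (ler_norm _); have := ln_le0 t1; lra.
- apply: (itg_le _ _ (itgD (itg_norm hi) (itgZ 2 ti))).
    by apply: pos_meas => //; apply: measurable_funM => //; exact: measurableT_comp.
  move=> t /andP[t0 t1]; have L0 := ln_le0 t1.
  have h2 : - ln t <= t `^ (- 2^-1) / 2^-1 by apply: ln_le_powR => //; lra.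
  rewrite normrM (ger0_norm (Gw_ge0 q t)) ger0_norm; last by lra.
  rewrite /Gw mulrDr mulr1; apply: lerD; last by move: h2; lra.
  rewrite -mulrA [X in _ <= X]normrM ler_wpM2r//.
  by apply: le_trans (ler_norm _); lra.
Qed.

End Hypotheses.

Local Open Scope complex_scope.

(** * Power series in a complex parameter *)

Section ComplexSeries.
Context {R : realType}.
Implicit Types (z w h : R[i]) (a b : nat -> R) (c d : nat -> R[i]).
Local Notation normc := (@ComplexField.Normc.normc R).
Local Notation Re := (@complex.Re R).
Local Notation Im := (@complex.Im R).

Lemma normrC z : `|z| = (normc z)%:C. Proof. by []. Qed.

Lemma normc_ge0 z : 0 <= normc z. Proof. by case: z => x y; exact: sqrtr_ge0. Qed.

Lemma normcD z w : normc (z + w) <= normc z + normc w.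
Proof. exact: le_normcD. Qed.

Lemma normcB z w : normc (z - w) <= normc z + normc w.
Proof. by rewrite -[normc w]normcN; exact: normcD. Qed.

Lemma normcM z w : normc (z * w) = normc z * normc w.
Proof. exact: ComplexField.Normc.normcM. Qed.

Lemma normcX z n : normc (z ^+ n) = normc z ^+ n.
Proof.
elim: n => [|n IH]; first by rewrite !expr0 ComplexField.Normc.normc1.
by rewrite !exprS normcM IH.
Qed.

Lemma normc_real (x : R) : normc x%:C = `|x|.
Proof. by rewrite /normc/= expr0n/= addr0 sqrtr_sqr. Qed.

Lemma Re_le_normc z : `|Re z| <= normc z.
Proof.
by case: z => x y; rewrite /normc/= -sqrtr_sqr ler_sqrt ?addr_ge0 ?sqr_ge0// lerDl sqr_ge0.
Qed.

Lemma Im_le_normc z : `|Im z| <= normc z.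
Proof.
by case: z => x y; rewrite /normc/= -sqrtr_sqr ler_sqrt ?addr_ge0 ?sqr_ge0// lerDr sqr_ge0.
Qed.

Lemma normc_le z : normc z <= `|Re z| + `|Im z|.
Proof.
case: z => x y; rewrite /normc/= -[X in _ <= X]ger0_norm ?addr_ge0//.
rewrite -sqrtr_sqr ler_sqrt ?sqr_ge0// sqrrD !real_normK ?num_real//.
by rewrite addrAC lerDl mulrn_wge0// mulr_ge0.
Qed.

(** The sequence [a] is real in all uses, so a complex series is a pair of real ones and no limit in
    the complex plane is taken. *)
Definition csum c a : R[i] :=
  ser (fun n => Re (c n) * a n) +i* ser (fun n => Im (c n) * a n).

Definition decay a := forall r : R, 0 < r -> exists2 K, 0 <= K &
  forall n, `|a n| <= K / r ^+ n.

Definition growth c := exists D s : R, [/\ 0 <= D, 0 < s &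
  forall n, normc (c n) <= D * s ^+ n].

Lemma csum_geobd c a : growth c -> decay a -> exists M,
  geobd M (fun n => Re (c n) * a n) /\ geobd M (fun n => Im (c n) * a n).
Proof.
move=> [D [s [D0 s0 hc]]] ha; have [K K0 hK] := ha (2 * s) (mulr_gt0 (ltr0Sn _ 1) s0).
exists (D * K); split; apply: geobd_pow hK => // n; apply: le_trans (hc n).
  exact: Re_le_normc.
exact: Im_le_normc.
Qed.

Lemma csum_bound c a (D s K : R) : 0 <= D -> 0 < s ->
  (forall n, normc (c n) <= D * s ^+ n) -> (forall n, `|a n| <= K / (2 * s) ^+ n) ->
  normc (csum c a) <= 4 * (D * K).
Proof.
move=> D0 s0 hc ha; apply: le_trans (normc_le _) _ => /=.
have -> : 4 * (D * K) = 2 * (D * K) + 2 * (D * K) by ring.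
apply: lerD; apply: ser_bound; apply: geobd_pow ha => // n; apply: le_trans (hc n).
  exact: Re_le_normc.
exact: Im_le_normc.
Qed.

Lemma csumD c d a : growth c -> growth d -> decay a ->
  csum (fun n => c n + d n) a = csum c a + csum d a.
Proof.
move=> hc hd ha; have [M [h1 h2]] := csum_geobd hc ha.
have [N [h3 h4]] := csum_geobd hd ha.
rewrite /csum; apply/eqP; rewrite eq_complex/= -(serD h1 h3) -(serD h2 h4).
apply/andP; split; apply/eqP; congr ser; apply/funext => n.
  by case: (c n) (d n) => [? ?] [? ?] /=; rewrite mulrDl.
by case: (c n) (d n) => [? ?] [? ?] /=; rewrite mulrDl.
Qed.

Lemma csumZ h c a : growth c -> decay a -> csum (fun n => h * c n) a = h * csum c a.
Proof.
move=> hc ha; have [M [h1 h2]] := csum_geobd hc ha.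
case: h => x y; rewrite /csum; apply/eqP; rewrite eq_complex/=.
have h3 := geobdZ (- y) h2; have h4 := geobdZ y h1.
rewrite -mulNr -(serZ x h1) -(serZ (- y) h2) -(serZ x h2) -(serZ y h1).
rewrite -(serD (geobdZ x h1) h3) -(serD (geobdZ x h2) h4).
apply/andP; split; apply/eqP; congr ser; apply/funext => n;
  by case: (c n) => [? ?] /=; ring.
Qed.

Lemma csumMr (k : R) c a : growth c -> decay a ->
  csum c (fun n => k * a n) = k%:C * csum c a.
Proof.
move=> hc ha; rewrite -csumZ//; congr (_ +i* _); congr ser; apply/funext => n;
  by case: (c n) => [? ?] /=; ring.
Qed.

Lemma growthX z : growth (fun n => z ^+ n).
Proof.
exists 1, (normc z + 1); split=> // [|n]; first by rewrite ltr_wpDl// normc_ge0.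
by rewrite mul1r normcX lerXn2r ?nnegrE ?addr_ge0 ?normc_ge0// lerDl.
Qed.

Lemma growthD c d : growth c -> growth d -> growth (fun n => c n + d n).
Proof.
move=> [D [s [D0 s0 hc]]] [E [t [E0 t0 hd]]]; exists (D + E), (s + t); split.
- by rewrite addr_ge0.
- by rewrite addr_gt0.
move=> n; apply: le_trans (normcD _ _) _; rewrite mulrDl lerD//.
  apply: le_trans (hc n) _; rewrite ler_wpM2l// lerXn2r ?nnegrE ?addr_ge0 ?(ltW s0) ?(ltW t0)//.
  by rewrite lerDl ltW.
apply: le_trans (hd n) _; rewrite ler_wpM2l// lerXn2r ?nnegrE ?addr_ge0 ?(ltW s0) ?(ltW t0)//.
by rewrite lerDr ltW.
Qed.

Lemma growthZ h c : growth c -> growth (fun n => h * c n).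
Proof.
move=> [D [s [D0 s0 hc]]]; exists (normc h * D), s; split=> // [|n].
  by rewrite mulr_ge0// normc_ge0.
by rewrite normcM -mulrA ler_wpM2l// normc_ge0.
Qed.

Definition cpow a z := csum (fun n => z ^+ n) a.

Lemma cpow0 z : cpow (fun n => (n == 0%N)%:R) z = 1.
Proof.
rewrite /cpow /csum; have b0 : geobd 0 (fun _ : nat => 0 : R).
  by move=> n; rewrite normr0 mul0r.
have s0 : ser (fun _ : nat => 0) = 0 :> R.
  by apply: (ser_unique (C := 0) b0) => N; rewrite big1// subr0 normr0 mul0r.
have E : (fun n => Re (z ^+ n.+1) * (n.+1 == 0%N)%:R) = (fun=> 0).
  by apply/funext => n; rewrite mulr0.
have E' : (fun n => Im (z ^+ n.+1) * (n.+1 == 0%N)%:R) = (fun=> 0).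
  by apply/funext => n; rewrite mulr0.
have g (f : nat -> R) : geobd `|f 0%N| (fun n => f n * (n == 0%N)%:R).
  by move=> [|n]; rewrite ?expr0 ?divr1 ?mulr1// mulr0 normr0 divr_ge0// exprn_ge0.
apply/eqP; rewrite eq_complex/=.
rewrite (ser_recl (g (fun n => Re (z ^+ n)))) (ser_recl (g (fun n => Im (z ^+ n)))).
by rewrite E E' s0 !addr0 expr0/= mulr1 mul0r !eqxx.
Qed.

(** The derivative [n z ^+ (n - 1)] of the power, in the form of the product rule, which suits
    induction on [n]. *)
Fixpoint dpow z n : R[i] := if n is m.+1 then z * dpow z m + z ^+ m else 0.

Section PowerBounds.
Variables (z h : R[i]) (s : R).
Hypotheses (s1 : 1 <= s) (hz : normc z <= s) (hzh : normc (z + h) <= s).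

Let s0 : 0 <= s. Proof. exact: le_trans s1. Qed.

Let zn n : normc (z ^+ n) <= s ^+ n.
Proof. by rewrite normcX lerXn2r ?nnegrE ?normc_ge0. Qed.

Lemma pow_lipschitz n : normc ((z + h) ^+ n - z ^+ n) <= normc h * (2 * s) ^+ n.
Proof.
elim: n => [|n IH].
  by rewrite !expr0 subrr ComplexField.Normc.normc0 mulr1 normc_ge0.
have -> : (z + h) ^+ n.+1 - z ^+ n.+1 =
    (z + h) * ((z + h) ^+ n - z ^+ n) + h * z ^+ n by rewrite !exprS; ring.
apply: le_trans (normcD _ _) _; rewrite !normcM.
have h0 := normc_ge0 h.
have i1 : normc (z + h) * normc ((z + h) ^+ n - z ^+ n) <= s * (normc h * (2 * s) ^+ n).
  by apply: ler_pM => //; exact: normc_ge0.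
have i2 : normc h * normc (z ^+ n) <= s * (normc h * (2 * s) ^+ n).
  rewrite mulrCA ler_wpM2l//; apply: le_trans (zn n) _.
  rewrite exprMn mulrA ler_peMl ?exprn_ge0//.
  by apply: le_trans s1 _; rewrite ler_peMr// exprn_ege1// ler1n.
by apply: le_trans (lerD i1 i2) _; rewrite le_eqVlt; apply/orP; left; apply/eqP; rewrite exprS; ring.
Qed.

Lemma dpow_growth n : normc (dpow z n) <= (2 * s) ^+ n.
Proof.
elim: n => [|n IH]; first by rewrite (_ : dpow z 0 = 0)// ComplexField.Normc.normc0 exprn_ge0// mulr_ge0.
rewrite (_ : dpow z n.+1 = z * dpow z n + z ^+ n)//; apply: le_trans (normcD _ _) _; rewrite normcM.
have i1 : normc z * normc (dpow z n) <= s * (2 * s) ^+ n.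
  by apply: ler_pM => //; exact: normc_ge0.
have i2 : normc (z ^+ n) <= s * (2 * s) ^+ n.
  apply: le_trans (zn n) _; rewrite exprMn mulrA ler_peMl ?exprn_ge0//.
  by apply: le_trans s1 _; rewrite ler_peMr// exprn_ege1// ler1n.
by apply: le_trans (lerD i1 i2) _; rewrite le_eqVlt; apply/orP; left; apply/eqP; rewrite exprS; ring.
Qed.

(** The remainder of order [n.+1] is [z] times the one of order [n] plus [h] times a first
    difference, which [pow_lipschitz] bounds. The base [4 s] is generous; coefficients decaying
    faster than every geometric sequence can afford it. *)
Lemma pow_taylor n :
  normc ((z + h) ^+ n - z ^+ n - h * dpow z n) <= normc h ^+ 2 * (4 * s) ^+ n.
Proof.
elim: n => [|n IH].
  by rewrite !expr0 subrr /= mulr0 subr0 ComplexField.Normc.normc0 mulr1 sqr_ge0.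
have -> : (z + h) ^+ n.+1 - z ^+ n.+1 - h * dpow z n.+1 =
    z * ((z + h) ^+ n - z ^+ n - h * dpow z n) + h * ((z + h) ^+ n - z ^+ n).
  by rewrite /= !exprS; ring.
apply: le_trans (normcD _ _) _; rewrite !normcM.
have h0 := normc_ge0 h.
have i1 : normc z * normc ((z + h) ^+ n - z ^+ n - h * dpow z n) <=
    s * (normc h ^+ 2 * (4 * s) ^+ n).
  by apply: ler_pM => //; exact: normc_ge0.
have i2 : normc h * normc ((z + h) ^+ n - z ^+ n) <= s * (normc h ^+ 2 * (4 * s) ^+ n).
  apply: le_trans (ler_wpM2l h0 (pow_lipschitz n)) _.
  rewrite mulrA -expr2 mulrCA ler_wpM2l ?sqr_ge0//.
  apply: (@le_trans _ _ ((4 * s) ^+ n)).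
    by rewrite lerXn2r ?nnegrE ?mulr_ge0//; have := s0; lra.
  by rewrite ler_peMl// exprn_ge0// mulr_ge0.
have A0 : 0 <= s * (normc h ^+ 2 * (4 * s) ^+ n).
  by rewrite !mulr_ge0 ?sqr_ge0// exprn_ge0// mulr_ge0.
have -> : normc h ^+ 2 * (4 * s) ^+ n.+1 = 4 * (s * (normc h ^+ 2 * (4 * s) ^+ n)).
  by rewrite [(4 * s) ^+ _]exprS; ring.
apply: le_trans (lerD i1 i2) _; move: (s * _) A0 => X X0; lra.
Qed.

End PowerBounds.

(** [4 s] is twice the base [2 s] of [pow_lipschitz], the factor two being what [csum_bound] needs
    to sum; in [cpow_taylor] the base [8 s] arises from [4 s] in the same way. *)
Lemma cpow_lipschitz a z (s K : R) w : 1 <= s -> (forall n, `|a n| <= K / (4 * s) ^+ n) ->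
  decay a -> normc z <= s -> normc w <= s ->
  normc (cpow a w - cpow a z) <= 4 * K * normc (w - z).
Proof.
move=> s1 ha hd hz hw; have s0 : 0 < s by exact: lt_le_trans s1.
have -> : cpow a w - cpow a z = csum (fun n => w ^+ n + (-1) * z ^+ n) a.
  rewrite csumD ?csumZ//; first last.
  - exact/growthZ/growthX.
  - exact: growthX.
  - exact: growthX.
  by rewrite mulN1r.
have -> : 4 * K * normc (w - z) = 4 * (normc (w - z) * K) by ring.
apply: (@csum_bound _ _ _ (2 * s)); rewrite ?normc_ge0 ?mulr_gt0//.
  move=> n; have := @pow_lipschitz z (w - z) s s1 hz; rewrite mulN1r subrKC.
  exact.
by move=> n; rewrite mulrA -natrM; exact: ha.
Qed.

Lemma cpow_taylor a z h (s K : R) : 1 <= s -> (forall n, `|a n| <= K / (8 * s) ^+ n) ->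
  decay a -> normc z <= s -> normc (z + h) <= s ->
  normc (cpow a (z + h) - cpow a z - h * csum (dpow z) a) <= 4 * K * normc h ^+ 2.
Proof.
move=> s1 ha hd hz hw; have s0 : 0 < s by exact: lt_le_trans s1.
have gd : growth (dpow z).
  exists 1, (2 * s); split=> // [|n]; first by rewrite mulr_gt0.
  by rewrite mul1r; exact: (dpow_growth s1 hz).
have -> : cpow a (z + h) - cpow a z - h * csum (dpow z) a =
    csum (fun n => ((z + h) ^+ n + (-1) * z ^+ n) + (- h) * dpow z n) a.
  rewrite !csumD ?csumZ//; do ?[exact: growthX|exact/growthZ|exact/growthZ/growthX].
    by rewrite mulN1r mulNr.
  by apply: growthD; [exact: growthX|exact/growthZ/growthX].
have -> : 4 * K * normc h ^+ 2 = 4 * (normc h ^+ 2 * K) by ring.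
apply: (@csum_bound _ _ _ (4 * s)); rewrite ?sqr_ge0 ?mulr_gt0//.
  by move=> n; have := @pow_taylor z h s s1 hz hw n; rewrite mulN1r mulNr.
by move=> n; rewrite mulrA -natrM; exact: ha.
Qed.

End ComplexSeries.

(** * Limits, joint continuity and complex differentiability from explicit estimates *)

Section ComplexTopology.
Context {R : realType}.
Implicit Types (z w h : R[i]) (f : R -> R[i]).
Local Notation normc := (@ComplexField.Normc.normc R).

Lemma gt0_complex (e : R[i]) : 0 < e -> exists2 r : R, 0 < r & e = r%:C.
Proof.
case: e => a b; rewrite ltcE/= => /andP[/eqP E a0]; exists a => //.
by apply/eqP; rewrite eq_complex/= E !eqxx.
Qed.

Lemma tends_to_at0I f z : (forall e : R, 0 < e -> exists2 d, 0 < d &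
  forall x, 0 < x -> x <= d -> normc (f x - z) <= e) -> tends_to_at0 f z.
Proof.
move=> H; apply/(@cvgrPdist_le _ R[i]^o _ _ _ f z) => _ /gt0_complex[e e0 ->].
have [d d0 hd] := H e e0.
near=> x; rewrite distrC normrC lecR hd//; near: x.
exact: nbhs_right_le.
Unshelve. all: by end_near.
Qed.

Lemma jointly_continuous_onI (A : set R) (F : R[i] -> R -> R[i]) :
  (forall z x (e : R), A x -> 0 < e -> exists2 d : R, 0 < d &
    forall w y, A y -> normc (w - z) < d -> `|y - x| < d ->
    normc (F w y - F z x) <= e) -> jointly_continuous_on A F.
Proof.
move=> H; apply/subspace_continuousP => -[z x] [_ /= Ax].
apply/cvgrPdist_le => _ /gt0_complex[e e0 ->].
have [d d0 hd] := H z x e Ax e0.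
change (nbhs ((z : R[i]^o), x) (fun wy : R[i]^o * R =>
  ([set: R[i]^o] `*` A) wy -> `|F z x - F wy.1 wy.2| <= e%:C)).
apply: (filterS (P := [set wy : R[i]^o * R | normc (wy.1 - z) < d /\ `|wy.2 - x| < d])).
  move=> [w y]/= [wz yx] [_ Ay]; rewrite /= distrC normrC lecR.
  exact: hd.
exists ([set w : R[i]^o | normc (w - z) < d], [set y : R | `|y - x| < d]) => /=.
  split=> /=.
    apply/nbhs_ballP; exists d%:C; first by rewrite /= ltcR.
    by move=> w; rewrite /ball/= distrC normrC ltcR.
  by apply/nbhs_ballP; exists d => // y; rewrite /ball/= distrC.
by case=> w y [].
Qed.

Lemma jointly_continuous_slice (A : set R) (F : R[i] -> R -> R[i]) z :
  jointly_continuous_on A F -> continuous_on A (F z).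
Proof.
move=> /subspace_continuousP H; apply/subspace_continuousP => x Ax.
have := H (z, x) (conj I Ax); move=> /cvgrPdist_le h; apply/cvgrPdist_le => e e0.
have [[U V] /= [Uz Vx] UV] := h e e0.
change (nbhs x (fun y => A y -> `|F z x - F z y| <= e)).
apply: filterS Vx => y Vy Ay; have := UV (z, y); apply => /=; last by [].
by split; [exact: (@nbhs_singleton R[i]^o)|].
Qed.

Lemma entireI (F : R[i] -> R[i]) : (forall z, exists (D : R[i]) (C : R),
  forall h, normc h <= 1 -> normc (F (z + h) - F z - h * D) <= C * normc h ^+ 2) ->
  entire F.
Proof.
move=> H z; have [D [C hC]] := H z; apply/cvg_ex; exists (D : R[i]^o).
apply/cvgrPdist_le => _ /gt0_complex[e e0 ->].
have C0 : 0 <= `|C| by [].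
pose d := Num.min 1 (e / (`|C| + 1)).
have d0 : 0 < d by rewrite lt_min ltr01 divr_gt0// ltr_wpDl.
have : \forall h \near (0 : R[i]^o), normc h < d.
  apply/nbhs_ballP; exists d%:C; first by rewrite /= ltcR.
  by move=> h; rewrite /ball/= sub0r normrN normrC ltcR.
move=> nh; rewrite near_withinE; apply: filterS nh => h hd h0.
have n0 : 0 < normc h by rewrite lt_neqAle normc_ge0 andbT eq_sym; apply/eqP => /ComplexField.Normc.eq0_normc/eqP; exact/negP.
have -> : D - h^-1 *: ((F \o shift z) (h *: 1) - F z) = - (h^-1 * (F (z + h) - F z - h * D)).
  by rewrite /= /GRing.scale/= mulr1 [h + z]addrC; field.
rewrite normrN normrC lecR normcM ComplexField.Normc.normcV ler_pdivrMl//.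
have h1 : normc h <= 1 by apply/ltW/(lt_le_trans hd); rewrite ge_min lexx.
apply: le_trans (hC h h1) _; rewrite expr2 mulrA mulrAC mulrC ler_wpM2l ?normc_ge0//.
have : normc h <= e / (`|C| + 1) by apply/ltW/(lt_le_trans hd); rewrite ge_min lexx orbT.
by rewrite ler_pdivlMr ?ltr_wpDl//; have := ler_norm C; nra.
Qed.


End ComplexTopology.

(** * Solutions for complex [z] *)

Section Solutions.
Context {R : realType}.
Local Notation mu := (@lebesgue_measure R).
Local Notation posR := (`]0, +oo[%classic : set R).
Local Notation normc := (@ComplexField.Normc.normc R).
Local Notation Re := (@complex.Re R).
Local Notation Im := (@complex.Im R).
Implicit Types (U : R -> R[i]) (F G : R -> R).

Definition rac (a b : R) F := forall e : R, 0 < e -> exists2 d : R, 0 < d &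
  forall (n : nat) (s t : 'I_n -> R),
    (forall i, [/\ a <= s i, s i <= t i & t i <= b]) ->
    trivIset [set: 'I_n] (fun i => `]s i, t i[%classic) ->
    \sum_(i < n) (t i - s i) < d ->
    \sum_(i < n) `|F (t i) - F (s i)| < e.

Lemma rac_abs_continuous a b U : rac a b (fun x => Re (U x)) ->
  rac a b (fun x => Im (U x)) -> abs_continuous a b U.
Proof.
move=> hR hI e e0; have e20 : 0 < e / 2 by lra.
have [d1 d10 h1] := hR _ e20; have [d2 d20 h2] := hI _ e20.
exists (Num.min d1 d2) => [|n s t st tr]; first by rewrite lt_min d10.
rewrite lt_min => /andP[sd1 sd2].
apply: le_lt_trans (_ : _ <= \sum_(i < n) (`|Re (U (t i)) - Re (U (s i))| +
    `|Im (U (t i)) - Im (U (s i))|)) _.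
  apply: ler_sum => i _; apply: le_trans (normc_le _) _.
  by case: (U (t i)) (U (s i)) => [? ?] [? ?].
by rewrite big_split/=; have := h1 n s t st tr sd1; have := h2 n s t st tr sd2; lra.
Qed.

Lemma abs_continuous_eq a b U U1 : (forall x, a <= x -> x <= b -> U x = U1 x) ->
  abs_continuous a b U -> abs_continuous a b U1.
Proof.
move=> E h e e0; have [d d0 hd] := h e e0; exists d => // n s t st tr sd.
rewrite (eq_bigr (fun i => normc (U (t i) - U (s i)))); first exact: hd.
move=> i _; have [as_ st' tb] := st i.
by rewrite !E//; [exact: le_trans tb|exact: le_trans st'].
Qed.

Lemma prim_loc_abs_continuous f g U : prim f (fun x => Re (U x)) ->
  prim g (fun x => Im (U x)) -> loc_abs_continuous U.
Proof.
move=> pf pg a b a0 ab; apply: rac_abs_continuous => e e0.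
  by have [d d0 hd] := prim_ac b pf a0 e0; exists d.
by have [d d0 hd] := prim_ac b pg a0 e0; exists d.
Qed.

Lemma is_derive_eq_pos F G (x f : R) : 0 < x -> (forall t, 0 < t -> F t = G t) ->
  is_derive x 1 F f -> is_derive x 1 G f.
Proof.
move=> x0 FG; apply: near_eq_is_derive.
by near=> t; apply: FG; near: t; exact: lt_nbhsr.
Unshelve. all: by end_near.
Qed.

Lemma cderive_is_derive U (x a b : R) : is_derive x 1 (fun x => Re (U x)) a ->
  is_derive x 1 (fun x => Im (U x)) b -> cderivable U x /\ cderive U x = a +i* b.
Proof.
move=> dR dI; split.
  by split; [exact: (@ex_derive _ _ _ _ _ _ _ dR)|exact: (@ex_derive _ _ _ _ _ _ _ dI)].
by rewrite /cderive !derive1E; congr (_ +i* _);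
  [exact: (@derive_val _ _ _ _ _ _ _ dR)|exact: (@derive_val _ _ _ _ _ _ _ dI)].
Qed.

Lemma cderive_prim U U1 : prim (fun x => Re (U1 x)) (fun x => Re (U x)) ->
  prim (fun x => Im (U1 x)) (fun x => Im (U x)) ->
  cont (fun x => Re (U1 x)) -> cont (fun x => Im (U1 x)) ->
  forall x, 0 < x -> cderivable U x /\ cderive U x = U1 x.
Proof.
move=> pR pI cR cI x x0.
have [h1 h2] := cderive_is_derive (prim_derive pR x0 (cR x x0)) (prim_derive pI x0 (cI x x0)).
by split=> //; rewrite h2; case: (U1 x).
Qed.

Variables (l : R) (q : R -> R).

Definition csolves (z : R[i]) U U1 :=
  [/\ prim (fun x => Re (U1 x)) (fun x => Re (U x)),
      prim (fun x => Im (U1 x)) (fun x => Im (U x)),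
      prim (fun x => pot l q x * Re (U x) + (-1) * Re (z * U x)) (fun x => Re (U1 x)) &
      prim (fun x => pot l q x * Im (U x) + (-1) * Im (z * U x)) (fun x => Im (U1 x))].

Lemma csolves_cderive z U U1 : csolves z U U1 ->
  forall x, 0 < x -> cderivable U x /\ cderive U x = U1 x.
Proof.
move=> [pR pI pR1 pI1]; apply: cderive_prim => //.
  exact: prim_cont pR1.
exact: prim_cont pI1.
Qed.

Lemma csolves_solution z U U1 : csolves z U U1 -> solution l q z U.
Proof.
move=> S; have dU := csolves_cderive S; have [pR pI pR1 pI1] := S.
split.
- by move=> x x0; exact: (dU x x0).1.
- exact: prim_loc_abs_continuous pR pI.
- move=> a b a0 ab; apply: (@abs_continuous_eq a b U1).
    by move=> x ax _; rewrite (dU x _).2//; exact: lt_le_trans ax.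
  exact: (prim_loc_abs_continuous pR1 pI1).
apply: ae_imp2 (prim_ae pR1) (prim_ae pI1) => x hR hI x0.
have E t : 0 < t -> Re (U1 t) = Re (cderive U t) by move=> t0; rewrite (dU t t0).2.
have E' t : 0 < t -> Im (U1 t) = Im (cderive U t) by move=> t0; rewrite (dU t t0).2.
have [h1 ->] := cderive_is_derive (is_derive_eq_pos x0 E (hR x0))
  (is_derive_eq_pos x0 E' (hI x0)).
split=> //; rewrite -/(V0 l x) -/(pot l q x).
move: (pot l q x) => P; case: (U x) => a b; case: (z) => c d.
by apply/eqP; rewrite eq_complex/=; apply/andP; split; apply/eqP; ring.
Qed.

Section Family.
Variables (w : R -> R) (u u1 : nat -> R -> R).
Hypothesis (qi : forall y x, 0 < y -> itg q y x) (cw : cont w) (hu : coef_family (pot l q) w u u1).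

Lemma family_decay x : 0 < x -> decay (u ^~ x).
Proof.
move=> x0 r r0; have [_ _ _ /(_ x r r0)[K K0 hK]] := hu.
exists `|K * w x| => // n; apply: le_trans (hK n x x0 (lexx _)) _.
by rewrite ler_wpM2r ?invr_ge0 ?exprn_ge0 ?(ltW r0)// ler_norm.
Qed.

(** Since the coefficients are real, [ser_solution] is applied once with [Re (z ^+ n)] and once with
    [Im (z ^+ n)]; the shifted series it produces is that of [z] times the sum. *)
Lemma family_csolves z : exists U1, csolves z (fun x => cpow (u ^~ x) z) U1.
Proof.
have [pu pu0 puS ub] := hu.
have Vi y x : 0 < y -> itg (pot l q) y x.
  move=> y0; apply: itgD; last exact: qi.
  by apply: cont_itg y0; exact: cont_V0.
have m1i y x : 0 < y -> itg (fun=> -1 : R) y x by move=> _; exact: itg_cst.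
have ub' y x (r : R) : 0 < y -> 0 < r -> exists2 K, 0 <= K &
    forall n t, y < t <= x -> `|u n t| <= K / r ^+ n.
  move=> y0 r0; have [K K0 hK] := ub x r r0; have [M M0 hM] := cont_bounded x cw y0.
  exists (K * M); first by rewrite mulr_ge0// ltW.
  move=> n t /andP[yt tx]; have t0 : 0 < t by exact: lt_trans yt.
  apply: le_trans (hK n t t0 tx) _.
  rewrite ler_wpM2r ?invr_ge0 ?exprn_ge0 ?(ltW r0)// ler_wpM2l//.
  by apply: le_trans (ler_norm _) (hM t _); rewrite (ltW yt) tx.
have [D [s [D0 s0 hz]]] := growthX z.
have zE x : 0 < x -> z * cpow (u ^~ x) z = csum (fun n => z ^+ n.+1) (u ^~ x).
  move=> x0; rewrite /cpow -csumZ//; [|exact: growthX|exact: family_decay].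
  by congr csum; apply/funext => n; rewrite exprS.
have [a1 [pa pa1 _]] := ser_solution Vi m1i pu pu0 puS ub' s0 D0
  (fun n => le_trans (Re_le_normc (z ^+ n)) (hz n)).
have [b1 [pb pb1 _]] := ser_solution Vi m1i pu pu0 puS ub' s0 D0
  (fun n => le_trans (Im_le_normc (z ^+ n)) (hz n)).
exists (fun x => a1 x +i* b1 x); split=> //.
  by apply: eq_prim pa1 => // x x0; rewrite zE.
by apply: eq_prim pb1 => // x x0; rewrite zE.
Qed.

End Family.
End Solutions.

(** * Joint continuity of power series with continuous coefficients *)

Section JointContinuity.
Context {R : realType}.
Local Notation normc := (@ComplexField.Normc.normc R).
Local Notation Re := (@complex.Re R).
Local Notation Im := (@complex.Im R).

Lemma ser_continuous_on (A : set R) (M : R) (a : nat -> R -> R) (x e : R) :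
  (forall y, A y -> geobd M (fun n => a n y)) -> A x ->
  (forall n (e : R), 0 < e -> exists2 d, 0 < d & forall y, A y -> `|y - x| < d ->
    `|a n y - a n x| <= e) -> 0 < e ->
  exists2 d, 0 < d & forall y, A y -> `|y - x| < d ->
    `|ser (a ^~ y) - ser (a ^~ x)| <= e.
Proof.
move=> hM Ax ca e0; have e40 : 0 < e / 4 by lra.
have [N hN] := geo_small (2 * M) e40.
have [d d0 hd] : exists2 d, 0 < d & forall y, A y -> `|y - x| < d ->
    `|\sum_(0 <= k < N) a k y - \sum_(0 <= k < N) a k x| <= e / 2.
  have : 0 < e / 2 by lra.
  move: {e e0 e40 hN}(e / 2); elim: N => [|N IH] e e0.
    by exists 1 => // y _ _; rewrite !big_nil subrr normr0 ltW.
  have e20 : 0 < e / 2 by lra.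
  have [d1 d10 h1] := IH _ e20; have [d2 d20 h2] := ca N _ e20.
  exists (Num.min d1 d2) => [|y Ay]; first by rewrite lt_min d10.
  rewrite lt_min => /andP[yd1 yd2]; rewrite !big_nat_recr//= opprD addrACA.
  by apply: le_trans (ler_normD _ _) _; have := h1 y Ay yd1; have := h2 y Ay yd2; lra.
exists d => // y Ay yd; have := hd y Ay yd.
have := ser_tail N (hM y Ay); have := ser_tail N (hM x Ax); move: hN.
move: (2 * M / _) (ser _) (ser _) (\sum_(_ <= _ < _) _) (\sum_(_ <= _ < _) _) => K s1 s2 t1 t2.
by rewrite !ler_norml => ? /andP[? ?] /andP[? ?] /andP[? ?]; apply/andP; split; lra.
Qed.

(** The increment is split at [(z, y)]: moving the parameter is Lipschitz uniformly in [y], and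
    moving [x] with [z] fixed is continuity of two uniformly convergent real series. *)
Lemma cpow_joint (A : set R) (v : nat -> R -> R) z x (e : R) :
  (forall r : R, 0 < r -> exists2 K, 0 <= K & forall n y, A y -> `|v n y| <= K / r ^+ n) ->
  (forall n x (e : R), A x -> 0 < e -> exists2 d, 0 < d & forall y, A y -> `|y - x| < d ->
    `|v n y - v n x| <= e) ->
  A x -> 0 < e -> exists2 d : R, 0 < d & forall w y, A y -> normc (w - z) < d ->
    `|y - x| < d -> normc (cpow (v ^~ y) w - cpow (v ^~ x) z) <= e.
Proof.
move=> bv cv Ax e0; pose s := normc z + 1.
have s1 : 1 <= s by rewrite lerDr normc_ge0.
have s0 : 0 < s by exact: lt_le_trans s1.
have [K K0 hK] := bv (4 * s) (mulr_gt0 (ltr0Sn _ _) s0).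
have [K' K'0 hK'] := bv (2 * s) (mulr_gt0 (ltr0Sn _ _) s0).
have dv y : A y -> decay (v ^~ y).
  by move=> Ay r /bv[L L0 hL]; exists L => // n; exact: hL.
have comp (c : nat -> R) : (forall n, `|c n| <= 1 * s ^+ n) ->
    exists2 d, 0 < d & forall y, A y -> `|y - x| < d ->
      `|ser (fun n => c n * v n y) - ser (fun n => c n * v n x)| <= e / 4.
  move=> hc; apply: (@ser_continuous_on A (1 * K') (fun n y => c n * v n y)) => //.
  - by move=> y Ay; apply: geobd_pow hc _ => // n; exact: hK'.
  - move=> n e' e'0; have e''0 : 0 < e' / (1 * s ^+ n) by rewrite divr_gt0 ?mul1r ?exprn_gt0.
    have [d d0 hd] := cv n x _ Ax e''0; exists d => // y Ay yd.
    rewrite -mulrBr normrM; apply: le_trans (ler_pM _ _ (hc n) (hd y Ay yd)) _ => //.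
    by rewrite mulrC divfK// mul1r expf_neq0// gt_eqF.
  - by lra.
have zn n : normc (z ^+ n) <= 1 * s ^+ n.
  by rewrite mul1r normcX lerXn2r ?nnegrE ?normc_ge0 ?(ltW s0)// lerDl.
have [d1 d10 h1] := comp _ (fun n => le_trans (Re_le_normc (z ^+ n)) (zn n)).
have [d2 d20 h2] := comp _ (fun n => le_trans (Im_le_normc (z ^+ n)) (zn n)).
have d30 : 0 < e / 2 / (4 * K + 1) by rewrite !divr_gt0// ltr_wpDl// mulr_ge0.
exists (Num.min (Num.min d1 d2) (Num.min 1 (e / 2 / (4 * K + 1)))).
  by rewrite !lt_min d10 d20 ltr01.
move=> w y Ay; rewrite !lt_min => /andP[_ /andP[w1 wd]] /andP[/andP[yd1 yd2] _].
have ws : normc w <= s.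
  rewrite -(subrK z w) (le_trans (normcD _ _))// /s addrC lerD2l.
  exact: ltW.
have zs : normc z <= s by rewrite /s lerDl.
have i1 := cpow_lipschitz s1 (fun n => hK n y Ay) (dv y Ay) zs ws.
have i2 : normc (cpow (v ^~ y) z - cpow (v ^~ x) z) <= e / 2.
  apply: le_trans (normc_le _) _ => /=.
  by have := h1 y Ay yd1; have := h2 y Ay yd2; lra.
have i3 : 4 * K * normc (w - z) <= e / 2.
  move: wd; rewrite ltr_pdivlMr ?ltr_wpDl ?mulr_ge0//.
  by have := normc_ge0 (w - z); nra.
rewrite -(subrKA (cpow (v ^~ y) z)); apply: le_trans (normcD _ _) _.
by have := le_trans i1 i3; lra.
Qed.

End JointContinuity.

(** * Normalized coefficients, extended to the endpoint *)

Section Quotient.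
Context {R : realType}.
Local Notation normc := (@ComplexField.Normc.normc R).

(* the value [(n == 0)%:R] at [0] is the limit of [u n / W] there *)
Definition qcoef (W : R -> R) (u : nat -> R -> R) n x :=
  if 0 < x then u n x / W x else (n == 0%N)%:R.

Variables (W : R -> R) (u : nat -> R -> R).

Lemma qcoef_cpow z x : 0 < x -> W x != 0 -> decay (u ^~ x) ->
  cpow (u ^~ x) z = (W x)%:C * cpow (qcoef W u ^~ x) z.
Proof.
move=> x0 Wx du; have dq : decay (qcoef W u ^~ x).
  move=> r /du[K K0 hK]; exists (K * `|(W x)^-1|) => [|n]; first by rewrite mulr_ge0.
  by rewrite /qcoef x0 normrM mulrAC ler_wpM2r.
rewrite /cpow -csumMr//; last exact: growthX.
by congr csum; apply/funext => n; rewrite /qcoef x0 mulrC divfK.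
Qed.

Lemma cpow_qcoef0 z : cpow (qcoef W u ^~ 0) z = 1.
Proof.
rewrite -(cpow0 z) /cpow; congr csum.
by apply/funext => n; rewrite /qcoef ltxx.
Qed.

(** The right end is a parameter because [W] must be positive up to it: the logarithmic [fb]
    vanishes at [1] and requires [X < 1], while [fA], and [fb] for [l > -1/2], allow [X = 1]. *)
Variable X : R.
Hypothesis W0 : forall x, 0 < x -> x <= X -> 0 < W x.
Hypothesis cW : forall x, 0 < x -> {for x, continuous W}.
Hypothesis cu : forall n, cont (u n).
Hypothesis ub : forall r : R, 0 < r -> exists2 K, 0 <= K &
  forall n x, 0 < x -> x <= X -> `|u n x| <= K * W x / r ^+ n.
Hypothesis u0 : forall e : R, 0 < e -> exists2 d, 0 < d &
  forall x, 0 < x -> x <= d -> `|u 0%N x / W x - 1| <= e.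
Hypothesis uS : forall n (e : R), 0 < e -> exists2 d, 0 < d &
  forall x, 0 < x -> x <= d -> `|u n.+1 x / W x| <= e.

Lemma qcoef_bound (r : R) : 0 < r -> exists2 K, 0 <= K &
  forall n x, 0 <= x <= X -> `|qcoef W u n x| <= K / r ^+ n.
Proof.
move=> r0; have [K K0 hK] := ub r0; exists (Num.max K 1); first by rewrite le_max K0.
move=> n x /andP[x0 xX]; rewrite /qcoef; case: ifPn => [{}x0|_].
  rewrite normrM normfV (gtr0_norm (W0 x0 xX)) ler_pdivrMr ?W0//.
  apply: le_trans (hK n x x0 xX) _; rewrite [X in X <= _]mulrAC ler_wpM2r ?(ltW (W0 x0 xX))//.
  by rewrite ler_wpM2r ?invr_ge0 ?exprn_ge0 ?(ltW r0)// le_max lexx.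
case: n => [|n]; first by rewrite normr1 expr0 divr1 le_max lexx orbT.
by rewrite normr0 divr_ge0 ?exprn_ge0 ?(ltW r0)// le_max ler01 orbT.
Qed.

Lemma qcoef_lim0 n (e : R) : 0 < e -> exists2 d, 0 < d &
  forall x, 0 <= x -> x <= d -> `|qcoef W u n x - qcoef W u n 0| <= e.
Proof.
move=> e0; have [d d0 hd] : exists2 d, 0 < d & forall x, 0 < x -> x <= d ->
    `|u n x / W x - (n == 0%N)%:R| <= e.
  case: n => [|n]; first exact: u0.
  by have [d d0 hd] := uS n e0; exists d => // x x0 xd; rewrite subr0 hd.
exists d => // x; rewrite le_eqVlt => /predU1P[<- _|x0 xd].
  by rewrite subrr normr0 ltW.
by rewrite /qcoef x0 ltxx hd.
Qed.

Lemma qcoef_continuous n x (e : R) : 0 <= x <= X -> 0 < e -> exists2 d, 0 < d &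
  forall y, 0 <= y <= X -> `|y - x| < d -> `|qcoef W u n y - qcoef W u n x| <= e.
Proof.
move=> /andP[]; rewrite le_eqVlt => /predU1P[<- _ e0|x0 xX e0].
  have [d d0 hd] := qcoef_lim0 n e0; exists d => // y /andP[y0 _].
  by rewrite subr0 ger0_norm// => /ltW; exact: hd.
have cq : {for x, continuous (fun y => u n y / W y)}.
  by apply: cvgM; [exact: cu|apply: cvgV; [rewrite gt_eqF// W0|exact: cW]].
have [d d0 hd] := (contP _ _).1 cq e e0.
exists (Num.min d x) => [|y _]; first by rewrite lt_min d0.
rewrite lt_min => /andP[yd yx]; have y0 : 0 < y by move: yx; rewrite ltr_norml; lra.
by rewrite /qcoef y0 x0 ltW// hd.
Qed.

Lemma qcoef_joint z x (e : R) : 0 <= x <= X -> 0 < e -> exists2 d : R, 0 < d &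
  forall w y, 0 <= y <= X -> normc (w - z) < d -> `|y - x| < d ->
    normc (cpow (qcoef W u ^~ y) w - cpow (qcoef W u ^~ x) z) <= e.
Proof.
by apply: (@cpow_joint R (fun y => 0 <= y <= X)); [exact: qcoef_bound|exact: qcoef_continuous].
Qed.

End Quotient.

(** * Sobolev regularity of the normalized solutions *)

Section SobolevRegularity.
Context {R : realType}.
Local Notation mu := (@lebesgue_measure R).
Local Notation posR := (`]0, +oo[%classic : set R).
Local Notation normc := (@ComplexField.Normc.normc R).
Local Notation Re := (@complex.Re R).
Local Notation Im := (@complex.Im R).

(** The integral bound on increments is known between positive points; inserting a point close to
    [0] and using continuity there extends it to the endpoint. *)
Lemma rac_closed (F w : R -> R) : prim w F -> itg w 0 1 ->
  (forall e : R, 0 < e -> exists2 d, 0 < d & forall x, 0 < x -> x <= d -> `|F x - F 0| <= e) ->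
  rac 0 1 F.
Proof.
move=> pF wi F0 e e0; have wni := itg_norm wi.
have H s t : 0 <= s -> s <= t -> t <= 1 -> `|F t - F s| <= oint (fun u => `|w u|) s t.
  rewrite le_eqVlt => /predU1P[<-|s0 st _]; last exact: prim_dist.
  rewrite le_eqVlt => /predU1P[<- _|t0 t1]; first by rewrite subrr normr0 oint_ge0.
  apply/ler_addgt0Pl => r r0; have [d d0 hd] := F0 r r0.
  pose y := Num.min d t; have y0 : 0 < y by rewrite lt_min d0.
  have yt : y <= t by rewrite ge_min lexx orbT.
  have yd : y <= d by rewrite ge_min lexx.
  rewrite -(subrKA (F y)) addrC; apply: le_trans (ler_normD _ _) _; apply: lerD.
    exact: hd.
  apply: le_trans (prim_dist pF y0 yt) _.
  by apply: le_oint_itv => //; [exact: ltW|exact: itgS wni].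
have [d d0 hd] := oint_sum_disj wi e0; exists d => // n s t st tr sd.
apply: le_lt_trans (hd n s t st tr sd); apply: ler_sum => i _.
by have [? ? ?] := st i; exact: H.
Qed.

Lemma cont_sqrt (F : R -> R) : cont F -> cont (fun x => Num.sqrt (F x)).
Proof. by move=> cF x x0; apply: (continuous_comp (cF _ x0)); exact: sqrt_continuous. Qed.

Lemma cont_normc (U : R -> R[i]) : cont (fun x => Re (U x)) -> cont (fun x => Im (U x)) ->
  cont (fun x => normc (U x)).
Proof.
move=> cR cI; apply: (@cont_eq R (fun x => Num.sqrt (Re (U x) * Re (U x) + Im (U x) * Im (U x)))).
  by move=> x _; case: (U x) => a b; rewrite /normc/= !expr2.
by apply: cont_sqrt; apply: contD; exact: contM.
Qed.

Definition cratio (F : R -> R) (U Ut Wt : R -> R[i]) :=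
  [/\ prim (fun x => Re (Wt x)) (fun x => Re (Ut x)),
      prim (fun x => Im (Wt x)) (fun x => Im (Ut x)),
      cont (fun x => Re (Wt x)), cont (fun x => Im (Wt x)) &
      forall x, 0 < x -> U x = (F x)%:C * Ut x].

Lemma cratio_cderive F U Ut Wt : cratio F U Ut Wt ->
  forall x, 0 < x -> cderivable Ut x /\ cderive Ut x = Wt x.
Proof. by move=> [pR pI cR cI _]; exact: cderive_prim. Qed.

Lemma is_derive_uniq (F : R -> R) (x a b : R) : is_derive x 1 F a -> is_derive x 1 F b ->
  a = b.
Proof.
move=> h1 h2; rewrite -(@derive_val _ _ _ _ _ _ _ h1).
exact: (@derive_val _ _ _ _ _ _ _ h2).
Qed.

Lemma cratio_derivative l q z F F1 U U1 Ut Wt : csolves l q z U U1 ->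
  prim F1 F -> cont F1 -> cratio F U Ut Wt ->
  forall x, 0 < x -> U1 x = (F1 x)%:C * Ut x + (F x)%:C * Wt x.
Proof.
move=> [pR pI pR1 pI1] pF cF1 [qR qI cR cI UE] x x0.
have dF := prim_derive pF x0 (cF1 x x0).
have hR : Re (U1 x) = F1 x * Re (Ut x) + F x * Re (Wt x).
  apply: (@is_derive_uniq (fun x => Re (U x)) x).
    exact: (prim_derive pR x0 (prim_cont pR1 x0)).
  apply: (@is_derive_eq_pos _ (fun t => F t * Re (Ut t))) => //.
    by move=> t t0; rewrite UE//; case: (Ut t) => a b /=; ring.
  apply: is_derive_eq (is_deriveM dF (prim_derive qR x0 (cR x x0))) _.
  by rewrite /GRing.scale/= addrC mulrC.
have hI : Im (U1 x) = F1 x * Im (Ut x) + F x * Im (Wt x).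
  apply: (@is_derive_uniq (fun x => Im (U x)) x).
    exact: (prim_derive pI x0 (prim_cont pI1 x0)).
  apply: (@is_derive_eq_pos _ (fun t => F t * Im (Ut t))) => //.
    by move=> t t0; rewrite UE//; case: (Ut t) => a b /=; ring.
  apply: is_derive_eq (is_deriveM dF (prim_derive qI x0 (cI x x0))) _.
  by rewrite /GRing.scale/= addrC mulrC.
move: hR hI; case: (U1 x) (Ut x) (Wt x) => [a b] [c d] [e f] /= -> ->.
by apply/eqP; rewrite eq_complex/=; apply/andP; split; apply/eqP; ring.
Qed.

Lemma W1p01I (p : \bar R) (F : R -> R) (U Ut Wt : R -> R[i]) (E : R -> R) (C : R) :
  (1 <= p)%E -> cratio F U Ut Wt -> measurable_fun posR E -> Lp01 p E ->
  (forall x, 0 < x -> x <= 1 -> normc (Wt x) <= C * `|E x|) ->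
  (forall e : R, 0 < e -> exists2 d, 0 < d &
    forall x, 0 < x -> x <= d -> normc (Ut x - Ut 0) <= e) ->
  W1p01 p Ut.
Proof.
move=> p1 S mE hE WE U0; have [pR pI cR cI _] := S.
have WR : Lp01 p (fun x => Re (Wt x)).
  apply: (Lp01_le (C := C) p1 (cont_measT cR) mE) hE => t t0 t1.
  exact: le_trans (Re_le_normc _) (WE t t0 t1).
have WI : Lp01 p (fun x => Im (Wt x)).
  apply: (Lp01_le (C := C) p1 (cont_measT cI) mE) hE => t t0 t1.
  exact: le_trans (Im_le_normc _) (WE t t0 t1).
split.
  apply: rac_abs_continuous.
    apply: (rac_closed pR (Lp01_itg (cont_measT cR) p1 WR)) => e /U0[d d0 hd].
    exists d => // x x0 xd; apply: le_trans (hd x x0 xd).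
    by have := Re_le_normc (Ut x - Ut 0); case: (Ut x) (Ut 0) => [a b] [c d'].
  apply: (rac_closed pI (Lp01_itg (cont_measT cI) p1 WI)) => e /U0[d d0 hd].
  exists d => // x x0 xd; apply: le_trans (hd x x0 xd).
  by have := Im_le_normc (Ut x - Ut 0); case: (Ut x) (Ut 0) => [a b] [c d'].
have D01 : `]0, 1[%classic `<=` posR.
  by move=> x; rewrite /= !in_itv/= andbT => /andP[].
exists Wt.
  split.
  - by apply: (@measurable_funS _ _ _ _ posR) => //; exact: cont_measT cR.
  - by apply: (@measurable_funS _ _ _ _ posR) => //; exact: cont_measT cI.
  - apply: (Lp01_le (C := C) p1 (cont_measT (cont_normc cR cI)) mE) hE => t t0 t1.
    by rewrite /= ger0_norm ?normc_ge0// WE.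
apply: aeW => x /andP[x0 _]; exact: cratio_cderive S x x0.
Qed.

End SobolevRegularity.

(** * Quotients of complex solutions *)

Section LiftedRatios.
Context {R : realType}.
Local Notation mu := (@lebesgue_measure R).
Local Notation posR := (`]0, +oo[%classic : set R).
Local Notation normc := (@ComplexField.Normc.normc R).
Local Notation Re := (@complex.Re R).
Local Notation Im := (@complex.Im R).
Variables (l : R) (q : R -> R).
Hypothesis hl : - 2^-1 <= l.
Hypothesis mq : measurable_fun posR q.
Hypothesis hq : forall X, itg (fun t => fA l t * fB l t * q t) 0 X.
Variables (z : R[i]) (U U1 Ut : R -> R[i]) (C : R).
Hypothesis SU : csolves l q z U U1.

Let cmul : cont (fun x => Re (z * U x)) /\ cont (fun x => Im (z * U x)).
Proof.
have [pR pI _ _] := SU; have cR := prim_cont pR; have cI := prim_cont pI.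
split.
  apply: (@cont_eq R (fun x => Re z * Re (U x) - Im z * Im (U x))).
    by move=> x _; case: (z) (U x) => [a b] [c d].
  by apply: contB; apply: contM => //; exact: cont_cst.
apply: (@cont_eq R (fun x => Re z * Im (U x) + Im z * Re (U x))).
  by move=> x _; case: (z) (U x) => [a b] [c d].
by apply: contD; apply: contM => //; exact: cont_cst.
Qed.

Let bnds (F : R -> R) : (forall x, 0 < x -> 0 < F x) ->
  (forall x, 0 < x -> x <= 1 -> normc (U x) <= C * F x) ->
  let C' := C + normc z * C in forall x, 0 < x -> x <= 1 ->
  [/\ `|Re (U x)| <= C' * F x, `|Im (U x)| <= C' * F x,
      `|Re (z * U x)| <= C' * F x & `|Im (z * U x)| <= C' * F x].
Proof.
move=> F0 hU C' x x0 x1; have h := hU x x0 x1; have Fx := F0 x x0.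
have C0 : 0 <= C by have := le_trans (normc_ge0 _) h; rewrite pmulr_lge0.
have h1 : normc (U x) <= C' * F x.
  by apply: le_trans h _; rewrite ler_wpM2r ?(ltW Fx)// lerDl mulr_ge0 ?normc_ge0.
have h2 : normc (z * U x) <= C' * F x.
  rewrite normcM; apply: le_trans (ler_wpM2l (normc_ge0 z) h) _.
  by rewrite mulrA ler_wpM2r ?(ltW Fx)// lerDr.
split.
- exact: le_trans (Re_le_normc _) h1.
- exact: le_trans (Im_le_normc _) h1.
- exact: le_trans (Re_le_normc _) h2.
- exact: le_trans (Im_le_normc _) h2.
Qed.

Let reim (F : R -> R) x : 0 < F x -> U x = (F x)%:C * Ut x ->
  Re (U x) / F x = Re (Ut x) /\ Im (U x) / F x = Im (Ut x).
Proof.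
by move=> F0 ->; case: (Ut x) => a b /=; split; field; rewrite gt_eqF.
Qed.

(** The real and imaginary parts of [U] solve real equations coupled only through [z U]. Taking that
    term as the inhomogeneity [v] of [regular_ratio] decouples them; [C'] bounds both [U] and
    [z U]. *)
Lemma complex_regular_ratio : (forall x, 0 < x -> U x = (fA l x)%:C * Ut x) ->
  (forall x, 0 < x -> x <= 1 -> normc (U x) <= C * fA l x) ->
  exists Wt (K : R), [/\ cratio (fA l) U Ut Wt,
    forall x, 0 < x -> x <= 1 -> normc (Wt x) <= K *
      `|x `^ (- (2 * l + 1) - 1) * oint (fun t => t `^ (2 * l + 1) * Gw q t) 0 x| &
    forall e : R, 0 < e -> exists2 d, 0 < d &
      forall x, 0 < x -> x <= d -> normc (x%:C * Wt x) <= e].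
Proof.
move=> UE hU; have [pR pI pR1 pI1] := SU; have [cR cI] := cmul.
have bd := bnds (fA_gt0 l) hU; set C' := C + normc z * C in bd.
have [wR [pwR cwR bR lR]] := regular_ratio hl mq hq (C := C') pR pR1 cR
  (fun t t0 t1 => let: And4 a _ _ _ := bd t t0 t1 in a)
  (fun t t0 t1 => let: And4 _ _ a _ := bd t t0 t1 in a).
have [wI [pwI cwI bI lI]] := regular_ratio hl mq hq (C := C') pI pI1 cI
  (fun t t0 t1 => let: And4 _ a _ _ := bd t t0 t1 in a)
  (fun t t0 t1 => let: And4 _ _ _ a := bd t t0 t1 in a).
exists (fun x => wR x +i* wI x), (C' + C'); split.
- split=> //=.
    by apply: eq_prim pwR => // x x0; rewrite (reim (fA_gt0 l x0) (UE x x0)).1.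
  by apply: eq_prim pwI => // x x0; rewrite (reim (fA_gt0 l x0) (UE x x0)).2.
- move=> x x0 x1; apply: le_trans (normc_le _) _; rewrite mulrDl /=.
  by apply: lerD; [exact: bR|exact: bI].
move=> e e0; have e20 : 0 < e / 2 by lra.
have [d1 d10 h1] := lR _ e20; have [d2 d20 h2] := lI _ e20.
exists (Num.min d1 d2) => [|x x0]; first by rewrite lt_min d10.
rewrite le_min => /andP[xd1 xd2].
rewrite (_ : _ * _ = (x * wR x) +i* (x * wI x)); last first.
  by apply/eqP; rewrite eq_complex/=; apply/andP; split; apply/eqP; ring.
apply: le_trans (normc_le _) _ => /=.
by have := h1 x x0 xd1; have := h2 x x0 xd2; lra.
Qed.

Lemma complex_singular_ratio (hl' : - 2^-1 < l) :
  (forall x, 0 < x -> U x = (fb l x)%:C * Ut x) ->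
  (forall x, 0 < x -> x <= 1 -> normc (U x) <= C * x `^ (- l)) ->
  exists Wt (K : R), [/\ cratio (fb l) U Ut Wt,
    forall x, 0 < x -> x <= 1 -> normc (Wt x) <= K *
      `|x `^ (2 * l + 1 - 1) * (1 - sint 1 (fun t => t `^ (- (2 * l + 1)) * Gw q t) x)| &
    forall e : R, 0 < e -> exists2 d, 0 < d &
      forall x, 0 < x -> x <= d -> normc (x%:C * Wt x) <= e].
Proof.
move=> UE hU; have [pR pI pR1 pI1] := SU.
have P0 (x : R) : 0 < x -> 0 < x `^ (- l) by exact: powR_gt0.
have bd := bnds P0 hU; set C' := C + normc z * C in bd.
have [wR [CR [pwR cwR bR lR]]] := singular_ratio hl mq hq (C := C') hl' pR pR1
  (fun t t0 t1 => let: And4 a _ _ _ := bd t t0 t1 in a)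
  (fun t t0 t1 => let: And4 _ _ a _ := bd t t0 t1 in a).
have [wI [CI [pwI cwI bI lI]]] := singular_ratio hl mq hq (C := C') hl' pI pI1
  (fun t t0 t1 => let: And4 _ a _ _ := bd t t0 t1 in a)
  (fun t t0 t1 => let: And4 _ _ _ a := bd t t0 t1 in a).
pose g := 2 * l + 1; have g0 : 0 < g by have := hl'; rewrite /g; lra.
have fE x : fb l x = x `^ (- l) / g by rewrite /fb hl'.
have F0 x : 0 < x -> 0 < fb l x by move=> x0; rewrite fE divr_gt0// P0.
(* [singular_ratio] divides by [x ^ (- l)], whereas [Ut] is the quotient by [fb = x ^ (- l) / g];
   hence the factor [g]. *)
exists (fun x => (g * wR x) +i* (g * wI x)), (g * (CR + CI)); split.
- split=> /=.
  + apply: eq_prim (primZ g pwR) => // x x0.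
    by rewrite -(reim (F0 x x0) (UE x x0)).1 fE; field; rewrite !gt_eqF// P0.
  + apply: eq_prim (primZ g pwI) => // x x0.
    by rewrite -(reim (F0 x x0) (UE x x0)).2 fE; field; rewrite !gt_eqF// P0.
  + by apply: contM => //; exact: cont_cst.
  + by apply: contM => //; exact: cont_cst.
  + exact: UE.
- move=> x x0 x1; apply: le_trans (normc_le _) _ => /=.
  rewrite !normrM (gtr0_norm g0) -mulrDr -mulrA ler_wpM2l ?(ltW g0)// -normrM mulrDl.
  by apply: lerD; [exact: bR|exact: bI].
move=> e e0; have e20 : 0 < e / 2 / g by rewrite !divr_gt0.
have [d1 d10 h1] := lR _ e20; have [d2 d20 h2] := lI _ e20.
exists (Num.min d1 d2) => [|x x0]; first by rewrite lt_min d10.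
rewrite le_min => /andP[xd1 xd2].
rewrite (_ : _ * _ = (g * (x * wR x)) +i* (g * (x * wI x))); last first.
  by apply/eqP; rewrite eq_complex/=; apply/andP; split; apply/eqP; ring.
apply: le_trans (normc_le _) _ => /=.
have := h1 x x0 xd1; have := h2 x x0 xd2; rewrite !ler_pdivlMr//.
by rewrite ![`|g * _|]normrM (gtr0_norm g0); lra.
Qed.

End LiftedRatios.

Section Entire.
Context {R : realType}.
Local Notation normc := (@ComplexField.Normc.normc R).

Lemma cpow_entire (a : nat -> R) : decay a -> entire (cpow a).
Proof.
move=> da; apply: entireI => z; pose s := normc z + 1.
have s1 : 1 <= s by rewrite lerDr normc_ge0.
have s0 : 0 < s by exact: lt_le_trans s1.
have [K K0 hK] := da (8 * s) (mulr_gt0 (ltr0Sn _ _) s0).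
exists (csum (dpow z) a), (4 * K) => h h1.
apply: (cpow_taylor s1) => //; first by rewrite lerDl.
by apply: le_trans (normcD _ _) _; rewrite lerD2l.
Qed.

End Entire.

(** * The fundamental system *)

Section Assembly.
Context {R : realType}.
Local Notation mu := (@lebesgue_measure R).
Local Notation posR := (`]0, +oo[%classic : set R).
Local Notation normc := (@ComplexField.Normc.normc R).
Variables (l : R) (p : \bar R) (q : R -> R).
Hypothesis hl : - 2^-1 <= l.
Hypothesis mq : measurable_fun posR q.
Hypothesis qi : forall y x, 0 < y -> itg q y x.
Hypothesis hq : forall X, itg (fun t => fA l t * fB l t * q t) 0 X.

Lemma fb_gt0 x : 0 < x -> - 2^-1 < l \/ x < 1 -> 0 < fb l x.
Proof.
move=> x0; rewrite /fb; case: ifPn => [h _|_ [//|x1]].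
  by rewrite divr_gt0 ?powR_gt0//; lra.
by rewrite mulr_gt0 ?powR_gt0// oppr_gt0 ln_lt0// x0.
Qed.

(** In the logarithmic case [x <= X < 1] gives [1 <= (- ln x) / (- ln X)], which bounds [1 + |ln x|]
    by a multiple of [- ln x] on the whole interval and not only near [0]. *)
Lemma fB_le_fb_itv X : - 2^-1 < l \/ X < 1 -> exists2 C, 0 <= C &
  forall x, 0 < x -> x <= X -> fB l x <= C * fb l x.
Proof.
have [h _|h [//|X1]] := ltP (- 2^-1) l.
  have g0 : 0 < 2 * l + 1 by lra.
  exists (2 * l + 1) => [|x x0 _]; first exact: ltW.
  by rewrite /fB /fb /lw h mulr1 mulrCA divff ?mulr1// gt_eqF.
have lE : l = - 2^-1 by apply/eqP; rewrite eq_le h hl.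
have [X0|X0] := leP X 0.
  by exists 0 => // x x0 /(lt_le_trans x0); rewrite ltNge X0.
have L0 : 0 < - ln X by rewrite oppr_gt0 ln_lt0// X0.
exists (1 + (- ln X)^-1) => [|x x0 xX]; first by rewrite addr_ge0 ?invr_ge0 ?ltW.
have lx : - ln X <= - ln x by rewrite lerN2 ler_ln ?posrE.
rewrite /fB /fb /lw lE ltxx opprK ler0_norm; last by lra.
rewrite mulrA [_ * x `^ _]mulrC ler_wpM2l ?powR_ge0//.
rewrite mulrDl mul1r addrC lerD2l mulrC ler_pdivlMr//.
by rewrite mul1r.
Qed.

Variables (u u1 v v1 : nat -> R -> R).
Hypotheses (hu : coef_family (pot l q) (fA l) u u1) (hv : coef_family (pot l q) (fB l) v v1).
Hypothesis u0 : forall e : R, 0 < e -> exists2 d, 0 < d &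
  forall x, 0 < x -> x <= d -> `|u 0%N x / fA l x - 1| <= e.
Hypothesis uS : forall n (e : R), 0 < e -> exists2 d, 0 < d &
  forall x, 0 < x -> x <= d -> `|u n.+1 x / fA l x| <= e.
Hypothesis v0 : forall e : R, 0 < e -> exists2 d, 0 < d &
  forall x, 0 < x -> x <= d -> `|v 0%N x / fb l x - 1| <= e.
Hypothesis vS : forall n (e : R), 0 < e -> exists2 d, 0 < d &
  forall x, 0 < x -> x <= d -> `|v n.+1 x / fb l x| <= e.

Let phi z x := cpow (u ^~ x) z.
Let theta z x := cpow (v ^~ x) z.
Let phit z x := cpow (qcoef (fA l) u ^~ x) z.
Let thetat z x := cpow (qcoef (fb l) v ^~ x) z.

Let phiE z x : 0 < x -> phi z x = (fA l x)%:C * phit z x.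
Proof.
move=> x0; apply: qcoef_cpow => //; first by rewrite gt_eqF// fA_gt0.
exact: (family_decay hu).
Qed.

Let thetaE z x : 0 < x -> fb l x != 0 -> theta z x = (fb l x)%:C * thetat z x.
Proof. by move=> x0 fx; apply: qcoef_cpow => //; exact: (family_decay hv). Qed.

Let phit_joint z x (e X : R) : 0 <= x <= X -> 0 < e -> exists2 d : R, 0 < d &
  forall w y, 0 <= y <= X -> normc (w - z) < d -> `|y - x| < d ->
    normc (phit w y - phit z x) <= e.
Proof.
have [pu _ _ ub] := hu.
apply: qcoef_joint => //.
- by move=> t t0 _; exact: fA_gt0.
- by move=> t t0; exact: (@cont_fA R l).
- by move=> n; exact: prim_cont (pu n).
- by move=> r r0; have [K K0 hK] := ub X r r0; exists K.
Qed.

Let thetat_joint z x (e X : R) : - 2^-1 < l \/ X < 1 -> 0 <= x <= X -> 0 < e ->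
  exists2 d : R, 0 < d & forall w y, 0 <= y <= X -> normc (w - z) < d -> `|y - x| < d ->
    normc (thetat w y - thetat z x) <= e.
Proof.
have [pv _ _ vb] := hv; move=> hX; have [C C0 hC] := fB_le_fb_itv hX.
have F0 t : 0 < t -> t <= X -> 0 < fb l t.
  move=> t0 tX; apply: fb_gt0 => //; case: hX => [|X1]; first by left.
  by right; exact: le_lt_trans X1.
apply: qcoef_joint => //.
- by move=> t t0; exact: (cont_fb hl).
- by move=> n; exact: prim_cont (pv n).
- move=> r r0; have [K K0 hK] := vb X r r0; exists (K * C); first by rewrite mulr_ge0.
  move=> n t t0 tX; apply: le_trans (hK n t t0 tX) _.
  rewrite ler_wpM2r ?invr_ge0 ?exprn_ge0 ?(ltW r0)// -mulrA ler_wpM2l//.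
  exact: hC.
Qed.

Let phit0 z : phit z 0 = 1. Proof. exact: cpow_qcoef0. Qed.
Let thetat0 z : thetat z 0 = 1. Proof. exact: cpow_qcoef0. Qed.

Let phit_lim z (e : R) : 0 < e -> exists2 d, 0 < d &
  forall x, 0 < x -> x <= d -> normc (phit z x - 1) <= e.
Proof.
move=> e0; have [|d d0 hd] := @phit_joint z 0 e 1 _ e0; first by rewrite lexx ler01.
exists (Num.min (d / 2) 1) => [|x x0]; first by rewrite lt_min ltr01 andbT; lra.
rewrite le_min => /andP[xd x1]; rewrite -(phit0 z); apply: hd.
- by rewrite (ltW x0).
- by rewrite subrr ComplexField.Normc.normc0.
- by rewrite subr0 gtr0_norm//; lra.
Qed.

Let thetat_lim z (e : R) : 0 < e -> exists2 d, 0 < d &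
  forall x, 0 < x -> x <= d -> normc (thetat z x - 1) <= e.
Proof.
have h1 : (1 / 2 : R) < 1 by lra.
have h0 : (0 : R) <= 1 / 2 by lra.
move=> e0; have [|d d0 hd] := @thetat_joint z 0 e (1 / 2) (or_intror h1) _ e0.
  by rewrite lexx.
exists (Num.min (d / 2) (1 / 2)) => [|x x0]; first by rewrite lt_min; apply/andP; split; lra.
rewrite le_min => /andP[xd x1]; rewrite -(thetat0 z); apply: hd.
- by rewrite (ltW x0).
- by rewrite subrr ComplexField.Normc.normc0.
- by rewrite subr0 gtr0_norm//; lra.
Qed.

Let phi_solution z : solution l q z (phi z).
Proof.
have [U1 S] := family_csolves qi (@cont_fA R l) hu z; exact: csolves_solution S.
Qed.

Let theta_solution z : solution l q z (theta z).
Proof.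
have [U1 S] := family_csolves qi (cont_fB hl) hv z; exact: csolves_solution S.
Qed.

(** Dividing the relation by [fb] and letting [x] tend to [0] isolates [d], because [fA / fb] tends
    to [0]. Then [c] vanishes because [phi z] has no zero near [0]. *)
Let phi_theta_indep z : lin_indep (phi z) (theta z).
Proof.
move=> c d H; have e0 : 0 < (1 / 2 : R) by lra.
have e1 : (1 / 2 : R) < 1 by lra.
have [d1 d10 h1] := phit_lim z e0.
have nc0 := normc_ge0 c; have nd0 := normc_ge0 d.
have d_eq0 : d = 0.
  apply: ComplexField.Normc.eq0_normc; apply/eqP; rewrite eq_le nd0 andbT leNgt.
  apply/negP => dpos; pose N := normc d + 2 * normc c.
  have N0 : 0 < N by rewrite ltr_pwDl// mulr_ge0.
  (* The error terms [|d| e] and [2 |c| e] add up to [e N = |d| / 2], which contradicts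
     [|d| > 0]. *)
  pose e := normc d / (2 * N); have epos : 0 < e by rewrite divr_gt0// mulr_gt0.
  have [d2 d20 h2] := thetat_lim z epos.
  have [d3 [d30 _ h3]] := fb_fA_large hl e^-1.
  pose x := Num.min d1 (Num.min d2 d3); have x0 : 0 < x by rewrite !lt_min d10 d20.
  have xd1 : x <= d1 by rewrite ge_min lexx.
  have xd2 : x <= d2 by rewrite !ge_min lexx !orbT.
  have xd3 : x <= d3 by rewrite !ge_min lexx !orbT.
  have [fx hx] := h3 x x0 xd3; have Ax := fA_gt0 l x0.
  have := H x x0; rewrite phiE// thetaE ?gt_eqF// => Hx.
  have E : d = d * (1 - thetat z x) - c * phit z x * (fA l x / fb l x)%:C.
    have fC : (fb l x)%:C != 0 by rewrite eq_complex/= gt_eqF.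
    apply: (mulfI fC); rewrite mulrBr.
    have -> : (fb l x)%:C * (c * phit z x * (fA l x / fb l x)%:C) =
        c * ((fA l x)%:C * phit z x).
      rewrite (_ : (fA l x)%:C = (fb l x)%:C * (fA l x / fb l x)%:C); first by ring.
      by rewrite -rmorphM/= mulrC divfK// gt_eqF.
    by apply/eqP; rewrite -subr_eq0; apply/eqP; rewrite -[RHS]Hx; ring.
  have r1 : fA l x / fb l x <= e.
    by rewrite -[_ / _]invf_div invf_ple// posrE divr_gt0.
  have nphi : normc (phit z x) <= 2.
    rewrite -(subrK 1 (phit z x)); apply: le_trans (normcD _ _) _.
    by rewrite ComplexField.Normc.normc1; have := h1 x x0 xd1; lra.
  have r0 : 0 <= fA l x / fb l x by rewrite divr_ge0// ltW.
  have : normc d <= normc d * e + normc c * 2 * e.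
    rewrite {1}E; apply: le_trans (normcB _ _) _; rewrite !normcM normc_real.
    apply: lerD.
      by rewrite ler_wpM2l// -normcN opprB; exact: h2.
    rewrite ger0_norm//; apply: ler_pM => //; first by rewrite mulr_ge0// normc_ge0.
    by rewrite ler_wpM2l.
  have -> : normc d * e + normc c * 2 * e = normc d / 2.
    by rewrite /e /N; field; rewrite gt_eqF.
  by lra.
split=> //; pose x := d1; have := H x d10; rewrite d_eq0 mul0r addr0 phiE//.
move=> /eqP; rewrite mulf_eq0 => /orP[/eqP//|]; rewrite mulf_eq0 => /orP[|/eqP p0].
  by rewrite eq_complex/= gt_eqF// fA_gt0.
have := h1 x d10 (lexx _); rewrite p0 sub0r normcN ComplexField.Normc.normc1 => h.
by move: h; rewrite leNgt e1.
Qed.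

Let phi_entire x : 0 < x -> entire (phi ^~ x).
Proof. by move=> x0; exact: cpow_entire (family_decay hu x0). Qed.

Let theta_entire x : 0 < x -> entire (theta ^~ x).
Proof. by move=> x0; exact: cpow_entire (family_decay hv x0). Qed.

Let phit_continuous : jointly_continuous_on `[0, 1]%classic phit.
Proof.
apply: jointly_continuous_onI => z x e; rewrite /= in_itv/= => xD e0.
have [d d0 hd] := phit_joint z xD e0; exists d => // w y.
Qed.

Let thetat_continuous : - 2^-1 < l -> jointly_continuous_on `[0, 1]%classic thetat.
Proof.
move=> hl'; apply: jointly_continuous_onI => z x e; rewrite /= in_itv/= => xD e0.
have [d d0 hd] := thetat_joint z (or_introl hl') xD e0; exists d => // w y.
Qed.

Let thetat_continuous_log : jointly_continuous_on `[0, 1[%classic thetat.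
Proof.
apply: jointly_continuous_onI => z x e; rewrite /= in_itv/= => /andP[x0 x1] e0.
(* The midpoint of [x] and [1]: the interval [[0, X]] contains a neighbourhood of [x] relative to
   [[0, 1[] and avoids the zero of [fb]. *)
pose X := (x + 1) / 2; have X1 : X < 1 by rewrite /X; lra.
have xX : 0 <= x <= X by apply/andP; split=> //; rewrite /X; lra.
have [d d0 hd] := thetat_joint z (or_intror X1) xX e0.
exists (Num.min d ((1 - x) / 2)) => [|w y]; first by rewrite lt_min d0; lra.
rewrite in_itv/= => /andP[y0 y1]; rewrite !lt_min => /andP[wz _] /andP[yd yx].
apply: hd => //; rewrite y0/=.
by move: yx; rewrite ltr_norml /X => /andP[_]; lra.
Qed.

Let family_bound (w : R -> R) (a a1 : nat -> R -> R) z :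
  coef_family (pot l q) w a a1 -> exists C : R,
  forall x, 0 < x -> x <= 1 -> normc (cpow (a ^~ x) z) <= C * w x.
Proof.
move=> [_ _ _ ab]; have [D [s [D0 s0 hz]]] := growthX z.
have [K K0 hK] := ab 1 (2 * s) (mulr_gt0 (ltr0Sn _ _) s0).
exists (4 * (D * K)) => x x0 x1.
have -> : 4 * (D * K) * w x = 4 * (D * (K * w x)) by ring.
by apply: csum_bound s0 hz _ => // n; exact: hK.
Qed.

Let phi_ratio z : exists U1 Wt (K : R), [/\ csolves l q z (phi z) U1,
    cratio (fA l) (phi z) (phit z) Wt,
    forall x, 0 < x -> x <= 1 -> normc (Wt x) <= K *
      `|x `^ (- (2 * l + 1) - 1) * oint (fun t => t `^ (2 * l + 1) * Gw q t) 0 x| &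
    forall e : R, 0 < e -> exists2 d, 0 < d &
      forall x, 0 < x -> x <= d -> normc (x%:C * Wt x) <= e].
Proof.
have [U1 S] := family_csolves qi (@cont_fA R l) hu z.
have [C hC] := family_bound z hu.
have [Wt [K [h1 h2 h3]]] := complex_regular_ratio hl mq hq S (phiE z) hC.
by exists U1, Wt, K.
Qed.

Let theta_ratio z : - 2^-1 < l -> exists U1 Wt (K : R), [/\ csolves l q z (theta z) U1,
    cratio (fb l) (theta z) (thetat z) Wt,
    forall x, 0 < x -> x <= 1 -> normc (Wt x) <= K *
      `|x `^ (2 * l + 1 - 1) * (1 - sint 1 (fun t => t `^ (- (2 * l + 1)) * Gw q t) x)| &
    forall e : R, 0 < e -> exists2 d, 0 < d &
      forall x, 0 < x -> x <= d -> normc (x%:C * Wt x) <= e].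
Proof.
move=> hl'; have [U1 S] := family_csolves qi (cont_fB hl) hv z.
have [C hC] := family_bound z hv.
have hC' x : 0 < x -> x <= 1 -> normc (theta z x) <= C * x `^ (- l).
  by move=> x0 x1; have := hC x x0 x1; rewrite /fB /lw hl' mulr1.
have E x : 0 < x -> theta z x = (fb l x)%:C * thetat z x.
  by move=> x0; apply: thetaE => //; rewrite gt_eqF// fb_gt0//; left.
have [Wt [K [h1 h2 h3]]] := complex_singular_ratio hl mq hq S hl' E hC'.
by exists U1, Wt, K.
Qed.

Hypothesis p1 : (1 <= p)%E.
Hypothesis qp : Lp01 p (fun t => t * q t).
Hypothesis qlog : 2 * l + 1 = 0 -> p = 1%:E -> itg (fun t => - ln t * Gw q t) 0 1.

Let phit_W1p z : W1p01 p (phit z).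
Proof.
have b0 : 0 <= 2 * l + 1 by have := hl; lra.
have [U1 [Wt [K [S Q bW _]]]] := phi_ratio z.
have GLp := Lp01_norm_add1 (measurable_idM mq) p1 qp.
have h0 := hardy0 (Gw_meas mq) (Gw_ge0 q) b0 p1 (Gw_itg mq hq) GLp qlog.
have H := W1p01I p1 Q (hardy0_meas mq hq b0) h0 bW; apply: H.
by move=> e /(phit_lim z)[d d0 hd]; exists d => // x x0 xd; rewrite phit0 hd.
Qed.

Let thetat_W1p z (r : \bar R) : - 2^-1 < l -> (1 <= r)%E -> (r <= p)%E ->
  (forall s, r = s%:E -> s * (1 - (2 * l + 1)) < 1) -> (r = +oo%E -> 1 < 2 * l + 1) ->
  W1p01 r (thetat z).
Proof.
move=> hl' r1 rp rs ry; have g0 : 0 < 2 * l + 1 by lra.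
have [U1 [Wt [K [S Q bW _]]]] := theta_ratio z hl'.
have GLp := Lp01_norm_add1_le (measurable_idM mq) r1 rp qp.
have h0 := hardy1 (Gw_meas mq) (Gw_ge0 q) g0 r1 (Gw_itg mq hq) GLp rs ry.
have H := W1p01I r1 Q (hardy1_meas mq hq (2 * l + 1)) h0 bW; apply: H.
by move=> e /(thetat_lim z)[d d0 hd]; exists d => // x x0 xd; rewrite thetat0 hd.
Qed.

Let phit_flat z : tends_to_at0 (fun x => x%:C * cderive (phit z) x) 0.
Proof.
have [U1 [Wt [K [S Q _ W0]]]] := phi_ratio z.
apply: tends_to_at0I => e /W0[d d0 hd]; exists d => // x x0 xd.
by rewrite subr0 (cratio_cderive Q x0).2 hd.
Qed.

Let thetat_flat z : - 2^-1 < l -> tends_to_at0 (fun x => x%:C * cderive (thetat z) x) 0.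
Proof.
move=> hl'; have [U1 [Wt [K [S Q _ W0]]]] := theta_ratio z hl'.
apply: tends_to_at0I => e /W0[d d0 hd]; exists d => // x x0 xd.
by rewrite subr0 (cratio_cderive Q x0).2 hd.
Qed.

(** By the product rule the Wronskian is [thetat phit], with the free Wronskian [1] as factor, plus
    [fA fb] times the Wronskian of [thetat] and [phit]. As [fA fb = x / (2 l + 1)], the second part
    tends to [0] with [x thetat'] and [x phit']; equality of the two spectral parameters is
    irrelevant here. *)
Let wronskian_lim z zeta : - 2^-1 < l -> tends_to_at0 (wronskian (theta z) (phi zeta)) 1.
Proof.
move=> hl'; have g0 : 0 < 2 * l + 1 by lra.
have [U1 [Ut [_ [SU QU _ U0]]]] := phi_ratio zeta.
have [V1 [Vt [_ [SV QV _ V0']]]] := theta_ratio z hl'.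
(* [3] from the errors [2 e'] and [e'] in [thetat phit - 1], and [4 / (2 l + 1)] from the two
   products of size [2 e'] carrying the factor [1 / (2 l + 1)]. *)
pose N := 3 + 4 / (2 * l + 1).
have N0 : 0 < N by rewrite ltr_pwDl// divr_ge0// ltW.
apply: tends_to_at0I => e e0; pose e' := Num.min 1 (e / N).
have e'0 : 0 < e' by rewrite lt_min ltr01 divr_gt0.
have e'1 : e' <= 1 by rewrite ge_min lexx.
have e'e : e' * N <= e by rewrite -ler_pdivlMr// ge_min lexx orbT.
have [d1 d10 h1] := phit_lim zeta e'0; have [d2 d20 h2] := thetat_lim z e'0.
have [d3 d30 h3] := U0 _ e'0; have [d4 d40 h4] := V0' _ e'0.
exists (Num.min (Num.min d1 d2) (Num.min d3 d4)); first by rewrite !lt_min d10 d20 d30.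
move=> x x0; rewrite !le_min => /andP[/andP[xd1 xd2] /andP[xd3 xd4]].
have E : wronskian (theta z) (phi zeta) x - 1 =
    (thetat z x * (phit zeta x - 1) + (thetat z x - 1)) +
    ((2 * l + 1)^-1)%:C * (thetat z x * (x%:C * Ut x) - x%:C * Vt x * phit zeta x).
  have := wronskian_free hl x0; have := fAB l x0; rewrite /fB /lw hl' mulr1 mulr1.
  rewrite /wronskian (csolves_cderive SU x0).2 (csolves_cderive SV x0).2.
  rewrite (cratio_derivative SU (@prim_fA R l) (prim_cont (@prim_fA1 R l)) QU x0).
  rewrite (cratio_derivative SV (prim_fb hl) (prim_cont (prim_fb1 hl)) QV x0).
  have [_ _ _ _ /(_ x x0) ->] := QU; have [_ _ _ _ /(_ x x0) ->] := QV.
  have -> : x `^ (- l) = (2 * l + 1) * fb l x.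
    by rewrite /fb hl' mulrCA divff ?mulr1// gt_eqF.
  move=> hAB hW.
  have hAB' : (fA l x)%:C * (fb l x)%:C = ((2 * l + 1)^-1)%:C * x%:C.
    rewrite -!rmorphM/= -{3}hAB; congr (_%:C); field.
    by rewrite gt_eqF.
  have hW' : (fb l x)%:C * (fA1 l x)%:C - (fb1 l x)%:C * (fA l x)%:C = 1.
    by rewrite -!rmorphM -rmorphB hW.
  move: hAB' hW' (thetat z x) (phit zeta x) (Ut x) (Vt x).
  move: (fA l x)%:C (fb l x)%:C (fA1 l x)%:C (fb1 l x)%:C ((2 * l + 1)^-1)%:C (x%:C).
  move=> A B A1 B1 G X hAB' hW' tt pp Up Vp.
  have -> : G * (tt * (X * Up) - X * Vp * pp) = A * B * (tt * Up - Vp * pp).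
    by rewrite hAB'; ring.
  have -> : tt * (pp - 1) + (tt - 1) = tt * pp * 1 - 1 by ring.
  by rewrite -hW'; ring.
have tb (a : R[i]) : normc (a - 1) <= e' -> normc a <= 2.
  move=> ha; rewrite -(subrK 1 a); apply: le_trans (normcD _ _) _.
  by rewrite ComplexField.Normc.normc1; lra.
have t2 := tb _ (h2 x x0 xd2); have p2 := tb _ (h1 x x0 xd1).
have i1 : normc (thetat z x * (phit zeta x - 1)) <= 2 * e'.
  by rewrite normcM; apply: ler_pM; rewrite ?normc_ge0//; exact: h1.
have i3 : normc (thetat z x * (x%:C * Ut x)) <= 2 * e'.
  by rewrite normcM; apply: ler_pM; rewrite ?normc_ge0//; exact: h3.
have i4 : normc (x%:C * Vt x * phit zeta x) <= 2 * e'.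
  by rewrite normcM mulrC; apply: ler_pM; rewrite ?normc_ge0//; exact: h4.
rewrite E; apply: le_trans (normcD _ _) _; apply: le_trans e'e.
have -> : e' * N = (2 * e' + e') + (2 * l + 1)^-1 * (2 * e' + 2 * e').
  by rewrite /N; field; rewrite gt_eqF.
apply: lerD.
  by apply: le_trans (normcD _ _) _; apply: lerD => //; exact: h2.
rewrite normcM normc_real gtr0_norm ?invr_gt0// ler_wpM2l ?invr_ge0 ?(ltW g0)//.
by apply: le_trans (normcB _ _) _; exact: lerD.
Qed.

(** Only the coefficient families and the integrability facts common to the three alternatives on
    [q] enter here, so that the construction is carried out once for all of them. *)
Lemma fundamental_system : exists phi theta phit thetat : R[i] -> R -> R[i],
    [/\ forall z, [/\ solution l q z (phi z), solution l q z (theta z) &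
                      lin_indep (phi z) (theta z)],
        forall z,
          [/\ forall x, 0 < x -> phi z x = (x `^ (l + 1))%:C * phit z x,
              - 2^-1 < l -> forall x, 0 < x ->
                theta z x = (x `^ (- l) / (2 * l + 1))%:C * thetat z x,
              l = - 2^-1 -> forall x, 0 < x -> x != 1 ->
                theta z x = (- ln x * x `^ 2^-1)%:C * thetat z x &
              phit z 0 = 1 /\ thetat z 0 = 1],
        forall z,
          [/\ W1p01 p (phit z),
              0 < l -> W1p01 p (thetat z),
              - 2^-1 < l -> l <= 0 ->
                forall r : \bar R, (1 <= r)%E -> (r <= p)%E ->
                (if l == 0 then (r < +oo)%E else (r < (- 1 / (2 * l))%:E)%E) ->
                W1p01 r (thetat z) &
              l = - 2^-1 -> continuous_on `[0, 1[%classic (thetat z)],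
        - 2^-1 < l ->
          [/\ forall z, tends_to_at0 (fun x => x%:C * cderive (phit z) x) 0,
              forall z, tends_to_at0 (fun x => x%:C * cderive (thetat z) x) 0 &
              forall z zeta, tends_to_at0 (wronskian (theta z) (phi zeta)) 1] &
        [/\ forall x, 0 < x -> entire (phi ^~ x),
            forall x, 0 < x -> entire (theta ^~ x),
            jointly_continuous_on `[0, 1]%classic phit,
            - 2^-1 < l -> jointly_continuous_on `[0, 1]%classic thetat &
            l = - 2^-1 -> jointly_continuous_on `[0, 1[%classic thetat]].
Proof.
exists phi, theta, phit, thetat; split.
- move=> z; split; [exact: phi_solution|exact: theta_solution|exact: phi_theta_indep].
- move=> z; split.
  + exact: phiE.
  + move=> hl' x x0; rewrite thetaE//; last by rewrite gt_eqF// fb_gt0//; left.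
    by rewrite /fb hl'.
  + move=> lE x x0 x1; rewrite thetaE//; first by rewrite /fb lE ltxx.
    rewrite /fb lE ltxx mulf_neq0//; last by rewrite gt_eqF// powR_gt0.
    by rewrite oppr_eq0 ln_eq0.
  + by split; [exact: phit0|exact: thetat0].
- move=> z; split.
  + exact: phit_W1p.
  (* For [l > 0] the condition on the exponent reads [- 2 l s < 1] and always holds: the factor
     [x ^ (2 l)] is bounded, so the full range up to [p] is reached. *)
  + move=> l0; apply: thetat_W1p => //; [by lra|move=> s ps|move=> _; by lra].
    have s1 : 1 <= s by move: p1; rewrite ps lee_fin.
    by nra.
  + move=> hl' l0 r r1 rp hr; apply: thetat_W1p => //.
      move=> s rs; move: hr; rewrite rs; case: eqP => [-> _|/eqP ln0].
        by lra.
      have {}l0 : l < 0 by rewrite lt_neqAle ln0.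
      rewrite lte_fin mulN1r -invrN -[_^-1]mul1r ltr_pdivlMr; last by lra.
      by lra.
    by move=> re; move: hr; rewrite re; case: eqP; rewrite ?ltxx.
  + by move=> _; apply: jointly_continuous_slice; exact: thetat_continuous_log.
- move=> hl'; split.
  + exact: phit_flat.
  + by move=> z; exact: thetat_flat.
  + by move=> z zeta; exact: wronskian_lim.
- split.
  + exact: phi_entire.
  + exact: theta_entire.
  + exact: phit_continuous.
  + exact: thetat_continuous.
  + by move=> _; exact: thetat_continuous_log.
Qed.

End Assembly.

(* For l = -1/2 the factor - ln x vanishes at x = 1, so there the function
   thetat z is required to be continuous on [0, 1[ only; continuity at 1 would
   force theta z 1 = 0, which fails whenever phi z 1 = 0. *)
Theorem lemma3p2 (R : realType) (l : R) (p : \bar R) (q : R -> R)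
  (q_loc : locally_integrable `]0, +oo[%classic q)
  (hyp : [\/ [/\ - 2^-1 < l, (1 <= p)%E & Lp01 p (fun x => x * q x)],
             [/\ l = - 2^-1, (1 < p)%E & Lp01 p (fun x => x * q x)] |
             [/\ l = - 2^-1, p = 1%:E &
                 Lp01 1%:E (fun x => (1 - ln x) * x * q x)]]) :
  exists phi theta phit thetat : R[i] -> R -> R[i],
    [/\ forall z, [/\ solution l q z (phi z), solution l q z (theta z) &
                      lin_indep (phi z) (theta z)],
        forall z,
          [/\ forall x, 0 < x -> phi z x = (x `^ (l + 1))%:C * phit z x,
              - 2^-1 < l -> forall x, 0 < x ->
                theta z x = (x `^ (- l) / (2 * l + 1))%:C * thetat z x,
              l = - 2^-1 -> forall x, 0 < x -> x != 1 ->
                theta z x = (- ln x * x `^ 2^-1)%:C * thetat z x &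
              phit z 0 = 1 /\ thetat z 0 = 1],
        forall z,
          [/\ W1p01 p (phit z),
              0 < l -> W1p01 p (thetat z),
              - 2^-1 < l -> l <= 0 ->
                forall r : \bar R, (1 <= r)%E -> (r <= p)%E ->
                (if l == 0 then (r < +oo)%E else (r < (- 1 / (2 * l))%:E)%E) ->
                W1p01 r (thetat z) &
              l = - 2^-1 -> continuous_on `[0, 1[%classic (thetat z)],
        - 2^-1 < l ->
          [/\ forall z, tends_to_at0 (fun x => x%:C * cderive (phit z) x) 0,
              forall z, tends_to_at0 (fun x => x%:C * cderive (thetat z) x) 0 &
              forall z zeta, tends_to_at0 (wronskian (theta z) (phi zeta)) 1] &
        [/\ forall x, 0 < x -> entire (phi ^~ x),
            forall x, 0 < x -> entire (theta ^~ x),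
            jointly_continuous_on `[0, 1]%classic phit,
            - 2^-1 < l -> jointly_continuous_on `[0, 1]%classic thetat &
            l = - 2^-1 -> jointly_continuous_on `[0, 1[%classic thetat]].
Proof.
have [mq qi] := locally_integrable_itg q_loc.
(* The three alternatives are reduced to five common facts; [qlog] carries content in the third one,
   while in the others its premises are contradictory. *)
have [hl p1 hq qp qlog] : [/\ - 2^-1 <= l, (1 <= p)%E,
    forall X, itg (fun t => fA l t * fB l t * q t) 0 X,
    Lp01 p (fun t => t * q t) &
    2 * l + 1 = 0 -> p = 1%:E -> itg (fun t => - ln t * Gw q t) 0 1].
  case: hyp => [[hl p1 qp]|[lE p1 qp]|[lE -> qp]].
  - split=> //; [exact: ltW|exact: (singular_weights mq qi hl p1 qp)|].
    by move=> h; exfalso; move: h hl; lra.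
  - split=> //; [by rewrite lE|exact: ltW| |].
      by apply: weight_itg => //; [rewrite lE|exact: lw_log_itg p1 qp].
    by move=> _ pE; move: p1; rewrite pE ltxx.
  - have [h1 h2 h3] := log_weights mq qi lE qp.
    by split=> //; rewrite lE.
have [f [f1 [pf pf1 hf hf0]]] := regular_solution hl mq hq.
have [g [g1 [pg pg1 W hg hg0]]] := singular_solution hl mq hq pf pf1 hf0.
have [u [u1 [hu u0 uS]]] := phi_coef hl pf pf1 pg pg1 W hf hg.
have [v [v1 [hv v0 vS]]] := theta_coef hl pf pf1 pg pg1 W hf hg.
have [C [d [C0 d0 hd]]] := fB_le_fb hl.
apply: (fundamental_system hl mq qi hq hu hv _ _ _ _ p1 qp qlog).
- move=> e e0; have [c [c0 _ hc]] := hf0 e e0.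
  by exists c => // x x0 xc; rewrite u0 hc.
- move=> n e e0; have [c c0 hc] := uS n e e0; exists c => // x x0 xc.
  have A0 := fA_gt0 l x0.
  by rewrite normrM normfV (gtr0_norm A0) ler_pdivrMr// hc.
- move=> e e0; have [c [c0 _ hc]] := hg0 e e0.
  by exists c => // x x0 xc; rewrite v0; exact: (hc x x0 xc).2.
(* The coefficients of [theta] are small relative to [fB], but the quotient is taken by [fb];
   dividing [e] by the constant [C] of [fB <= C fb] near [0] makes up for this. *)
- move=> n e e0; have eC : 0 < e / C by rewrite divr_gt0.
  have [c c0 hc] := vS n _ eC; have [c' [c'0 _ hc']] := hg0 1 ltr01.
  exists (Num.min (Num.min c c') d) => [|x x0]; first by rewrite !lt_min c0 c'0.
  rewrite !le_min => /andP[/andP[xc xc'] xd]; have [F0 _] := hc' x x0 xc'.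
  rewrite normrM normfV (gtr0_norm F0) ler_pdivrMr//.
  apply: le_trans (hc x x0 xc) _; rewrite -mulrA ler_wpM2l ?(ltW e0)//.
  by rewrite ler_pdivrMl//; exact: hd.
Qed.
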